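(* Let $V$ be an $\mathbb{R}$-vector space of finite dimension $n$, let $N$ be a $\mathbb{Z}$-structure on $V$, let $\Sigma$ be an $N$-fan in $V$, let $S$ be a scheme, and let $X_\Sigma(S)$ be the toric scheme over $S$ associated with $\Sigma$. Then: a) Let $k\in\mathbb{N}$. If ($S$ has $(R_k)$ and $\Sigma$ is $N$-regular), or $S=\emptyset$, or $\Sigma=\emptyset$, then $X_\Sigma(S)$ has $(R_k)$; if $k\ge n$ then the converse holds. b) $X_\Sigma(S)$ is regular if and only if ($S$ is regular and $\Sigma$ is $N$-regular), or $S=\emptyset$, or $\Sigma=\emptyset$.
   Context: Toric schemes. A $\mathbb{Z}$-structure on $V$ is a subgroup $N$ of the additive group of $V$ with $\langle N\rangle_{\mathbb{R}}=V$ and $\operatorname{rk}_{\mathbb{Z}}(N)=n=\dim_{\mathbb{R}}(V)$; $M=N^*$ is the dual $\mathbb{Z}$-structure on $V^*$, $M=\{u\in V^*\mid u(N)\subseteq\mathbb{Z}\}$. For $A\subseteq V$ put $A^\vee=\{u\in V^*\mid u(A)\subseteq\mathbb{R}_{\ge 0}\}$ and $A^\vee_M=A^\vee\cap M$. An $N$-polycone in $V$ is a set of the form $\operatorname{cone}(A)$ (nonnegative real linear combinations of $A$) with $A\subseteq N$ finite, that does not contain a line. A face of an $N$-polycone $\sigma$ is a set $\sigma\cap\operatorname{Ker}(u)$ with $u\in\sigma^\vee_M$. An $N$-fan is a finite (possibly empty) set $\Sigma$ of $N$-polycones such that $\sigma\cap\tau\in\operatorname{face}(\sigma)\subseteq\Sigma$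 for all $\sigma,\tau\in\Sigma$, where $\operatorname{face}(\sigma)$ is the set of faces of $\sigma$. It is $N$-regular if every $\sigma\in\Sigma$ is generated (as a cone) by a subset of a $\mathbb{Z}$-basis of $N$. If $\tau$ is a face of $\sigma$, then $\sigma^\vee_M$ is a submonoid of $\tau^\vee_M$ and the induced $\operatorname{Spec}(\mathbb{Z}[\tau^\vee_M])\to\operatorname{Spec}(\mathbb{Z}[\sigma^\vee_M])$ is an open immersion. $X_\Sigma(\mathbb{Z})$ is the scheme obtained by gluing the affine schemes $X_\sigma(\mathbb{Z})=\operatorname{Spec}(\mathbb{Z}[\sigma^\vee_M])$, $\sigma\in\Sigma$, along the open subschemes $X_{\sigma\cap\tau}(\mathbb{Z})$ ($\mathbb{Z}[\cdot]$ denoting monoid algebras). For a scheme $S$, $X_\Sigma(S)=X_\Sigma(\mathbb{Z})\times_{\mathbb{Z}}S$. Regularity. For $k\in\mathbb{N}$ a scheme $X$ has $(R_k)$ if it is locally noetherian and $\mathcal{O}_{X,x}$ is regular for every $x\in X$ with $\dim(\mathcal{O}_{X,x})\le k$. A scheme is regular if it has $(R_k)$ for every $k\in\mathbb{N}$. *)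

(* Defs.v *)
From HB Require Import structures.
From mathcomp Require Import all_boot all_order all_algebra.
From mathcomp Require Import generic_quotient ring_quotient finmap monalg.
From mathcomp Require Import boolp classical_sets functions cardinality filter.
From mathcomp Require Import reals topology.
From mathcomp Require Import ring.

Set Implicit Arguments.
Unset Strict Implicit.
Unset Printing Implicit Defensive.

Import Order.TTheory GRing.Theory Num.Theory.

Local Open Scope ring_scope.
Local Open Scope quotient_scope.
Local Open Scope classical_set_scope.

(** * Commutative algebra *)

Section Rings.
Variable A : comNzRingType.

Definition invertible (a : A) : Prop := exists b, a * b = 1.

Definition local_ring : Prop :=
  forall a b : A, invertible (a + b) -> invertible a \/ invertible b.

Definition prime_ideal (p : {pred A}) : Prop :=
  idealr_closed p /\ prime_idealr_closed p.

(* Unlike [idealr_closed], this does not exclude the unit ideal. *)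
Definition ideal (I : {pred A}) : Prop :=
  0 \in I /\ forall a, {in I &, forall u v, a * u + v \in I}.

Definition ideal_gen (s : seq A) : set A :=
  [set a | exists c : 'I_(size s) -> A, a = \sum_i c i * s`_i].

Definition noetherian : Prop :=
  forall I : {pred A}, ideal I ->
    exists s : seq A, forall a, a \in I <-> ideal_gen s a.

Definition prime_chain (d : nat) : Prop :=
  exists p : nat -> {pred A},
    (forall i, (i <= d)%N -> prime_ideal (p i)) /\
    (forall i, (i < d)%N ->
       {subset p i <= p i.+1} /\ exists a, a \in p i.+1 /\ a \notin p i).

Definition krull_dim_le (d : nat) : Prop := ~ prime_chain d.+1.

Definition krull_dim (d : nat) : Prop := prime_chain d /\ krull_dim_le d.

(* A noetherian local ring whose maximal ideal (the set of its non-units) can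
   be generated by as many elements as its Krull dimension. *)
Definition regular_local_ring : Prop :=
  [/\ local_ring, noetherian &
      exists s : seq A, krull_dim (size s) /\
        forall a, ~ invertible a <-> ideal_gen s a].

End Rings.

Lemma invertible_rmorph (A B : comNzRingType) (f : {rmorphism A -> B}) a :
  invertible a -> invertible (f a).
Proof. by case=> b ab; exists (f b); rewrite -rmorphM ab rmorph1. Qed.

(** * The prime spectrum and localization at a prime *)

Record Spec_pt (A : comNzRingType) := SpecPt {
  pt_ideal : A -> bool;
  pt_prime : prime_ideal pt_ideal }.

Coercion pt_pred (A : comNzRingType) (p : Spec_pt A) : {pred A} := pt_ideal p.

Section Spectrum.
Variable A : comNzRingType.
Implicit Types p q : Spec_pt A.

Lemma Spec_pt_eq p q : (forall a, (a \in p) = (a \in q)) -> p = q.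
Proof.
case: p q => [p hp] [q hq] /= e.
have {}e : p = q by apply/funext => a; exact: e.
by case: _ / e hq => hq; congr SpecPt; exact: Prop_irrelevance.
Qed.

HB.instance Definition _ := gen_eqMixin (Spec_pt A).
HB.instance Definition _ := gen_choiceMixin (Spec_pt A).

Lemma pt0 p : 0 \in p. Proof. by case: (pt_prime p) => -[]. Qed.

Lemma pt1 p : 1 \notin p. Proof. by case: (pt_prime p) => -[]. Qed.

Lemma ptD p a b : a \in p -> b \in p -> a + b \in p.
Proof.
by case: (pt_prime p) => -[_ _ h] _ ha hb; rewrite -[a]mul1r; exact: h.
Qed.

Lemma ptMl p a b : b \in p -> a * b \in p.
Proof.
case: (pt_prime p) => -[h0 _ h] _ hb; rewrite -[a * b]addr0; exact: h.
Qed.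

Lemma ptM p a b : (a * b \in p) = (a \in p) || (b \in p).
Proof.
apply/idP/orP => [ab|[h|h]]; last exact: ptMl.
- by case: (pt_prime p) => _ /(_ _ _ ab) /orP.
- by rewrite mulrC; exact: ptMl.
Qed.

Lemma ptMn p a b : a \notin p -> b \notin p -> a * b \notin p.
Proof. by move=> ha hb; rewrite ptM negb_or ha. Qed.

(* Zariski topology: the open sets are the complements of the V(E). *)
Definition zariski_open : set_system (Spec_pt A) :=
  [set U | exists E : set A, U = [set p : Spec_pt A | exists2 a, E a & a \notin p]].

Lemma zariski_openT : zariski_open setT.
Proof.
exists [set 1]; apply/esym/seteqP; split => // p _ /=.
by exists 1 => //; exact: pt1.
Qed.

Lemma zariski_openI : setI_closed zariski_open.
Proof.
move=> _ _ [E ->] [F ->].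
exists [set c | exists a b, [/\ E a, F b & c = a * b]].
apply/seteqP; split => p /=.
  case=> -[a Ea ap] [b Fb bp]; exists (a * b); last exact: ptMn.
  by exists a, b.
case=> _ [a [b [Ea Fb ->]]]; rewrite ptM negb_or => /andP[ap bp].
by split; [exists a|exists b].
Qed.

Lemma zariski_open_bigU (I : Type) (f : I -> set (Spec_pt A)) :
  (forall i, zariski_open (f i)) -> zariski_open (\bigcup_i f i).
Proof.
move=> fo; exists [set a | exists2 E : set A,
  (exists i, f i = [set p : Spec_pt A | exists2 a, E a & a \notin p]) & E a].
apply/seteqP; split => p /=.
  case=> i _ fip; have [E fE] := fo i; move: fip; rewrite fE => -[a Ea ap].
  by exists a => //; exists E => //; exists i.
case=> a [E [i fE] Ea] ap; exists i => //; rewrite fE; by exists a.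
Qed.

HB.instance Definition _ := isOpenTopological.Build (Spec_pt A)
  zariski_openT zariski_openI zariski_open_bigU.

Lemma open_basic (a : A) : open [set p : Spec_pt A | a \notin p].
Proof.
exists [set a]; apply/seteqP; split => p /= => [ap|[_ -> //]].
by exists a.
Qed.

End Spectrum.

Section Localization.
Variables (A : comNzRingType) (p : Spec_pt A).

Definition denom := {s : A | s \notin p}.

Definition loc_rel (x y : A * denom) : bool :=
  `[< exists u, u \notin p /\
        u * (x.1 * val y.2) = u * (y.1 * val x.2) >].

Lemma loc_rel_refl : reflexive loc_rel.
Proof. by move=> x; apply/asboolP; exists 1; split => //; exact: pt1. Qed.

Lemma loc_rel_sym : symmetric loc_rel.
Proof.
by move=> x y; apply/asboolP/asboolP => -[u [up e]]; exists u; rewrite e.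
Qed.

Lemma loc_rel_trans : transitive loc_rel.
Proof.
move=> y x z /asboolP[u [up xy]] /asboolP[v [vp yz]]; apply/asboolP.
exists (u * v * val y.2); split; first by rewrite !ptMn ?(valP y.2).
transitivity (v * val z.2 * (u * (x.1 * val y.2))).
  by ring.
rewrite xy; transitivity (u * val x.2 * (v * (y.1 * val z.2))); first by ring.
by rewrite yz; ring.
Qed.

Canonical loc_equiv := EquivRel loc_rel loc_rel_refl loc_rel_sym loc_rel_trans.

Definition loc := {eq_quot loc_equiv}.
HB.instance Definition _ := EqQuotient.on loc.
HB.instance Definition _ := Choice.on loc.

Definition lfrac (a s : A) (sp : s \notin p) : loc := \pi_loc (a, exist _ s sp).

Lemma lfracP a s sp b t tp : @lfrac a s sp = @lfrac b t tp <->
  exists u, u \notin p /\ u * (a * t) = u * (b * s).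
Proof.
split => [/eqmodP /asboolP //|h]; apply/eqmodP; exact/asboolP.
Qed.

Lemma lfrac_eq a s sp b t tp : a * t = b * s -> @lfrac a s sp = @lfrac b t tp.
Proof. by move=> e; apply/lfracP; exists 1; rewrite e; split=> //; exact: pt1. Qed.

Lemma lfrac_surj x : exists a s sp, x = @lfrac a s sp.
Proof.
exists (repr x).1, (val (repr x).2), (valP (repr x).2).
rewrite /lfrac -[LHS]reprK; congr \pi; case: (repr x) => a [s sp] /=.
by congr (_, exist _ _ _); exact: Prop_irrelevance.
Qed.

Definition loc0 : loc := lfrac 0 (pt1 p).
Definition loc1 : loc := lfrac 1 (pt1 p).
Definition loc_opp (x : loc) : loc :=
  lfrac (- (repr x).1) (valP (repr x).2).
Definition loc_add (x y : loc) : loc :=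
  lfrac ((repr x).1 * val (repr y).2 + (repr y).1 * val (repr x).2)
    (ptMn (valP (repr x).2) (valP (repr y).2)).
Definition loc_mul (x y : loc) : loc :=
  lfrac ((repr x).1 * (repr y).1) (ptMn (valP (repr x).2) (valP (repr y).2)).

Lemma repr_lfrac a s sp : exists u, u \notin p /\
  u * ((repr (@lfrac a s sp)).1 * s) =
  u * (a * val (repr (@lfrac a s sp)).2).
Proof.
have /eqmodP /asboolP // : repr (@lfrac a s sp) = (a, exist _ s sp) %[mod loc].
by rewrite reprK.
Qed.

Lemma loc_oppE a s sp : loc_opp (@lfrac a s sp) = lfrac (- a) sp.
Proof.
have [u [up e]] := repr_lfrac a sp.
apply/lfracP; exists u; split => //.
by rewrite !mulNr !mulrN e.
Qed.

Lemma loc_addE a s sp b t tp : loc_add (@lfrac a s sp) (@lfrac b t tp) =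
  lfrac (a * t + b * s) (ptMn sp tp).
Proof.
rewrite /loc_add.
have [u [up]] := repr_lfrac a sp; have [v [vp]] := repr_lfrac b tp.
case: (repr _) => b' [t' tp'] /=; case: (repr _) => a' [s' sp'] /= e2 e1.
apply/lfracP; exists (u * v); split; first exact: ptMn.
transitivity (u * (a' * s) * (v * t * t') + v * (b' * t) * (u * s * s')).
  by ring.
by rewrite e1 e2; ring.
Qed.

Lemma loc_mulE a s sp b t tp : loc_mul (@lfrac a s sp) (@lfrac b t tp) =
  lfrac (a * b) (ptMn sp tp).
Proof.
rewrite /loc_mul.
have [u [up]] := repr_lfrac a sp; have [v [vp]] := repr_lfrac b tp.
case: (repr _) => b' [t' tp'] /=; case: (repr _) => a' [s' sp'] /= e2 e1.
apply/lfracP; exists (u * v); split; first exact: ptMn.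
transitivity (u * (a' * s) * (v * (b' * t))); first by ring.
by rewrite e1 e2; ring.
Qed.

Lemma loc_addA : associative loc_add.
Proof.
move=> x y z; have [a [s [sp ->]]] := lfrac_surj x.
have [b [t [tp ->]]] := lfrac_surj y; have [c [r [rp ->]]] := lfrac_surj z.
by rewrite !loc_addE; apply: lfrac_eq; ring.
Qed.

Lemma loc_addC : commutative loc_add.
Proof.
move=> x y; have [a [s [sp ->]]] := lfrac_surj x.
have [b [t [tp ->]]] := lfrac_surj y.
by rewrite !loc_addE; apply: lfrac_eq; ring.
Qed.

Lemma loc_add0 : left_id loc0 loc_add.
Proof.
move=> x; have [a [s [sp ->]]] := lfrac_surj x.
by rewrite loc_addE; apply: lfrac_eq; ring.
Qed.

Lemma loc_addN : left_inverse loc0 loc_opp loc_add.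
Proof.
move=> x; have [a [s [sp ->]]] := lfrac_surj x.
by rewrite loc_oppE loc_addE; apply: lfrac_eq; ring.
Qed.

HB.instance Definition _ :=
  GRing.isZmodule.Build loc loc_addA loc_addC loc_add0 loc_addN.

Lemma loc_mulA : associative loc_mul.
Proof.
move=> x y z; have [a [s [sp ->]]] := lfrac_surj x.
have [b [t [tp ->]]] := lfrac_surj y; have [c [r [rp ->]]] := lfrac_surj z.
by rewrite !loc_mulE; apply: lfrac_eq; ring.
Qed.

Lemma loc_mulC : commutative loc_mul.
Proof.
move=> x y; have [a [s [sp ->]]] := lfrac_surj x.
have [b [t [tp ->]]] := lfrac_surj y.
by rewrite !loc_mulE; apply: lfrac_eq; ring.
Qed.

Lemma loc_mul1 : left_id loc1 loc_mul.
Proof.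
move=> x; have [a [s [sp ->]]] := lfrac_surj x.
by rewrite loc_mulE; apply: lfrac_eq; ring.
Qed.

Lemma loc_mulDl : left_distributive loc_mul loc_add.
Proof.
move=> x y z; have [a [s [sp ->]]] := lfrac_surj x.
have [b [t [tp ->]]] := lfrac_surj y; have [c [r [rp ->]]] := lfrac_surj z.
by rewrite !(loc_mulE, loc_addE); apply: lfrac_eq; ring.
Qed.

Lemma loc1_neq0 : loc1 != 0 :> loc.
Proof.
apply/eqP => /lfracP [u [up]]; rewrite mul1r mul0r mulr0 mulr1 => u0.
by move: up; rewrite u0 pt0.
Qed.

HB.instance Definition _ := GRing.Zmodule_isComNzRing.Build loc
  loc_mulA loc_mulC loc_mul1 loc_mulDl loc1_neq0.

Lemma lfracB a s sp b t tp : @lfrac a s sp - @lfrac b t tp =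
  lfrac (a * t - b * s) (ptMn sp tp).
Proof.
have -> : - lfrac b tp = lfrac (- b) tp by exact: loc_oppE.
by rewrite -mulNr; exact: loc_addE.
Qed.

Lemma lfracM a s sp b t tp : @lfrac a s sp * @lfrac b t tp =
  lfrac (a * b) (ptMn sp tp).
Proof. exact: loc_mulE. Qed.

Lemma lfrac11 : lfrac 1 (pt1 p) = 1. Proof. by []. Qed.

Definition to_loc (a : A) : loc := lfrac a (pt1 p).

Lemma to_loc_is_zmod_morphism : zmod_morphism to_loc.
Proof. by move=> a b; rewrite /to_loc lfracB; apply: lfrac_eq; ring. Qed.

Lemma to_loc_is_monoid_morphism : monoid_morphism to_loc.
Proof.
by split => // a b; rewrite /to_loc lfracM; apply: lfrac_eq; ring.
Qed.

HB.instance Definition _ := GRing.isZmodMorphism.Build A loc to_loc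
  to_loc_is_zmod_morphism.
HB.instance Definition _ := GRing.isMonoidMorphism.Build A loc to_loc
  to_loc_is_monoid_morphism.

Lemma to_locB a b : to_loc (a - b) = to_loc a - to_loc b.
Proof. exact: rmorphB. Qed.

Lemma to_locM a b : to_loc (a * b) = to_loc a * to_loc b.
Proof. exact: rmorphM. Qed.

Lemma lfrac_mul a s sp : @lfrac a s sp * to_loc s = to_loc a.
Proof. by rewrite /to_loc lfracM; apply: lfrac_eq; ring. Qed.

Lemma invertible_lfrac a s sp : invertible (@lfrac a s sp) <-> a \notin p.
Proof.
split => [[y]|ap].
  have [b [t [tp ->]]] := lfrac_surj y.
  rewrite lfracM => /lfracP [u [up]]; rewrite !mulr1 mul1r => e.
  apply/negP => ap; move: (ptMn up (ptMn sp tp)).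
  by rewrite -e !ptM ap orbT.
by exists (lfrac s ap); rewrite lfracM -lfrac11; apply: lfrac_eq; ring.
Qed.

Lemma invertible_to_loc a : invertible (to_loc a) <-> a \notin p.
Proof. exact: invertible_lfrac. Qed.

Lemma loc_local : local_ring loc.
Proof.
move=> x y; have [a [s [sp ->]]] := lfrac_surj x.
have [b [t [tp ->]]] := lfrac_surj y.
have -> : lfrac a sp + lfrac b tp = lfrac (a * t + b * s) (ptMn sp tp).
  exact: loc_addE.
rewrite !invertible_lfrac => h.
have [ap|] := boolP (a \in p); last by left.
have [bp|] := boolP (b \in p); last by right.
by move: h; rewrite ptD // mulrC ptMl.
Qed.

Lemma to_loc_eq a b : to_loc a = to_loc b <-> exists u, u \notin p /\ u * a = u * b.
Proof. by rewrite lfracP; split=> -[u]; rewrite !mulr1; exists u. Qed.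

Lemma loc_cancel (x y : loc) s : s \notin p -> x * to_loc s = y * to_loc s -> x = y.
Proof.
move=> /invertible_to_loc [z sz] e.
by rewrite -[x]mulr1 -sz mulrA e -mulrA sz mulr1.
Qed.

End Localization.

Section LocLift.
Variables (A C : comNzRingType) (p : Spec_pt A) (g : {rmorphism A -> C}).
Hypothesis g_unit : forall s, s \notin p -> invertible (g s).

(* The ring morphism out of the localization induced by [g]. *)
Definition loc_lift (x : loc p) : C :=
  g (repr x).1 * sval (cid (g_unit (valP (repr x).2))).

Lemma invertible_cancel (c x y : C) : invertible c -> x * c = y * c -> x = y.
Proof. by case=> d cd e; rewrite -[x]mulr1 -cd mulrA e -mulrA cd mulr1. Qed.

Lemma loc_liftE a s (sp : s \notin p) : loc_lift (lfrac a sp) * g s = g a.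
Proof.
rewrite /loc_lift; case: (cid _) => d /= dP.
have [u [up]] := repr_lfrac a sp.
case: (repr _) dP => a' [s' sp'] /= dP /(congr1 g); rewrite !rmorphM => e.
apply: (invertible_cancel (g_unit up)).
transitivity (d * (g u * (g a' * g s))); first by ring.
by rewrite e -[RHS]mulr1 -dP; ring.
Qed.

Lemma loc_lift_is_zmod_morphism : zmod_morphism loc_lift.
Proof.
move=> x y; have [a [s [sp ->]]] := lfrac_surj x.
have [b [t [tp ->]]] := lfrac_surj y.
apply: (invertible_cancel (g_unit (ptMn sp tp))).
rewrite lfracB loc_liftE rmorphB !rmorphM -(loc_liftE a sp) -(loc_liftE b tp).
by ring.
Qed.

Lemma loc_lift_is_monoid_morphism : monoid_morphism loc_lift.
Proof.
split => [|x y].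
  by have := loc_liftE 1 (pt1 p); rewrite rmorph1 mulr1 lfrac11.
have [a [s [sp ->]]] := lfrac_surj x.
have [b [t [tp ->]]] := lfrac_surj y.
apply: (invertible_cancel (g_unit (ptMn sp tp))).
rewrite lfracM loc_liftE !rmorphM -(loc_liftE a sp) -(loc_liftE b tp).
by ring.
Qed.

HB.instance Definition _ := GRing.isZmodMorphism.Build (loc p) C loc_lift
  loc_lift_is_zmod_morphism.
HB.instance Definition _ := GRing.isMonoidMorphism.Build (loc p) C loc_lift
  loc_lift_is_monoid_morphism.

Lemma loc_lift_to_loc a : loc_lift (to_loc p a) = g a.
Proof. by rewrite -(loc_liftE a (pt1 p)) rmorph1 mulr1. Qed.

End LocLift.

(** * Locally ringed spaces and schemes *)

(* The structure sheaf is given by its étalé space: a sheaf of rings on X is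
   the family of its stalks together with, for every open U, the ring of those
   families of germs [s x], x in U, that are sections over U.  Sections are
   total families, but whether [sec U s] holds depends only on the values of
   [s] on U, and [sec U] is only meaningful for open U.  The sheaf condition
   amounts to [sec_res] and [sec_glue]; [germ_surj] and [germ_inj] say that
   [stalk x] is the colimit of the rings of sections over the open
   neighbourhoods of x. *)
Record lrspace := LRSpace {
  points :> topologicalType;
  stalk : points -> comNzRingType;
  sec : set points -> set (forall x, stalk x);
  sec_ext : forall U s t, open U -> (forall x, U x -> s x = t x) ->
    sec U s -> sec U t;
  sec_res : forall U W s, open U -> open W -> W `<=` U -> sec U s -> sec W s;
  sec_glue : forall U s, open U ->
    (forall x, U x -> exists W, [/\ open W, W x, W `<=` U & sec W s]) ->
    sec U s;
  sec1 : forall U, open U -> sec U (fun=> 1);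
  secB : forall U s t, open U -> sec U s -> sec U t ->
    sec U (fun x => s x - t x);
  secM : forall U s t, open U -> sec U s -> sec U t ->
    sec U (fun x => s x * t x);
  germ_surj : forall x (a : stalk x), exists U s,
    [/\ open U, U x, sec U s & s x = a];
  germ_inj : forall U s t x, open U -> U x -> sec U s -> sec U t ->
    s x = t x ->
    exists W, [/\ open W, W x, W `<=` U & forall y, W y -> s y = t y];
  stalk_local : forall x, local_ring (stalk x) }.

Arguments stalk {l} x.
Arguments sec {l} U s.

Record lrs_hom (X Y : lrspace) := LRSHom {
  hom_fun :> X -> Y;
  hom_continuous : continuous hom_fun;
  hom_stalk : forall x, {rmorphism stalk (hom_fun x) -> stalk x};
  hom_sec : forall (V : set Y) (s : forall y, stalk y), open V -> sec V s ->
    sec (hom_fun @^-1` V) (fun x => hom_stalk x (s (hom_fun x)));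
  hom_local : forall x a, invertible (hom_stalk x a) -> invertible a }.

Arguments hom_stalk {X Y} l x.

(* Equality of morphisms of locally ringed spaces; comparing the images of
   sections avoids transporting along [f x = g x]. *)
Definition eq_hom (X Y : lrspace) (f g : lrs_hom X Y) : Prop :=
  (forall x, f x = g x) /\
  (forall (V : set Y) (s : forall y, stalk y), open V -> sec V s ->
     forall x, V (f x) -> hom_stalk f x (s (f x)) = hom_stalk g x (s (g x))).

Section Comp.
Variables (X Y Z : lrspace) (g : lrs_hom Y Z) (f : lrs_hom X Y).

Definition comp_fun (x : X) : Z := g (f x).

Definition comp_stalk (x : X) : {rmorphism stalk (comp_fun x) -> stalk x} :=
  hom_stalk f x \o hom_stalk g (f x).

Lemma comp_continuous : continuous comp_fun.
Proof.
move=> x; apply: continuous_comp; exact: hom_continuous.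
Qed.

Lemma comp_sec (V : set Z) (s : forall z, stalk z) : open V -> sec V s ->
  sec (comp_fun @^-1` V) (fun x => comp_stalk x (s (comp_fun x))).
Proof.
move=> oV sV; apply: (hom_sec f (V := g @^-1` V)
  (s := fun y => hom_stalk g y (s (g y)))); last exact: hom_sec.
by apply: open_comp => // y _; exact: hom_continuous.
Qed.

Lemma comp_local x a : invertible (comp_stalk x a) -> invertible a.
Proof. by move=> /hom_local /hom_local. Qed.

Definition comp_hom : lrs_hom X Z :=
  LRSHom comp_continuous comp_sec comp_local.

End Comp.

Definition open_immersion (X Y : lrspace) (f : lrs_hom X Y) : Prop :=
  [/\ injective f, (forall U : set X, open U -> open (f @` U)) &
      forall x, bijective (hom_stalk f x)].

Section SpecLRS.
Variable A : comNzRingType.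

(* Sections over U are the families that are locally of the form a/f; since
   f is a unit of the localization at q, the condition
   [s q * f = a] determines [s q = a/f]. *)
Definition Spec_sec (U : set (Spec_pt A)) : set (forall q : Spec_pt A, loc q) :=
  [set s | forall p, U p -> exists a f : A, \forall q \near p,
     f \notin pt_pred q /\ s q * to_loc q f = to_loc q a].

Lemma Spec_sec_ext U s t : open U -> (forall x, U x -> s x = t x) ->
  Spec_sec U s -> Spec_sec U t.
Proof.
move=> oU st sU p Up; have [a [f h]] := sU p Up; exists a, f.
have nU : \forall q \near p, U q by exact: open_nbhs_nbhs.
by apply: filterS2 nU h => q Uq; rewrite st.
Qed.

Lemma Spec_sec_res U W s : open U -> open W -> W `<=` U ->
  Spec_sec U s -> Spec_sec W s.
Proof. by move=> _ _ WU sU p /WU; exact: sU. Qed.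

Lemma Spec_sec_glue U s : open U ->
  (forall x, U x -> exists W, [/\ open W, W x, W `<=` U & Spec_sec W s]) ->
  Spec_sec U s.
Proof. by move=> _ h p /h [W [_ Wp _]]; exact. Qed.

Lemma Spec_sec1 U : open U -> Spec_sec U (fun=> 1).
Proof.
move=> _ p _; exists 1, 1; apply: filterE => q.
by rewrite pt1 mul1r.
Qed.

Lemma Spec_secB U s t : open U -> Spec_sec U s -> Spec_sec U t ->
  Spec_sec U (fun x => s x - t x).
Proof.
move=> _ sU tU p Up; have [a [f h]] := sU p Up; have [b [g k]] := tU p Up.
exists (a * g - b * f), (f * g); apply: filterS2 h k => q [fq e] [gq e'].
split; first exact: ptMn.
by rewrite to_locB !to_locM -e -e'; ring.
Qed.

Lemma Spec_secM U s t : open U -> Spec_sec U s -> Spec_sec U t ->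
  Spec_sec U (fun x => s x * t x).
Proof.
move=> _ sU tU p Up; have [a [f h]] := sU p Up; have [b [g k]] := tU p Up.
exists (a * b), (f * g); apply: filterS2 h k => q [fq e] [gq e'].
split; first exact: ptMn.
by rewrite !to_locM -e -e'; ring.
Qed.

Lemma nbhs_basic (p : Spec_pt A) (f : A) : f \notin p ->
  \forall q \near p, f \notin (q : Spec_pt A).
Proof. by move=> fp; apply: open_nbhs_nbhs; split => //; exact: open_basic. Qed.

Definition frac_sec (a f : A) (q : Spec_pt A) : loc q :=
  if pselect (f \notin q) is left fq then lfrac a fq else 0.

Lemma frac_secE a f (q : Spec_pt A) (fq : f \notin pt_pred q) : frac_sec a f q = lfrac a fq.
Proof.
by rewrite /frac_sec; case: pselect => // h; exact: lfrac_eq.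
Qed.

Lemma Spec_germ_surj x (a : loc x) : exists U s,
  [/\ open U, U x, Spec_sec U s & s x = a].
Proof.
have [b [f [fx ->]]] := lfrac_surj a.
exists [set q : Spec_pt A | f \notin q], (frac_sec b f); split => //.
- exact: open_basic.
- move=> q fq; exists b, f; apply: filterS (nbhs_basic fq) => r fr.
  by split => //; rewrite frac_secE lfrac_mul.
- exact: frac_secE.
Qed.

Lemma Spec_germ_inj U s t x : open U -> U x -> Spec_sec U s -> Spec_sec U t ->
  s x = t x ->
  exists W, [/\ open W, W x, W `<=` U & forall y, W y -> s y = t y].
Proof.
move=> oU Ux sU tU e; have [a [f h]] := sU x Ux; have [b [g k]] := tU x Ux.
have [fx ea] := nbhs_singleton h; have [gx eb] := nbhs_singleton k.
have : to_loc x (a * g) = to_loc x (b * f).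
  by rewrite !to_locM -ea -eb e; ring.
case/to_loc_eq => u [ux eu].
have : \forall q \near x, U q /\ s q = t q.
  have nU : \forall q \near x, U q by exact: open_nbhs_nbhs.
  near=> q; split; first by near: q.
  have [fq eaq] : f \notin q /\ s q * to_loc q f = to_loc q a by near: q.
  have [gq ebq] : g \notin q /\ t q * to_loc q g = to_loc q b by near: q.
  have uq : u \notin q by near: q; exact: nbhs_basic.
  apply: (loc_cancel (ptMn fq gq)).
  rewrite to_locM mulrA eaq [to_loc q f * _]mulrC mulrA ebq -!to_locM.
  by apply/to_loc_eq; exists u.
move=> n; have : nbhs x [set q | U q /\ s q = t q] by exact: n.
rewrite nbhsE => -[W [oW Wx] WU].
by exists W; split => // y /WU [].
Unshelve. all: by end_near. Qed.

Definition Spec_lrs : lrspace :=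
  @LRSpace (Spec_pt A) (fun p => loc p) Spec_sec
    Spec_sec_ext Spec_sec_res Spec_sec_glue Spec_sec1 Spec_secB Spec_secM
    Spec_germ_surj Spec_germ_inj (fun p => @loc_local A p).

End SpecLRS.

Section SpecMap.
Variables (A B : comNzRingType) (phi : {rmorphism A -> B}).

Lemma preim_prime (q : Spec_pt B) : prime_ideal [pred a | phi a \in q].
Proof.
split; last by move=> a b; rewrite !inE rmorphM ptM.
split; rewrite ?inE ?rmorph0 ?rmorph1 ?pt0 ?pt1 // => a u v.
by rewrite !inE rmorphD rmorphM => uq vq; rewrite ptD // ptMl.
Qed.

Definition Spec_fun (q : Spec_lrs B) : Spec_lrs A := SpecPt (preim_prime q).

Lemma Spec_fun_in (q : Spec_pt B) a : (a \in Spec_fun q) = (phi a \in q).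
Proof. by []. Qed.

Lemma Spec_fun_continuous : continuous Spec_fun.
Proof.
apply/continuousP => _ [E ->]; exists (phi @` E).
apply/seteqP; split => q /=; first by case=> a Ea aq; exists (phi a) => //; exists a.
by case=> _ [a Ea <-] aq; exists a.
Qed.

Lemma Spec_stalk_unit (q : Spec_pt B) s : s \notin Spec_fun q ->
  invertible ((to_loc q \o phi) s).
Proof. by rewrite Spec_fun_in => h; exact/invertible_to_loc. Qed.

Definition Spec_stalk (q : Spec_lrs B) :
    {rmorphism stalk (Spec_fun q) -> stalk q} :=
  loc_lift (@Spec_stalk_unit q).

Lemma Spec_stalk_to_loc (q : Spec_lrs B) a :
  Spec_stalk q (to_loc (Spec_fun q) a) = to_loc q (phi a).
Proof. exact: loc_lift_to_loc. Qed.

Lemma Spec_hom_sec (V : set (Spec_lrs A)) s : open V -> sec V s ->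
  sec (Spec_fun @^-1` V) (fun q => Spec_stalk q (s (Spec_fun q))).
Proof.
move=> oV sV q Vq; have [a [f h]] := sV _ Vq; exists (phi a), (phi f).
have n : nbhs (q : Spec_pt B) (Spec_fun @^-1` [set r : Spec_pt A |
  f \notin r /\ s r * to_loc r f = to_loc r a]) by exact: Spec_fun_continuous.
apply: filterS n => r [fr e].
by split => //; rewrite -!Spec_stalk_to_loc -e rmorphM.
Qed.

Lemma Spec_hom_local q a : invertible (Spec_stalk q a) -> invertible a.
Proof.
have [b [f [fq ->]]] := lfrac_surj a => h.
apply/invertible_lfrac; rewrite Spec_fun_in; apply/invertible_to_loc.
rewrite -Spec_stalk_to_loc -(lfrac_mul b fq) rmorphM.
have [c hc] := h; have [d hd] := Spec_stalk_unit fq.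
exists (c * d); rewrite Spec_stalk_to_loc mulrACA hc mul1r.
exact: hd.
Qed.

Definition Spec_hom : lrs_hom (Spec_lrs B) (Spec_lrs A) :=
  LRSHom Spec_fun_continuous Spec_hom_sec Spec_hom_local.

End SpecMap.

Definition locally_affine (X : lrspace) : Prop :=
  forall x : X, exists (A : comNzRingType) (f : lrs_hom (Spec_lrs A) X),
    open_immersion f /\ range f x.

Record scheme := Scheme {
  scheme_lrs :> lrspace;
  scheme_affine : locally_affine scheme_lrs }.

Lemma Spec_locally_affine (A : comNzRingType) : locally_affine (Spec_lrs A).
Proof.
move=> x; exists A.
have idl (y : Spec_lrs A) a : invertible ((idfun : {rmorphism stalk y -> stalk y}) a) ->
  invertible a by [].
have ids (V : set (Spec_lrs A)) (s : forall y, stalk y) : open V -> sec V s ->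
  sec (id @^-1` V) (fun y => (idfun : {rmorphism stalk y -> stalk y}) (s y)) by [].
have idc : continuous (id : Spec_lrs A -> Spec_lrs A) by move=> y.
exists (LRSHom idc ids idl); split; last by exists x.
split => [y z //|U oU|y]; first by rewrite image_id.
by exists id.
Qed.

Definition Spec (A : comNzRingType) : scheme := Scheme (@Spec_locally_affine A).

Definition fibre_product (Z X Y P : scheme) (a : lrs_hom X Z) (b : lrs_hom Y Z)
    (p : lrs_hom P X) (q : lrs_hom P Y) : Prop :=
  eq_hom (comp_hom a p) (comp_hom b q) /\
  forall (T : scheme) (f : lrs_hom T X) (g : lrs_hom T Y),
    eq_hom (comp_hom a f) (comp_hom b g) ->
    exists h : lrs_hom T P,
      [/\ eq_hom (comp_hom p h) f, eq_hom (comp_hom q h) g &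
          forall h' : lrs_hom T P, eq_hom (comp_hom p h') f ->
            eq_hom (comp_hom q h') g -> eq_hom h' h].

Definition empty_scheme (X : scheme) : Prop := [set: X] = set0.

(** * Regularity *)

Definition locally_noetherian (X : scheme) : Prop :=
  forall x : X, exists (A : comNzRingType) (f : lrs_hom (Spec A) X),
    [/\ noetherian A, open_immersion f & range f x].

Definition has_R (k : nat) (X : scheme) : Prop :=
  locally_noetherian X /\
  forall x : X, krull_dim_le (stalk x) k -> regular_local_ring (stalk x).

Definition regular_scheme (X : scheme) : Prop := forall k, has_R k X.

(** * Monoid algebras *)

(* The algebra R[K] of a commutative monoid, here written additively. *)
Definition monoid_alg (R : comNzRingType) (K : nmodType) : Type := {malg R[K]}.

Section MonoidAlg.
Variables (R : comNzRingType) (K : nmodType).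
Implicit Types g : monoid_alg R K.

HB.instance Definition _ := GRing.Zmodule.on (monoid_alg R K).

Definition mono (k : K) (c : R) : monoid_alg R K := << c *g k >>.

Lemma monoE g : g = \sum_(k <- msupp g) mono k g@_k.
Proof. exact: monalgE. Qed.

Lemma mono_is_zmod_morphism k : zmod_morphism (mono k).
Proof. by move=> c d; exact: monalgUB. Qed.

HB.instance Definition _ k := GRing.isZmodMorphism.Build R (monoid_alg R K)
  (mono k) (mono_is_zmod_morphism k).

Lemma mono0 k : mono k 0 = 0. Proof. exact: (raddf0 (mono k)). Qed.

Lemma monoid_alg_ind (P : monoid_alg R K -> Prop) :
  P 0 -> (forall g h, P g -> P h -> P (g + h)) ->
  (forall c k, P (mono k c)) -> forall g, P g.
Proof. by move=> P0 PD PU g; rewrite [g]monoE; elim/big_ind: _. Qed.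

(* A K-indexed family of elements of an additive group extends linearly. *)
Section Extend.
Variables (V : zmodType) (F : K -> {additive R -> V}).

Definition mono_ext g : V := \sum_(k <- msupp g) F k g@_k.

Lemma mono_extw (d : {fset K}) g : (msupp g `<=` d)%fset ->
  mono_ext g = \sum_(k <- d) F k g@_k.
Proof.
move=> sd; rewrite /mono_ext; apply: big_fset_incl => // k _ /mcoeff_outdom ->.
by rewrite raddf0.
Qed.

Lemma mono_ext_is_zmod_morphism : zmod_morphism mono_ext.
Proof.
move=> g h; rewrite (mono_extw (fsubsetUl (msupp g) (msupp h))).
rewrite (mono_extw (fsubsetUr (msupp g) (msupp h))).
rewrite (mono_extw (msuppB_le _ _)) -sumrB; apply: eq_bigr => k _.
by rewrite mcoeffB raddfB.
Qed.

HB.instance Definition _ := GRing.isZmodMorphism.Build (monoid_alg R K) V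
  mono_ext mono_ext_is_zmod_morphism.

Lemma mono_extU c k : mono_ext (mono k c) = F k c.
Proof. by rewrite (mono_extw msuppU_le) big_seq_fset1 mcoeffUU. Qed.

End Extend.

Definition alg_mul g h : monoid_alg R K :=
  \sum_(k <- msupp g) \sum_(l <- msupp h) mono (k + l) (g@_k * h@_l).

Lemma mono_scale_is_zmod_morphism (c : R) (k l : K) :
  zmod_morphism (fun d => mono (k + l) (c * d)).
Proof. by move=> d e; rewrite mulrBr (raddfB (mono _)). Qed.

Lemma alg_mulDr : right_distributive alg_mul +%R.
Proof.
move=> g h h'; rewrite /alg_mul -big_split /=; apply: eq_bigr => k _.
pose F l : {additive R -> monoid_alg R K} :=
  HB.pack (fun d => mono (k + l) (g@_k * d))
    (GRing.isZmodMorphism.Build R (monoid_alg R K)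
      (fun d => mono (k + l) (g@_k * d)) (mono_scale_is_zmod_morphism g@_k k l)).
exact: (raddfD (mono_ext F)).
Qed.

Lemma alg_mulC : commutative alg_mul.
Proof.
move=> g h; rewrite /alg_mul exchange_big; apply: eq_bigr => l _.
by apply: eq_bigr => k _; rewrite mulrC addrC.
Qed.

Lemma alg_mulDl : left_distributive alg_mul +%R.
Proof. by move=> g h h'; rewrite !(alg_mulC _ h') alg_mulDr. Qed.

Lemma alg_mulUU c d k l : alg_mul (mono k c) (mono l d) = mono (k + l) (c * d).
Proof.
rewrite /alg_mul !msuppU.
case: eqVneq => [->|_]; first by rewrite big_seq_fset0 mul0r mono0.
rewrite big_seq_fset1; case: eqVneq => [->|_].
  by rewrite big_seq_fset0 mulr0 mono0.
by rewrite big_seq_fset1 !mcoeffUU.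
Qed.

Lemma alg_mul0 g : alg_mul 0 g = 0.
Proof. by rewrite /alg_mul msupp0 big_seq_fset0. Qed.

Lemma alg_mulA : associative alg_mul.
Proof.
move=> x y z; elim/monoid_alg_ind: x => [|x x' e e'|c k].
- by rewrite !alg_mul0.
- by rewrite !alg_mulDl e e'.
elim/monoid_alg_ind: y => [|y y' e e'|d l].
- by rewrite (alg_mulC _ 0) !alg_mul0 (alg_mulC _ 0) !alg_mul0.
- by rewrite !alg_mulDr !alg_mulDl !alg_mulDr e e'.
elim/monoid_alg_ind: z => [|z z' e e'|b m].
- by rewrite !(alg_mulC _ 0) !alg_mul0 (alg_mulC _ 0) !alg_mul0.
- by rewrite !alg_mulDr e e'.
by rewrite !alg_mulUU mulrA addrA.
Qed.

Lemma alg_mul1 : left_id (mono 0 1) alg_mul.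
Proof.
move=> x; elim/monoid_alg_ind: x => [|x x' e e'|c k].
- by rewrite alg_mulC alg_mul0.
- by rewrite alg_mulDr e e'.
by rewrite alg_mulUU mul1r add0r.
Qed.

Lemma alg_1neq0 : mono 0 1 != 0.
Proof. by rewrite monalgU_eq0 oner_eq0. Qed.

HB.instance Definition _ := GRing.Zmodule_isComNzRing.Build (monoid_alg R K)
  alg_mulA alg_mulC alg_mul1 alg_mulDl alg_1neq0.

Lemma monoM c d k l : mono k c * mono l d = mono (k + l) (c * d).
Proof. exact: alg_mulUU. Qed.

End MonoidAlg.

Section MonoidAlgMap.
Variables (R : comNzRingType) (K L : nmodType) (f : {additive K -> L}).

(* The ring morphism R[K] -> R[L] induced by a morphism of monoids. *)
Definition monoid_alg_map (g : monoid_alg R K) : monoid_alg R L :=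
  \sum_(k <- msupp g) mono (f k) g@_k.

Lemma monoid_alg_map_is_zmod_morphism : zmod_morphism monoid_alg_map.
Proof.
exact: (mono_ext_is_zmod_morphism (fun k => mono (f k) : {additive _ -> _})).
Qed.

HB.instance Definition _ := GRing.isZmodMorphism.Build
  (monoid_alg R K) (monoid_alg R L) monoid_alg_map
  monoid_alg_map_is_zmod_morphism.

Lemma monoid_alg_mapU c k : monoid_alg_map (mono k c) = mono (f k) c.
Proof. exact: (mono_extU (fun k => mono (f k) : {additive _ -> _})). Qed.

Lemma monoid_alg_map_is_monoid_morphism : monoid_morphism monoid_alg_map.
Proof.
split; first by rewrite [LHS]monoid_alg_mapU raddf0.
move=> x y; elim/monoid_alg_ind: x => [|x x' e e'|c k].
- by rewrite raddf0 !mul0r raddf0.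
- by rewrite mulrDl !raddfD /= e e' mulrDl.
elim/monoid_alg_ind: y => [|y y' e e'|d l].
- by rewrite raddf0 !mulr0 raddf0.
- by rewrite mulrDr !raddfD /= e e' mulrDr.
by rewrite monoM !monoid_alg_mapU monoM raddfD.
Qed.

HB.instance Definition _ := GRing.isMonoidMorphism.Build
  (monoid_alg R K) (monoid_alg R L) monoid_alg_map
  monoid_alg_map_is_monoid_morphism.

End MonoidAlgMap.

(** * Fans *)

Section Fans.
Variables (R : realType) (V : vectType R).
Implicit Types (N A sigma tau : set V) (Sigma : set (set V)).

Local Notation dual := 'Hom(V, R^o).

Definition Zbasis N (b : seq V) : Prop :=
  (forall v, N v <-> exists z : 'I_(size b) -> int, v = \sum_(i < size b) b`_i *~ z i) /\
  (forall z : 'I_(size b) -> int, \sum_(i < size b) b`_i *~ z i = 0 -> forall i, z i = 0).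

(* The rank condition is that N is free of rank dim V as a Z-module. *)
Definition Zstructure N : Prop :=
  [/\ N 0 /\ (forall v w, N v -> N w -> N (v - w)),
      (forall v, exists s : seq V, (forall w, w \in s -> N w) /\ v \in <<s>>%VS) &
      exists b, Zbasis N b /\ size b = \dim {:V}].

Definition cone A : set V :=
  [set v | exists (s : seq V) (c : 'I_(size s) -> R),
     [/\ forall w, w \in s -> A w, forall i, 0 <= c i &
         v = \sum_(i < size s) c i *: s`_i]].

Definition has_line A : Prop :=
  exists d : V, d != 0 /\ forall t : R, A (t *: d).

Definition polycone N sigma : Prop :=
  (exists A, [/\ finite_set A, A `<=` N & sigma = cone A]) /\ ~ has_line sigma.

(* The u in the dual M of N that are nonnegative on sigma. *)
Definition dual_pred N sigma : {pred dual} :=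
  [pred u : dual | `[< (forall v, sigma v -> 0 <= (u v : R)) /\
                (forall v, N v -> (u v : R) \is a Num.int) >]].

Definition face N sigma : set (set V) :=
  [set tau | exists u : dual, u \in dual_pred N sigma /\
     tau = sigma `&` [set v | u v = 0]].

Definition fan N Sigma : Prop :=
  [/\ finite_set Sigma,
      forall sigma, Sigma sigma -> polycone N sigma &
      forall sigma tau, Sigma sigma -> Sigma tau ->
        face N sigma (sigma `&` tau) /\ face N sigma `<=` Sigma].

Definition regular_fan N Sigma : Prop :=
  forall sigma, Sigma sigma ->
    exists b A, [/\ Zbasis N b, A `<=` [set` b] & sigma = cone A].

End Fans.

(** * Toric schemes *)

Section DualMonoid.
Variables (R : realType) (V : vectType R) (N sigma : set V).

Lemma dual_pred_nmod_closed : GRing.nmod_closed (dual_pred N sigma).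
Proof.
split; first by apply/asboolP; split => v _; rewrite lfunE /= ?lexx ?rpred0.
move=> u w /asboolP[u1 u2] /asboolP[w1 w2]; apply/asboolP.
split => v hv; rewrite lfunE /=.
  exact: addr_ge0 (u1 v hv) (w1 v hv).
exact: (rpredD (u2 v hv) (w2 v hv)).
Qed.

Record dual_monoid := DualMonoid {
  dual_val :> 'Hom(V, R^o);
  dual_valP : dual_val \in dual_pred N sigma }.

HB.instance Definition _ := [isSub for dual_val].
HB.instance Definition _ := [Choice of dual_monoid by <:].
HB.instance Definition _ := 
  GRing.SubChoice_isSubNmodule.Build _ _ dual_monoid dual_pred_nmod_closed.

End DualMonoid.

Section DualIncl.
Variables (R : realType) (V : vectType R) (N sigma tau : set V).
Hypothesis sub : tau `<=` sigma.

Lemma dual_pred_sub u : u \in dual_pred N sigma -> u \in dual_pred N tau.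
Proof. by move=> /asboolP[h k]; apply/asboolP; split => // v /sub; exact: h. Qed.

Definition dual_incl (u : dual_monoid N sigma) : dual_monoid N tau :=
  DualMonoid (dual_pred_sub (dual_valP u)).

Lemma dual_incl_is_nmod_morphism : GRing.nmod_morphism dual_incl.
Proof. by split => [|u v]; exact: val_inj. Qed.

HB.instance Definition _ := GRing.isNmodMorphism.Build
  (dual_monoid N sigma) (dual_monoid N tau) dual_incl dual_incl_is_nmod_morphism.

End DualIncl.

Definition affine_toric (R : realType) (V : vectType R) (N sigma : set V) :
  scheme := Spec (monoid_alg int (dual_monoid N sigma)).

Definition affine_toric_map (R : realType) (V : vectType R)
    (N sigma tau : set V) (sub : tau `<=` sigma) :
    lrs_hom (affine_toric N tau) (affine_toric N sigma) :=
  Spec_hom (monoid_alg_map (R := int) (dual_incl (N := N) sub)).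

(* X is obtained by gluing the schemes X_sigma, sigma in Sigma, along the open
   subschemes X_(sigma `&` tau). *)
Definition toric_gluing (R : realType) (V : vectType R) (N : set V)
    (Sigma : set (set V)) (X : scheme) : Prop :=
  exists i : forall sigma, Sigma sigma -> lrs_hom (affine_toric N sigma) X,
  [/\ forall sigma (hs : Sigma sigma), open_immersion (i sigma hs),
      forall x : X, exists sigma (hs : Sigma sigma), range (i sigma hs) x,
      forall sigma tau (hs : Sigma sigma) (ht : Sigma tau),
        eq_hom
          (comp_hom (i sigma hs) (affine_toric_map N (@subIsetl _ sigma tau)))
          (comp_hom (i tau ht) (affine_toric_map N (@subIsetr _ sigma tau))) &
      forall sigma tau (hs : Sigma sigma) (ht : Sigma tau),
        range (i sigma hs) `&` range (i tau ht) =
        range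
          (comp_hom (i sigma hs) (affine_toric_map N (@subIsetl _ sigma tau)))].

(* X is the toric scheme over S associated with Sigma; it is determined up to
   isomorphism, and so is the gluing XZ. *)
Definition toric_scheme (R : realType) (V : vectType R) (N : set V)
    (Sigma : set (set V)) (S X : scheme) : Prop :=
  exists (XZ : scheme) (a : lrs_hom XZ (Spec int)) (b : lrs_hom S (Spec int))
    (p : lrs_hom X XZ) (q : lrs_hom X S),
    toric_gluing N Sigma XZ /\ fibre_product a b p q.

(* Main.v *)
(* As A[P] is the coproduct of A and Z[P], the fibre product X is covered by
   open subschemes Spec A[P_sigma], where Spec A runs through affine opens of S
   and P_sigma is the dual monoid of sigma.  If sigma is regular, A[P_sigma]
   arises from A by adjoining variables and invertible variables; for noetherian
   A this neither creates nor destroys (R_k), because passing from p to its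
   extension p[X] preserves heights and regularity.  This gives the forward
   direction and, for the cone 0, the descent of (R_k) from X to S; that S is
   locally noetherian follows by means of the augmentation A[P_0] -> A.

   For the regularity of the fan, localize A at a minimal prime, which gives a
   field F, and consider the point of Spec F[P_sigma] at which the units of
   P_sigma take the value 1 and all its other elements the value 0.  Its local
   ring has dimension at most n, hence is regular.  A derivation shows that an
   irreducible element of P_sigma is not in the square of the maximal ideal; so
   it is part of a regular system of parameters and generates a prime ideal.
   Thus P_sigma is factorial.  The exponents of its primes are elements of N,
   which extend to a basis of N by the Smith normal form, and which generate
   sigma by Farkas' lemma. *)

From HB Require Import structures.
Require Import Defs.
From mathcomp Require Import all_boot all_order all_algebra.
From mathcomp Require Import generic_quotient ring_quotient finmap monalg.
From mathcomp Require Import boolp classical_sets functions cardinality filter.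
From mathcomp Require Import reals topology.
From mathcomp Require Import ring zify.

Set Implicit Arguments.
Unset Strict Implicit.
Unset Printing Implicit Defensive.

Import Order.TTheory GRing.Theory Num.Theory.

Local Open Scope ring_scope.
Local Open Scope quotient_scope.
Local Open Scope classical_set_scope.

(** * Ideals and chains of primes *)

Section Ideals.
Variable A : comNzRingType.
Implicit Types (I J K : set A) (a b c u v x y : A) (s t : seq A) (p q : Spec_pt A).

(** The dimension theory forms no quotient rings: an ideal [I] is carried along in place of A/I, and
    statements about a local ring at [p] are phrased in the ring itself with multipliers outside
    [p]. Chains of primes and lists of generators can thus be moved between A, A[X] and their
    localizations. One notion, [loc_like], covers isomorphisms, localization at a prime,
    localization away from an element and inversion of a variable.

    The bound k >= n enters at the distinguished point: more than n algebraically independent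
    elements of F[P] would have more monomials than a box in the dual lattice has points. At a
    minimal prime of A the height is 0, so (R_k) makes the local ring a field for every k.

    The toric scheme is known only through universal properties, so its charts are built from the
    coproduct of rings and shown to be open immersions by testing on affine opens of X. Local
    noetherianity of X provides some noetherian affine open at each point, unrelated to the charts;
    descent to S therefore shrinks both to common principal opens. *)

Definition is_ideal I : Prop := I 0 /\ forall a u v, I u -> I v -> I (a * u + v).

Lemma ideal0 I : is_ideal I -> I 0. Proof. by case. Qed.

Lemma idealMl I a u : is_ideal I -> I u -> I (a * u).
Proof. by move=> [I0 h] Iu; rewrite -[_ * _]addr0; exact: h. Qed.

Lemma idealD I u v : is_ideal I -> I u -> I v -> I (u + v).
Proof. by move=> [I0 h] Iu Iv; rewrite -[u]mul1r; exact: h. Qed.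

Lemma idealN I u : is_ideal I -> I u -> I (- u).
Proof. by move=> hI Iu; rewrite -mulN1r; exact: idealMl. Qed.

Lemma idealB I u v : is_ideal I -> I u -> I v -> I (u - v).
Proof. by move=> hI Iu Iv; apply: idealD => //; exact: idealN. Qed.

Lemma ideal_sum I (T : Type) (r : seq T) (P : pred T) (F : T -> A) :
  is_ideal I -> (forall i, P i -> I (F i)) -> I (\sum_(i <- r | P i) F i).
Proof.
move=> hI h; elim/big_ind: _ => //; first exact: ideal0.
by move=> x y; exact: idealD.
Qed.

Lemma is_ideal0 : is_ideal [set 0].
Proof. by split => // a u v -> ->; rewrite mulr0 addr0. Qed.

Definition pset p : set A := [set a | a \in p].

Lemma is_ideal_pset p : is_ideal (pset p).
Proof. by split => [|a u v up vp]; rewrite /pset /= ?pt0 // ptD ?ptMl. Qed.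

Lemma is_ideal_bigcup (F : set (set A)) : F !=set0 ->
  (forall I, F I -> is_ideal I) -> total_on F subset ->
  is_ideal (\bigcup_(X in F) X).
Proof.
move=> [I0 FI0] hF tot; split; first by exists I0 => //; exact: ideal0 (hF _ FI0).
move=> a u v [I FI Iu] [J FJ Jv].
have [IJ|JI] := tot I J FI FJ.
  by exists J => //; case: (hF J FJ) => _; apply => //; exact: IJ.
by exists I => //; case: (hF I FI) => _; apply => //; exact: JI.
Qed.

(** This is the ideal I + (s). Enlarging the parameter I replaces the passage to a quotient ring. *)
Fixpoint adj I s : set A :=
  if s is x :: s' then [set a | exists c, adj I s' (a - c * x)] else I.

Lemma is_ideal_adj I s : is_ideal I -> is_ideal (adj I s).
Proof.
move=> hI; elim: s => //= x s [h0 h]; split.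
  by exists 0; rewrite mul0r subr0.
move=> a u v [c hc] [d hd]; exists (a * c + d).
rewrite (_ : _ - _ = a * (u - c * x) + (v - d * x)); first exact: h.
by ring.
Qed.

Lemma adj_sub I s : is_ideal I -> I `<=` adj I s.
Proof.
move=> hI; elim: s => //= x s h a Ia; exists 0.
by rewrite mul0r subr0; exact: h.
Qed.

Lemma adj_mem I s x : is_ideal I -> x \in s -> adj I s x.
Proof.
move=> hI; elim: s => //= y s h; rewrite inE => /orP [/eqP ->|/h hx].
  by exists 1; rewrite mul1r subrr; exact: ideal0 (is_ideal_adj _ hI).
by exists 0; rewrite mul0r subr0.
Qed.

Lemma adj_min I J s : is_ideal J -> I `<=` J -> {in s, forall x, J x} ->
  adj I s `<=` J.
Proof.
move=> hJ IJ; elim: s => //= x s h hs a [c /h hc].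
rewrite -(subrK (c * x) a); apply: idealD => //.
  by apply: hc => y ys; apply: hs; rewrite inE ys orbT.
by apply: idealMl => //; apply: hs; rewrite mem_head.
Qed.

Lemma adj_mono I J s t : is_ideal J -> I `<=` J -> {subset s <= t} ->
  adj I s `<=` adj J t.
Proof.
move=> hJ IJ st; apply: adj_min; first exact: is_ideal_adj.
  by apply: (subset_trans IJ); exact: adj_sub.
by move=> x /st; exact: adj_mem.
Qed.

Lemma adj_cons I x s : is_ideal I -> adj (adj I [:: x]) s = adj I (x :: s).
Proof.
move=> hI; apply/seteqP; split; apply: adj_min.
- exact: is_ideal_adj.
- by apply: adj_mono => // y; rewrite inE => /eqP ->; rewrite mem_head.
- by move=> y ys; apply: adj_mem => //; rewrite inE ys orbT.
- by do 2?apply: is_ideal_adj.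
- exact: subset_trans (adj_sub [:: x] hI) (adj_sub s (is_ideal_adj _ hI)).
- move=> y; rewrite inE => /orP [/eqP ->|ys].
    by apply: adj_sub; [exact: is_ideal_adj|apply: adj_mem => //; rewrite mem_head].
  by apply: adj_mem => //; exact: is_ideal_adj.
Qed.

Lemma ideal_genE s : ideal_gen s = adj [set 0] s.
Proof.
apply/seteqP; split => [a [c ->]|].
  apply: ideal_sum => [|i _]; first by exact: is_ideal_adj is_ideal0.
  apply: idealMl; first by exact: is_ideal_adj is_ideal0.
  by apply: adj_mem; [exact: is_ideal0|exact: mem_nth].
elim: s => [|x s h] a /=.
  by move=> ->; exists (fun=> 0); rewrite big_ord0.
case=> c /h [d e].
exists (fun i => if unlift ord0 i is Some j then d j else c).
rewrite big_ord_recl unlift_none -(subrK (c * x) a) e addrC; congr (_ + _).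
by apply: eq_bigr => i _; rewrite liftK.
Qed.

Lemma noetherianP : noetherian A <->
  forall I, is_ideal I -> exists s, I = adj [set 0] s.
Proof.
split => [h I hI|h I hI].
  have [|s hs] := h [pred a | `[< I a >]].
    split; first by apply/asboolP; exact: ideal0.
    by move=> a u v /asboolP Iu /asboolP Iv; apply/asboolP; case: hI => _; exact.
  exists s; rewrite -ideal_genE; apply/seteqP; split => a.
    by move=> Ia; apply/hs; apply/asboolP.
  by move/hs/asboolP.
have [|s hs] := h [set a | a \in I]; first by case: hI.
exists s => a; rewrite ideal_genE -hs; by [].
Qed.

Lemma proper_by I J a : I `<=` J -> J a -> ~ I a -> I `<` J.
Proof. by move=> IJ Ja nIa; split => // /(_ a Ja). Qed.

(** The union of a chain of ideals has finitely many generators, which lie in one member of the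
    chain; the union is that member, and Zorn applies. *)
Lemma noetherian_max (F : set (set A)) : noetherian A -> F !=set0 ->
  (forall I, F I -> is_ideal I) ->
  exists I, F I /\ forall J, F J -> I `<=` J -> J = I.
Proof.
move=> /noetherianP noeth [I0 FI0] hF.
have [I [[I_0|FI] Imax]] : exists I, (I = set0 \/ F I) /\
    forall J, I `<` J -> ~ (J = set0 \/ F J).
- apply: (@Zorn_bigcup _ [set I | I = set0 \/ F I]) => G sG tG.
  pose G' := G `&` F.
  have e : \bigcup_(X in G) X = \bigcup_(X in G') X.
    apply/seteqP; split => a [X GX Xa]; last by exists X => //; case: GX.
    by exists X => //; split => //; case: (sG X GX) => // X0; rewrite X0 in Xa.
  rewrite e; have [[I1 GI1]|nG] := pselect (G' !=set0); last first.
    left; apply/seteqP; split => // a [X GX _]; by case: nG; exists X.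
  have hU : is_ideal (\bigcup_(X in G') X).
    apply: is_ideal_bigcup; [by exists I1|by move=> I [_ /hF]|].
    by move=> X Y [GX _] [GY _]; exact: tG.
  have [s hs] := noeth _ hU; right.
  have [X [GX sX]] : exists X, G' X /\ {in s, forall x, X x}.
    have : {in s, forall x, (\bigcup_(X in G') X) x}.
      by move=> x xs; rewrite hs; apply: adj_mem => //; exact: is_ideal0.
    elim: {hs} s => [_|x s IHs sub]; first by exists I1.
    have [X [GX sX]] : exists X, G' X /\ {in s, forall x, X x}.
      by apply: IHs => y ys; apply: sub; rewrite inE ys orbT.
    have [Y GY Yx] : (\bigcup_(X in G') X) x by apply: sub; rewrite mem_head.
    have [XY|YX] := tG X Y GX.1 GY.1.
      exists Y; split => // y; rewrite inE => /orP [/eqP -> //|ys].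
      by apply: XY; exact: sX.
    exists X; split => // y; rewrite inE => /orP [/eqP ->|ys]; last exact: sX.
    exact: (YX x Yx).
  suff -> : \bigcup_(X in G') X = X by case: GX.
  apply/seteqP; split; last by move=> a Xa; exists X.
  rewrite hs; apply: adj_min => // [|a ->]; first exact: hF GX.2.
  exact: ideal0 (hF _ GX.2).
- exfalso; apply: (Imax I0); last by right.
  by rewrite I_0; apply: (@proper_by _ _ 0) => //; exact: ideal0 (hF _ FI0).
exists I; split => // J FJ IJ; apply: contrapT => nJI; apply: (Imax J); last by right.
by split => // JI; apply: nJI; apply/seteqP.
Qed.

(** An ideal J maximal among those that contain I and miss U is prime: if a and b are outside J,
    then J + (a) and J + (b) meet U, and the product of the two elements found there lies in J +
    (ab). *)
Lemma prime_avoid I (U : set A) : is_ideal I -> U 1 ->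
  (forall u v, U u -> U v -> U (u * v)) -> (forall u, U u -> ~ I u) ->
  exists p, I `<=` pset p /\ forall u, U u -> u \notin p.
Proof.
move=> hI U1 UM UI.
pose F := [set J | [/\ is_ideal J, I `<=` J & forall u, U u -> ~ J u]].
have [J [[J0|[hJ IJ UJ]] Jmax]] : exists J, (J = set0 \/ F J) /\
    forall K, J `<` K -> ~ (K = set0 \/ F K).
- apply: (@Zorn_bigcup _ [set J | J = set0 \/ F J]) => G sG tG.
  pose G' := G `&` F.
  have e : \bigcup_(X in G) X = \bigcup_(X in G') X.
    apply/seteqP; split => a [X GX Xa]; last by exists X => //; case: GX.
    by exists X => //; split => //; case: (sG X GX) => // X0; rewrite X0 in Xa.
  rewrite e; have [[I1 GI1]|nG] := pselect (G' !=set0); last first.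
    left; apply/seteqP; split => // a [X GX _]; by case: nG; exists X.
  right; split.
  + apply: is_ideal_bigcup; [by exists I1|by move=> K [_ []]|].
    by move=> X Y [GX _] [GY _]; exact: tG.
  + by move=> a Ia; exists I1 => //; case: GI1 => _ [_ + _]; apply.
  + by move=> u Uu [X [_ [_ _ h]] Xu]; exact: h Xu.
- exfalso; apply: (Jmax I); last by right; split.
  by rewrite J0; apply: (@proper_by _ _ 0) => //; exact: ideal0.
have out a : ~ J a -> exists u, U u /\ adj J [:: a] u.
  move=> Ja; apply: contrapT => h; apply: (Jmax (adj J [:: a])).
    apply: (@proper_by _ _ a) => //; first exact: adj_sub.
    by apply: adj_mem => //; rewrite mem_head.
  right; split; first exact: is_ideal_adj.
    by apply: (subset_trans IJ); exact: adj_sub.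
  by move=> u Uu hu; apply: h; exists u.
have prJ : prime_ideal [pred a | `[< J a >]].
  split; last first.
    move=> a b /asboolP Jab; apply/orP; apply: contrapT => h.
    have /out [u [Uu [c hc]]] : ~ J a by move=> Ja; apply: h; left; apply/asboolP.
    have /out [v [Uv [d hd]]] : ~ J b by move=> Jb; apply: h; right; apply/asboolP.
    apply: (UJ (u * v)); first exact: UM.
    rewrite (_ : u * v = v * (u - c * a) + (c * a * (v - d * b) + c * d * (a * b))).
      by do 2?apply: (hJ.2) => //; apply: idealMl.
    by ring.
  split.
  + by apply/asboolP; exact: ideal0.
  + by apply/asboolP; exact: UJ.
  + by move=> a u v /asboolP Ju /asboolP Jv; apply/asboolP; exact: hJ.2.
exists (SpecPt prJ); split => [a /IJ Ja|u /UJ nJ]; first exact/asboolP.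
by apply/asboolP.
Qed.

(** This makes A a local ring with maximal ideal p. *)
Definition nonunits_in p : Prop := forall a, a \notin p -> invertible a.

(** This is the ideal K + p(s); if s generates p and K is zero, it is the square of p. *)
Fixpoint madj p K s : set A :=
  if s is x :: s' then [set a | exists c, c \in p /\ madj p K s' (a - c * x)] else K.

Lemma is_ideal_madj p K s : is_ideal K -> is_ideal (madj p K s).
Proof.
move=> hK; elim: s => //= x s [h0 h]; split.
  by exists 0; rewrite pt0 mul0r subr0.
move=> a u v [c [cp hc]] [d [dp hd]]; exists (a * c + d).
split; first by rewrite ptD // ptMl.
rewrite (_ : _ - _ = a * (u - c * x) + (v - d * x)); first exact: h.
by ring.
Qed.

Lemma madj_min p K J s : is_ideal J -> K `<=` J ->
  {in s, forall x, J x} -> madj p K s `<=` J.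
Proof.
move=> hJ KJ; elim: s => //= x s h hs a [c [_ /h hc]].
rewrite -(subrK (c * x) a); apply: idealD => //.
  by apply: hc => y ys; apply: hs; rewrite inE ys orbT.
by apply: idealMl => //; apply: hs; rewrite mem_head.
Qed.

Lemma madj_sub p K s : is_ideal K -> K `<=` madj p K s.
Proof.
move=> hK; elim: s => //= x s h a Ka; exists 0.
by rewrite mul0r subr0 pt0; split => //; exact: h.
Qed.

(** Generators are eliminated one at a time: x - cx lies in the ideal of the others for some c in p,
    and 1 - c is a unit. *)
Lemma nakayama p K s : nonunits_in p -> is_ideal K ->
  {in s, forall x, madj p K s x} -> {in s, forall x, K x}.
Proof.
move=> hp hK; elim: s => // x s IHs hs.
have hM := is_ideal_madj p s hK.
have Mx : madj p K s x.
  have [c [cp hc]] := hs x (mem_head _ _).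
  have [d hd] : invertible (1 - c).
    by apply: hp; apply: contra (pt1 p) => /(ptD cp); rewrite addrC subrK.
  have -> : x = d * (x - c * x) by rewrite -[LHS]mul1r -hd; ring.
  exact: idealMl.
have Ks : {in s, forall y, K y}.
  apply: IHs => y ys.
  have [c [cp hc]] : madj p K (x :: s) y by apply: hs; rewrite inE ys orbT.
  by rewrite -(subrK (c * x) y); apply: idealD => //; exact: idealMl.
move=> y; rewrite inE => /orP [/eqP ->|/Ks //].
exact: (madj_min hK (fun _ h => h) Ks Mx).
Qed.

Lemma adj_madj p K s a y : is_ideal K -> a \in p -> adj [set 0] s y -> madj p K s (a * y).
Proof.
move=> hK ap; elim: s y => /= [y ->|x s IHs y [c /IHs hc]].
  by rewrite mulr0; exact: ideal0.
exists (a * c); split; first by rewrite mulrC ptMl.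
by move: hc; rewrite mulrBr mulrA.
Qed.

(** Nakayama for an inclusion of N in K + aN: an inclusion modulo a becomes an inclusion. *)
Lemma nakayama1 p K N a : noetherian A -> nonunits_in p -> is_ideal K ->
  is_ideal N -> a \in p ->
  (forall x, N x -> exists k y, [/\ K k, N y & x = k + a * y]) -> N `<=` K.
Proof.
move=> /noetherianP noeth hp hK hN ap h; have [s hs] := noeth _ hN.
rewrite hs; apply: adj_min => // [x ->|]; first exact: ideal0.
apply: (nakayama hp hK) => x xs.
have [|k [y [Kk Ny ->]]] := h x.
  by rewrite hs; apply: adj_mem => //; exact: is_ideal0.
apply: idealD; first exact: is_ideal_madj.
  exact: madj_sub.
by apply: adj_madj => //; rewrite -hs.
Qed.

Definition ltp p q : Prop := (forall a, a \in p -> a \in q) /\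
  exists a, a \in q /\ a \notin p.

Definition lep p q : Prop := forall a, a \in p -> a \in q.

Lemma ltp_le p q : ltp p q -> lep p q. Proof. by case. Qed.

Lemma ltp_lep_trans p q r : ltp p q -> lep q r -> ltp p r.
Proof. by move=> [h [a [aq ap]]] k; split=> [b /h /k //|]; exists a; split => //; exact: k. Qed.

Lemma lep_ltp_trans p q r : lep p q -> ltp q r -> ltp p r.
Proof.
move=> k [h [a [aq ap]]]; split=> [b /k /h //|]; exists a; split => //.
by apply: contra ap; exact: k.
Qed.

Lemma lep_anti p q : lep p q -> lep q p -> p = q.
Proof. by move=> pq qp; apply: Spec_pt_eq => a; apply/idP/idP; [exact: pq|exact: qp]. Qed.

Lemma ltpN p q : lep p q -> p <> q -> ltp p q.
Proof.
move=> pq npq; split => //; apply: contrapT => h; apply: npq; apply: lep_anti => // a aq.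
by apply: contrapT => /negP ap; apply: h; exists a.
Qed.

(** A chain of l strict inclusions starting at p whose last member only has to lie below q, which
    makes the notion monotone in q. *)
Fixpoint chn (l : nat) p q : Prop :=
  if l is l'.+1 then exists p', ltp p p' /\ chn l' p' q else lep p q.

(** The height of p is at least d; no upper bound is included. *)
Definition ht p d : Prop := exists q, chn d q p.

Lemma chn_le l p q : chn l p q -> lep p q.
Proof.
elim: l p => //= l IHl p [p' [[h _] /IHl h']] a; by move/h/h'.
Qed.

Lemma chn_lep l p q r : chn l p q -> lep q r -> chn l p r.
Proof.
elim: l p => /= [p h k a /h /k //|l IHl p [p' [h h']] k].
by exists p'; split => //; exact: IHl.
Qed.

Lemma ht_le p d e : (e <= d)%N -> ht p d -> ht p e.
Proof.
move=> ed; rewrite -(subnK ed); elim: (d - e)%N => // k IHk.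
move=> [q [q' [_ h]]]; apply: IHk; by exists q'.
Qed.

End Ideals.

(** * Krull's height theorem *)

Section PrincipalIdeal.
Variable A : comNzRingType.
Hypothesis noethA : noetherian A.
Implicit Types (I J K : set A) (p q : Spec_pt A).

Lemma nonunits_lep p q : nonunits_in p -> lep q p.
Proof.
move=> hp a aq; apply: contrapT => /negP /hp [b ab].
by move: (pt1 q); rewrite -ab mulrC ptMl.
Qed.

Section Colon.
Variables (J : set A) (g : A).
Hypotheses (hJ : is_ideal J) (nJg : ~ J g)
  (gmax : forall h, ~ J h -> (forall c, J (c * g) -> J (c * h)) ->
     forall c, J (c * h) -> J (c * g)).

(** By [gmax], J : g is maximal among the annihilators of nonzero elements of A/J. If ab is in it
    and a is not, then J : ag is no larger than J : g and contains b. *)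
Lemma colon_prime : prime_ideal [pred c | `[< J (c * g) >]].
Proof.
split; last first.
  move=> a b /asboolP Jab; apply/orP; apply: contrapT => h.
  have nJa : ~ J (a * g) by move=> Ja; apply: h; left; apply/asboolP.
  apply: h; right; apply/asboolP; apply: (gmax nJa).
    by move=> c Jc; rewrite mulrCA; exact: idealMl.
  by rewrite mulrCA mulrA.
split; [apply/asboolP|apply/asboolP|move=> a u v /asboolP Ju /asboolP Jv; apply/asboolP].
- by rewrite mul0r; exact: ideal0.
- by rewrite mul1r.
- by rewrite mulrDl -mulrA; exact: hJ.2.
Qed.

End Colon.

Lemma colon_max J : is_ideal J -> ~ J 1 -> exists g, ~ J g /\
  forall h, ~ J h -> (forall c, J (c * g) -> J (c * h)) ->
     forall c, J (c * h) -> J (c * g).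
Proof.
move=> hJ nJ1.
pose F := [set K : set A | exists g, ~ J g /\ K = [set c | J (c * g)]].
have hF K : F K -> is_ideal K.
  move=> [g [_ ->]]; split; first by rewrite /= mul0r; exact: ideal0.
  by move=> a u v /= Ju Jv; rewrite mulrDl -mulrA; exact: hJ.2.
have [|K [[g [nJg Kg]] Kmax]] := noetherian_max noethA _ hF.
  by exists [set c | J (c * 1)], 1.
exists g; split => // h nJh sub c Jc.
have e : [set c | J (c * h)] = K.
  by apply: Kmax; [exists h|rewrite Kg].
have : K c by rewrite -e.
by rewrite Kg.
Qed.

(** Krull's principal ideal theorem modulo p0. If there is no such p', then m is minimal over p0 +
    (a); the descending chain condition that follows, applied to a kind of symbolic powers,
    contradicts the existence of p1. *)
Lemma principal_ideal_local m p0 p1 a : nonunits_in m -> ltp p0 p1 -> ltp p1 m ->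
  a \in m -> exists p', [/\ lep p0 p', a \in p' & ltp p' m].
Proof.
move=> hm p01 p1m am; apply: contrapT => H.
have min p' : lep p0 p' -> a \in p' -> p' = m.
  move=> h h'; apply: contrapT => ne; apply: H; exists p'; split => //.
  by apply: ltpN => //; exact: nonunits_lep.
have ap1 : a \notin p1.
  apply/negP => ap1; have := min _ (ltp_le p01) ap1; case: p1m => _ [c [cm cp1]] e.
  by move: cp1; rewrite e cm.
have hp0 := is_ideal_pset p0.
pose I0 := adj (pset p0) [:: a].
have hI0 : is_ideal I0 by exact: is_ideal_adj.
have I0a : I0 a by apply: adj_mem => //; rewrite mem_head.
have p0I0 : pset p0 `<=` I0 by exact: adj_sub.
(* A / (p0 + (a)) is artinian: descending chains of ideals become stationary. *)
pose stat (E : nat -> set A) J := exists n0, forall n, (n0 <= n)%N ->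
  E n0 `&` J `<=` E n.
pose F := [set J | [/\ is_ideal J, I0 `<=` J & forall E : nat -> set A,
  (forall n, is_ideal (E n)) -> (forall n, E n.+1 `<=` E n) ->
  (forall n, I0 `<=` E n) -> stat E J]].
have [||J [[hJ I0J statJ] Jmax]] := @noetherian_max _ F noethA.
- exists I0; split => // E _ _ h; exists 0%N => n _ x [_ /h]; exact.
- by move=> I [].
(* If the maximal J were proper, an associated prime of A/J would contain p0 and a, hence be m. Then
   J + (g) is a smallest step above J, and the chain condition extends to it. *)
have J1 : J 1.
  apply: contrapT => nJ1.
  have [g [nJg gmax]] := colon_max hJ nJ1.
  pose pr := SpecPt (colon_prime hJ nJg gmax).
  have prm : pr = m.
    apply: min => [c cp0|]; apply/asboolP; rewrite mulrC; apply: idealMl => //.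
      exact/I0J/p0I0.
    exact: I0J.
  have mg c : c \in m -> J (c * g) by rewrite -prm => /asboolP.
  have Jg : F (adj J [:: g]).
    split; first exact: is_ideal_adj.
      by apply: (subset_trans I0J); exact: adj_sub.
    move=> E hE dE sE; have [n0 hn0] := statJ E hE dE sE.
    have Em n k : (n <= k)%N -> E k `<=` E n.
      move=> nk; rewrite -(subnK nk); elim: (k - n)%N => // j IHj x.
      by rewrite addSn => /dE /IHj.
    (* Either the chain meets J + (g) inside J from some index on, or each of its members contains
       some j + ug with j in J and u a unit, by which multiples of g are corrected into J. *)
    have [[n1 hn1]|nex] := pselect (exists n1, forall x, E n1 x -> adj J [:: g] x -> J x).
      exists (maxn n0 n1) => n; rewrite geq_max => /andP [n0n _] x [Ex Jx].
      apply: (hn0 n n0n); split; first by apply: Em Ex; exact: leq_maxl.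
      by apply: hn1 => //; apply: Em Ex; exact: leq_maxr.
    exists n0 => n n0n x [Ex [r Jr]].
    have [y [Ey [u Ju] nJy]] : exists y, [/\ E n y, adj J [:: g] y & ~ J y].
      apply: contrapT => h; apply: nex; exists n => y Ey Jy; apply: contrapT => nJy.
      by apply: h; exists y.
    have [v uv] : invertible u.
      apply: hm; apply/negP => um; apply: nJy; rewrite -(subrK (u * g) y).
      by apply: idealD => //; exact: mg.
    have Jz : J (x - r * v * y).
      rewrite (_ : _ - _ = (x - r * g) - r * v * (y - u * g)).
        by apply: idealB => //; exact: idealMl.
      rewrite mulrBr (_ : r * v * (u * g) = r * (u * v) * g); last by ring.
      by rewrite uv; ring.
    rewrite -(subrK (r * v * y) x); apply: idealD => //; last exact: idealMl.
    apply: (hn0 n n0n); split => //; apply: idealB => //; apply: idealMl => //.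
    exact: Em Ey.
  apply: (nJg); rewrite -(Jmax _ Jg); last exact: adj_sub.
  by apply: adj_mem => //; rewrite mem_head.
case: p01 => p01 [b [bp1 bp0]].
(* The contraction of p0 + (b^n) from the localization at p1; it replaces the n-th symbolic power of
   p1. *)
pose sym n := [set x | exists s, s \notin p1 /\ adj (pset p0) [:: b ^+ n] (s * x)].
have hsym n : is_ideal (sym n).
  split; first by exists 1; rewrite pt1 mulr0; split => //; exact: ideal0 (is_ideal_adj _ _).
  move=> c x y [s [sp hs]] [t [tp ht]]; exists (s * t); split; first exact: ptMn.
  rewrite (_ : _ * _ = (t * c) * (s * x) + s * (t * y)); last by ring.
  have hb : is_ideal (adj (pset p0) [:: b ^+ n]) by exact: is_ideal_adj.
  by apply: idealD => //; apply: idealMl.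
have p0sym n : pset p0 `<=` sym n.
  by move=> x hx; exists 1; rewrite pt1 mul1r; split => //; exact: adj_sub.
have symS n : sym n.+1 `<=` sym n.
  move=> x [s [sp [c hc]]]; exists s; split => //; exists (c * b).
  by rewrite -mulrA -exprS.
pose E n := [set x | exists y z, [/\ sym n y, I0 z & x = y + z]].
have [|||n0 hn0] := statJ E.
- move=> n; split.
    by exists 0, 0; rewrite addr0; split => //; [exact: ideal0 (hsym n)|exact: ideal0].
  move=> c _ _ [y [z [hy hz ->]]] [y' [z' [hy' hz' ->]]].
  exists (c * y + y'), (c * z + z'); split; [exact: (hsym n).2|exact: hI0.2|].
  by ring.
- by move=> n x [y [z [/symS hy hz ->]]]; exists y, z.
- by move=> n x hx; exists 0, x; rewrite add0r; split => //; exact: ideal0 (hsym n).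
(* Stationarity is known modulo p0 + (a). As a is outside p1, it cancels in [sym n0], and the
   inclusion takes the form that Nakayama needs. *)
have sub : sym n0 `<=` sym n0.+1.
  apply: (@nakayama1 _ m _ _ a) => // x hx.
  have [] : E n0.+1 x.
    apply: (hn0 n0.+1 (leqnSn _)); split; last by rewrite -[x]mulr1; exact: idealMl.
    by exists x, 0; rewrite addr0; split => //; exact: ideal0.
  move=> y [z [hy [c hc] e]]; exists (y + (z - c * a)), c; split.
  - by apply: idealD => //; exact: p0sym.
  - have [s [sp hs]] : sym n0 (a * c).
      rewrite (_ : a * c = x - y - (z - c * a)); last by rewrite e; ring.
      by apply: idealB => //; [apply: idealB => //; exact: symS|exact: p0sym].
    by exists (s * a); rewrite -mulrA; split => //; exact: ptMn.
  - by rewrite e; ring.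
have [s [sp [c hc]]] : sym n0.+1 (b ^+ n0).
  apply: sub; exists 1; rewrite pt1 mul1r; split => //.
  by apply: adj_mem => //; rewrite mem_head.
have : (s - c * b) * b ^+ n0 \in p0 by move: hc; rewrite /pset /= exprS mulrA -mulrBl.
have bn : b ^+ n0 \notin p0.
  by elim: (n0) => [|n IHn]; rewrite ?expr0 ?pt1 // exprS ptMn.
rewrite ptM (negPf bn) orbF => /p01 h; move/negP: sp; apply.
by rewrite -(subrK (c * b) s) ptD // ptMl.
Qed.

End PrincipalIdeal.

(** * Localizations *)

Definition powers (A : comNzRingType) (f : A) : set A := [set u | exists n, u = f ^+ n].

(* [phi] presents [B] as a ring of fractions of [C] with denominators in [U]. *)
Definition loc_like (C B : comNzRingType) (U : set C) (phi : {rmorphism C -> B}) :=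
  [/\ forall u, U u -> invertible (phi u),
      forall b, exists c u, U u /\ b * phi u = phi c &
      forall c, phi c = 0 -> exists u, U u /\ u * c = 0].

Lemma invertible1 (A : comNzRingType) : invertible (1 : A).
Proof. by exists 1; rewrite mulr1. Qed.

Lemma invertibleM (A : comNzRingType) (a b : A) :
  invertible (a * b) <-> invertible a /\ invertible b.
Proof.
split => [[c h]|[[c ac] [d bd]]]; last by exists (c * d); rewrite mulrACA ac bd mulr1.
split; first by exists (b * c); rewrite mulrA.
by exists (a * c); rewrite mulrCA mulrA.
Qed.

Lemma invertible_notin (A : comNzRingType) (p : Spec_pt A) a : invertible a -> a \notin p.
Proof. by case=> b ab; apply: contra (pt1 p) => ap; rewrite -ab mulrC ptMl. Qed.

Lemma to_loc_like (A : comNzRingType) (p : Spec_pt A) :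
  loc_like [set u | u \notin p] (to_loc p).
Proof.
split.
- by move=> u up; exact/invertible_to_loc.
- move=> b; have [a [s [sp ->]]] := lfrac_surj b; exists a, s; split => //.
  exact: lfrac_mul.
- move=> c; rewrite -(rmorph0 (to_loc p)) => /to_loc_eq [u [up e]].
  by exists u; rewrite e mulr0.
Qed.

Section LocLike.
Variables (C B : comNzRingType) (U : set C) (phi : {rmorphism C -> B}).
Hypothesis phiU : loc_like U phi.
Implicit Types (p : Spec_pt C) (q : Spec_pt B).

Definition preimp q : Spec_pt C := Spec_fun phi q.

Lemma preimpE q c : (c \in preimp q) = (phi c \in q). Proof. by []. Qed.

Lemma loc_like_unit u : U u -> invertible (phi u). Proof. by case: phiU => h _ _; exact: h. Qed.

Lemma loc_like_avoid q u : U u -> u \notin preimp q.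
Proof. by move=> /loc_like_unit; rewrite preimpE; exact: invertible_notin. Qed.

Lemma loc_like_frac b : exists c u, U u /\ b * phi u = phi c.
Proof. by case: phiU. Qed.

Lemma loc_like_ker c : phi c = 0 -> exists u, U u /\ u * c = 0.
Proof. by case: phiU => _ _; apply. Qed.

Lemma loc_like_in q b c u : U u -> b * phi u = phi c -> (b \in q) = (c \in preimp q).
Proof.
move=> Uu e; rewrite preimpE -e ptM.
by rewrite (negPf (invertible_notin q (loc_like_unit Uu))) orbF.
Qed.

(** Denominators are cleared twice, so the local ring of B at q is also a ring of fractions of C at
    the preimage of q; this identifies the stalks. *)
Lemma loc_like_stalk q : loc_like [set u | u \notin preimp q] (to_loc q \o phi).
Proof.
split.
- by move=> u /= uq; exact/invertible_to_loc.
- move=> x; have [b [t [tq ->]]] := lfrac_surj x.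
  have [c [u [Uu ec]]] := loc_like_frac b; have [d [v [Uv ed]]] := loc_like_frac t.
  exists (c * v), (u * d); split.
    by apply: ptMn (loc_like_avoid q Uu) _; rewrite -(loc_like_in q Uv ed).
  rewrite /= !rmorphM /= -ec -ed !rmorphM /=.
  have := lfrac_mul b tq => <-; ring.
- move=> c /=; rewrite -(rmorph0 (to_loc q)) => /to_loc_eq [w [wq]]; rewrite mulr0 => wc.
  have [e [u [Uu eu]]] := loc_like_frac w.
  have [|v [Uv ev]] := @loc_like_ker (e * c).
    by rewrite rmorphM -eu mulrAC wc mul0r.
  exists (v * e); rewrite -mulrA; split => //.
  by apply: ptMn (loc_like_avoid q Uv) _; rewrite -(loc_like_in q Uu eu).
Qed.

Lemma adj_loc_like (s : seq C) b : adj [set 0] (map phi s) b ->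
  exists c u, [/\ invertible (phi u), b * phi u = phi c & adj [set 0] s c].
Proof.
elim: s b => /= [b ->|x s IHs b [d /IHs [c [u [iu e hc]]]]].
  by exists 0, 1; rewrite rmorph0 mul0r rmorph1; split => //; exact: invertible1.
have [f [v [Uv ev]]] := loc_like_frac d.
exists (v * c + u * f * x), (u * v); split.
- by rewrite rmorphM; apply/invertibleM; split => //; exact: loc_like_unit.
- by rewrite rmorphD !rmorphM -e -ev; ring.
exists (u * f); rewrite addrK; apply: idealMl => //; exact: is_ideal_adj (@is_ideal0 C).
Qed.

Lemma adj_loc_like_inv (s : seq C) a : adj [set 0] (map phi s) (phi a) ->
  exists u, invertible (phi u) /\ adj [set 0] s (u * a).
Proof.
case/adj_loc_like => c [u [iu e hc]].
have [|v [Uv ev]] := @loc_like_ker (a * u - c).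
  by rewrite rmorphB rmorphM e subrr.
exists (v * u); split; first by rewrite rmorphM; apply/invertibleM; split => //; exact: loc_like_unit.
rewrite (_ : v * u * a = v * c); last by apply: subr0_eq; rewrite -[RHS]ev; ring.
by apply: idealMl => //; exact: is_ideal_adj (@is_ideal0 C).
Qed.

Lemma adj_map (s : seq C) c : adj [set 0] s c -> adj [set 0] (map phi s) (phi c).
Proof.
elim: s c => /= [c ->|x s IHs c [d /IHs h]]; first by rewrite rmorph0.
by exists (phi d); rewrite -rmorphM -rmorphB.
Qed.

Lemma loc_like_noetherian : noetherian C -> noetherian B.
Proof.
move=> /noetherianP noeth; apply/noetherianP => J hJ.
have hI : is_ideal [set c | J (phi c)].
  split => [|a u v Ju Jv] /=; first by rewrite rmorph0; exact: ideal0.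
  by rewrite rmorphD rmorphM; exact: hJ.2.
have [s hs] := noeth _ hI; exists (map phi s); apply/seteqP; split; last first.
  apply: adj_min => // [_ ->|_ /mapP [c cs ->]]; first exact: ideal0.
  have : [set c | J (phi c)] c by rewrite hs; apply: adj_mem => //; exact: is_ideal0.
  by [].
move=> b Jb; have [c [u [Uu e]]] := loc_like_frac b.
have : [set c | J (phi c)] c by rewrite /= -e mulrC; exact: idealMl.
rewrite hs => /adj_map; rewrite -e; have [v uv] := loc_like_unit Uu => h.
rewrite (_ : b = v * (b * phi u)); last by rewrite mulrCA [v * _]mulrC uv mulr1.
by apply: idealMl => //; exact: is_ideal_adj (@is_ideal0 B).
Qed.

Section Ext.
Variable p : Spec_pt C.
Hypothesis pU : forall u, U u -> u \notin p.

(** A fraction belongs to the extension of p when its numerator is in p; [key] makes this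
    independent of how the fraction is written. *)
Lemma ext_prime : prime_ideal [pred b | `[< exists c u, [/\ U u, b * phi u = phi c & c \in p] >]].
Proof.
have key b c u c' u' : U u -> U u' -> b * phi u = phi c -> b * phi u' = phi c' ->
    c' \in p -> c \in p.
  move=> Uu Uu' e e' cp.
  have [|v [Uv ev]] := @loc_like_ker (c * u' - c' * u).
    by rewrite rmorphB !rmorphM -e -e'; ring.
  have : v * (c * u') \in p.
    rewrite (_ : _ * _ = v * u * c'); first by rewrite ptMl.
    by apply: subr0_eq; rewrite -[RHS]ev; ring.
  by rewrite !ptM (negPf (pU Uv)) (negPf (pU Uu')) orbF.
split; last first.
  move=> a b /asboolP [c [u [Uu e cp]]].
  have [d [v [Uv ed]]] := loc_like_frac a; have [f [w [Uw ef]]] := loc_like_frac b.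
  have [|v' [Uv' ev]] := @loc_like_ker (c * v * w - d * f * u).
    by rewrite rmorphB !rmorphM -e -ed -ef; ring.
  have : v' * (d * f * u) \in p.
    rewrite (_ : _ * _ = v' * v * w * c); first by rewrite ptMl.
    by apply/esym; apply: subr0_eq; rewrite -[RHS]ev; ring.
  rewrite !ptM (negPf (pU Uv')) (negPf (pU Uu)) orbF /= => /orP [dp|fp]; apply/orP.
    by left; apply/asboolP; exists d, v.
  by right; apply/asboolP; exists f, w.
split.
- have [c [u [Uu e]]] := loc_like_frac 0; apply/asboolP; exists c, u; split => //.
  have [v [Uv ev]] : exists v, U v /\ v * c = 0.
    by apply: loc_like_ker; rewrite -e mul0r.
  have : v * c \in p by rewrite ev pt0.
  by rewrite ptM (negPf (pU Uv)).
- apply/asboolP => -[c [u [Uu e cp]]].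
  by move: (pU Uu); rewrite (key 1 u u c u) // mul1r.
- move=> a b b' /asboolP [c [u [Uu e cp]]] /asboolP [c' [u' [Uu' e' cp']]].
  have [d [v [Uv ed]]] := loc_like_frac (a * b + b').
  apply/asboolP; exists d, v; split => //.
  have [f [w [Uw ef]]] := loc_like_frac a.
  have [|v' [Uv' ev]] := @loc_like_ker (d * (w * u * u') - v * (f * c * u' + c' * w * u)).
    by rewrite rmorphB !(rmorphM, rmorphD) -ed -ef -e -e'; ring.
  have : v' * (d * (w * u * u')) \in p.
    rewrite (_ : _ * _ = v' * (v * (f * c * u' + c' * w * u))).
      do 2?apply: ptMl; apply: ptD; first by rewrite mulrAC ptMl.
      by rewrite -mulrA mulrC ptMl.
    by apply: subr0_eq; rewrite -[RHS]ev; ring.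
  rewrite !ptM (negPf (pU Uv')) (negPf (pU Uw)) (negPf (pU Uu)) (negPf (pU Uu')).
  by rewrite !orbF.
Qed.

Definition extp : Spec_pt B := SpecPt ext_prime.

Lemma preimp_extp : preimp extp = p.
Proof.
apply: Spec_pt_eq => c; rewrite preimpE; apply/asboolP/idP => [[d [u [Uu e dp]]]|cp].
  have [|v [Uv ev]] := @loc_like_ker (c * u - d).
    by rewrite rmorphB rmorphM e subrr.
  have : v * (c * u) \in p.
    rewrite (_ : _ * _ = v * d); first by rewrite ptMl.
    by apply: subr0_eq; rewrite -[RHS]ev; ring.
  by rewrite !ptM (negPf (pU Uv)) (negPf (pU Uu)) orbF.
have [d [u [Uu e]]] := loc_like_frac 1; exists (c * u), u; split => //.
  by rewrite rmorphM.
by rewrite mulrC ptMl.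
Qed.

End Ext.

Lemma preimp_le q q' : lep (preimp q) (preimp q') <-> lep q q'.
Proof.
split => [h b bq|h c]; last by rewrite !preimpE; exact: h.
have [c [u [Uu e]]] := loc_like_frac b.
by rewrite (loc_like_in q' Uu e); apply: h; rewrite -(loc_like_in q Uu e).
Qed.

Lemma preimp_inj q q' : preimp q = preimp q' -> q = q'.
Proof. by move=> e; apply: lep_anti; apply/preimp_le; rewrite e. Qed.

Lemma preimp_lt q q' : ltp (preimp q) (preimp q') <-> ltp q q'.
Proof.
split=> -[h [c [c1 c2]]].
  by split; [exact/preimp_le|exists (phi c)].
apply: ltpN; first by apply/preimp_le.
by move=> /preimp_inj e; move: c2; rewrite e c1.
Qed.

Lemma lep_avoid p q : lep p (preimp q) -> forall u, U u -> u \notin p.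
Proof. by move=> h u Uu; apply: contra (loc_like_avoid q Uu); exact: h. Qed.

Lemma chn_preimp l q q' : chn l q q' -> chn l (preimp q) (preimp q').
Proof.
elim: l q => /= [q /preimp_le //|l IHl q [q1 [/preimp_lt h /IHl h']]].
by exists (preimp q1).
Qed.

(** A prime below one that misses U misses U as well, so the whole chain extends to B. *)
Lemma chn_preimp_inv l p q : chn l p (preimp q) -> exists q0, preimp q0 = p /\ chn l q0 q.
Proof.
elim: l p => [p h|l IHl p [p1 [h h']]].
  exists (extp (lep_avoid h)); rewrite preimp_extp; split => //.
  by apply/preimp_le; rewrite preimp_extp.
have [q1 [e1 h1]] := IHl _ h'.
have hp : lep p (preimp q) by move=> a /h.1; exact: (chn_le h').
exists (extp (lep_avoid hp)); rewrite preimp_extp; split => //; exists q1; split => //.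
by apply/preimp_lt; rewrite preimp_extp e1.
Qed.

Lemma ht_preimp q d : ht (preimp q) d <-> ht q d.
Proof.
split => [[p /chn_preimp_inv [q0 [_ h]]]|[q0 /chn_preimp h]]; first by exists q0.
by exists (preimp q0).
Qed.

End LocLike.

(** * Krull's height theorem for several generators *)

Section HeightBound.
Variable A : comNzRingType.
Implicit Types (I : set A) (p q : Spec_pt A) (s t : seq A).

Lemma pt_avoid p u : [set v | v \notin p] u -> u \notin p. Proof. by []. Qed.

Definition mloc p : Spec_pt (loc p) := extp (to_loc_like p) (@pt_avoid p).

Lemma preimp_mloc p : preimp (to_loc p) (mloc p) = p.
Proof. exact: preimp_extp. Qed.

Lemma mlocE p a : (to_loc p a \in mloc p) = (a \in p).
Proof. by rewrite -(preimpE (to_loc p)) preimp_mloc. Qed.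

Lemma nonunits_mloc p : nonunits_in (mloc p).
Proof.
move=> x; have [a [s [sp ->]]] := lfrac_surj x => h.
apply/invertible_lfrac; apply: contra h => ap.
by apply/asboolP; exists a, s; split => //; exact: lfrac_mul.
Qed.

Lemma nonunits_inE p a : nonunits_in p -> (a \in p) <-> ~ invertible a.
Proof.
move=> hp; split => [ap /(invertible_notin p)|na]; first by rewrite ap.
by apply: contrapT => /negP /hp.
Qed.

(** If a is not in p0, the principal ideal theorem in the localization at p2 provides the new middle
    prime, which is strictly above p0 because it contains a. *)
Lemma principal_ideal_move p0 p1 p2 a : noetherian A -> ltp p0 p1 -> ltp p1 p2 ->
  a \in p2 -> exists p', [/\ ltp p0 p', ltp p' p2 & a \in p'].
Proof.
move=> noeth h01 h12 a2; have [a0|a0] := boolP (a \in p0).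
  by exists p1; split => //; exact: h01.1.
have lk := to_loc_like p2.
have avoid q : lep q p2 -> forall u, u \notin p2 -> u \notin q.
  by move=> qp u; apply: contra; exact: qp.
have a02 : lep p0 p2 by move=> b /h01.1 /h12.1.
pose q0 := extp lk (avoid _ a02); pose q1 := extp lk (avoid _ h12.1).
have [|||q' [q0q' aq' q'm]] := @principal_ideal_local _ (loc_like_noetherian lk noeth)
    (mloc p2) q0 q1 (to_loc p2 a) (@nonunits_mloc p2).
- by apply/(preimp_lt lk); rewrite !preimp_extp.
- by apply/(preimp_lt lk); rewrite preimp_extp preimp_mloc.
- by rewrite mlocE.
exists (preimp (to_loc p2) q'); split => //.
- split; last by exists a.
  by move: q0q' => /(preimp_le lk); rewrite preimp_extp.
- by move: q'm => /(preimp_lt lk); rewrite preimp_mloc.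
Qed.

(** The move is applied from the top of the chain downwards, so that a enters every member above
    q. *)
Lemma chn_move l q p a : noetherian A -> chn l.+1 q p -> a \in p ->
  exists q', [/\ ltp q q', chn l q' p & a \in q'].
Proof.
move=> noeth; elim: l q => [|l IHl] q [q1 [h1 h]] ap.
  by exists p; split => //; exact: ltp_lep_trans h1 h.
have [q2 [h12 h2 a2]] := IHl _ h ap.
have [q' [qq' h' aq']] := principal_ideal_move noeth h1 h12 a2.
by exists q'; split => //; exists q2.
Qed.

(** The height theorem modulo I, with p generated only up to multipliers outside p. Each x in s
    costs one inclusion: by [chn_move] the rest of the chain can be taken above x. *)
Lemma height_bound I s p l q : noetherian A -> is_ideal I -> {subset s <= p} ->
  (forall a, a \in p -> exists u, u \notin p /\ adj I s (u * a)) ->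
  I `<=` pset q -> chn l q p -> (l <= size s)%N.
Proof.
move=> noeth; elim: s I l q => [|x s IHs] I [|l] q hI sp hp Iq //.
  move=> [q' [[qq' [a [aq' aq]]] /chn_le q'p]].
  have [u [up /Iq]] := hp a (q'p _ aq').
  rewrite /pset /= ptM (negPf aq) orbF => /qq' /q'p.
  by rewrite (negPf up).
move=> h; have [|q' [qq' h' xq']] := @chn_move _ _ _ x noeth h.
  by apply: sp; rewrite mem_head.
apply: (IHs (adj I [:: x]) _ q') => //.
- exact: is_ideal_adj.
- by move=> y ys; apply: sp; rewrite inE ys orbT.
- by move=> a ap; have := hp a ap; rewrite adj_cons.
apply: adj_min; first exact: is_ideal_pset.
  by move=> y /Iq; exact: qq'.1.
by move=> y; rewrite inE => /eqP ->.
Qed.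

Lemma ht_bounded p : noetherian A -> exists n, forall l, ht p l -> (l <= n)%N.
Proof.
move=> noeth; have [s hs] := (noetherianP A).1 noeth _ (is_ideal_pset p).
have sp x : x \in s -> x \in p.
  by move=> xs; suff : pset p x by []; rewrite hs; apply: adj_mem => //; exact: is_ideal0.
exists (size s) => l [q h]; apply: (height_bound noeth (@is_ideal0 A) sp) (h).
  move=> a ap; exists 1; rewrite pt1 mul1r -hs; by split.
by move=> a ->; exact: pt0.
Qed.

(** The minimal prime is the bottom of a longest chain below p, which exists because heights are
    bounded. *)
Lemma exists_minimal_pt p : noetherian A -> exists q, lep q p /\ ~ ht q 1.
Proof.
move=> noeth; have [n hn] := ht_bounded p noeth.
have ex0 : exists l, `[< ht p l >] by exists 0%N; apply/asboolP; exists p.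
have ub l : `[< ht p l >] -> (l <= n)%N by move=> /asboolP; exact: hn.
case: (ex_maxnP ex0 ub) => l /asboolP [q hq] lmax.
exists q; split; first exact: chn_le hq.
move=> [q0 [q1 [h h']]]; have : (l.+1 <= l)%N.
  apply: lmax; apply/asboolP; exists q0; exists q; split => //.
  exact: ltp_lep_trans h'.
by rewrite ltnn.
Qed.

End HeightBound.

(** * Regular local rings *)

Section RegularLocal.
Variable A : comNzRingType.
Hypothesis noethA : noetherian A.
Implicit Types (I : set A) (p q m : Spec_pt A) (s t : seq A).

Lemma adj_rem I s x : is_ideal I -> x \in s -> adj I s = adj (adj I [:: x]) (rem x s).
Proof.
move=> hI xs; rewrite adj_cons //; have e := perm_mem (perm_to_rem xs).
by apply/seteqP; split; apply: adj_mono => // y; rewrite e.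
Qed.

(* Taking quotients by the members of [s] one at a time, the dimension has to
   drop at each step, so that each time the chain of primes starts at the zero
   ideal of the quotient. *)
Lemma regular_prime m I s q : nonunits_in m -> is_ideal I -> pset m = adj I s ->
  I `<=` pset q -> chn (size s) q m -> I = pset q.
Proof.
move=> hm; have [r] := ubnP (size s).
elim: r => // r IHr in I s q *; rewrite ltnS => sr hI ms Iq.
case: (posnP (size s)) => [s0|s_gt0].
  move: ms; rewrite (size0nil s0) => /= e qm; apply/seteqP; split => // a aq.
  by have : pset m a by [exact: qm]; rewrite e.
rewrite -(prednK s_gt0) => qm.
have [x [xs xq]] : exists x, x \in s /\ x \notin q.
  apply: contrapT => h; case: qm => q1 [[_ [a [aq1 aq]]] /chn_le q1m].
  have : pset m a by exact: q1m.
  rewrite ms => /(adj_min (is_ideal_pset q) Iq) => k.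
  move/negP: aq; apply; apply: k => y ys.
  by apply: contrapT => yq; apply: h; exists y; split => //; exact/negP.
have xm : x \in m.
  by suff : pset m x by []; rewrite ms; exact: adj_mem.
have [q' [qq' q'm xq']] := chn_move noethA qm xm.
have e : adj I [:: x] = pset q'.
  apply: (IHr _ (rem x s)).
  - by rewrite size_rem // prednK.
  - exact: is_ideal_adj.
  - by rewrite -adj_rem.
  - apply: adj_min; first exact: is_ideal_pset.
      by move=> y /Iq; exact: qq'.1.
    by move=> y; rewrite inE => /eqP ->.
  - by rewrite size_rem.
apply/seteqP; split => //; apply: (@nakayama1 _ m _ _ x) => //.
  exact: is_ideal_pset.
move=> y yq; have [c hc] : adj I [:: x] y by rewrite e; exact: qq'.1.
exists (y - c * x), c; split => //; last by rewrite mulrC subrK.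
have : c * x \in q.
  rewrite (_ : c * x = y - (y - c * x)); last by rewrite subKr.
  exact: idealB (is_ideal_pset q) yq (Iq _ hc).
by rewrite ptM (negPf xq) orbF.
Qed.

(** If some coefficient of y is a unit, y can take the place of that generator; otherwise y lies in
    I + m(s). *)
Lemma adj_exchange m I s y : nonunits_in m -> is_ideal I -> adj I s y ->
  madj m I s y \/ exists s', [/\ (size s').+1 = size s, {subset s' <= s} &
    adj I s `<=` adj I (y :: s')].
Proof.
move=> hm hI; elim: s y => [|x s IHs] y; first by left.
move=> [c hc]; have [cm|/hm [d cd]] := boolP (c \in m).
  have [h|[s' [ss' sub h]]] := IHs _ hc; first by left; exists c.
  right; exists (x :: s'); split; first by rewrite /= ss'.
    by move=> z; rewrite !inE => /orP [->//|/sub ->]; rewrite orbT.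
  apply: adj_min; first exact: is_ideal_adj.
    exact: adj_sub.
  have hJ : is_ideal (adj I (y :: x :: s')) by exact: is_ideal_adj.
  have hx : adj I (y :: x :: s') x by apply: adj_mem => //; rewrite !inE eqxx orbT.
  have hy : adj I (y :: x :: s') y by apply: adj_mem => //; rewrite !inE eqxx.
  move=> z; rewrite inE => /orP [/eqP -> //|zs].
  have : adj I (y - c * x :: s') z by apply: h; exact: adj_mem.
  apply: adj_min => //; first exact: adj_sub.
  move=> w; rewrite inE => /orP [/eqP ->|ws].
    by apply: idealB => //; exact: idealMl.
  by apply: adj_mem => //; rewrite !inE ws !orbT.
right; exists s; split => //; first by move=> z zs; rewrite inE zs orbT.
have hJ : is_ideal (adj I (y :: s)) by exact: is_ideal_adj.
apply: adj_min => //; first exact: adj_sub.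
have sJ : adj I s `<=` adj I (y :: s).
  by apply: adj_mono => // z zs; rewrite inE zs orbT.
move=> z; rewrite inE => /orP [/eqP ->|zs]; last by apply: sJ; exact: adj_mem.
rewrite (_ : x = d * (y - (y - c * x))); last by rewrite subKr mulrA [d * c]mulrC cd mul1r.
apply: idealMl => //; apply: idealB => //; last exact: sJ.
by apply: adj_mem => //; rewrite mem_head.
Qed.

(** Steinitz exchange: an element of t outside I + m(s) replaces a member of s, and if there is
    none, Nakayama gives m = I. The selection stays inside t, whose elements have a prescribed shape
    in the application to A[X]. *)
Lemma exchange_gens m I s t : nonunits_in m -> is_ideal I ->
  pset m = adj I s -> pset m = adj I t ->
  exists t', [/\ {subset t' <= t}, (size t' <= size s)%N & pset m = adj I t'].
Proof.
move=> hm; have [r] := ubnP (size s).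
elim: r => // r IHr in I s *; rewrite ltnS => sr hI ms mt.
have [h|h] := pselect (forall y, y \in t -> madj m I s y).
  exists [::]; split => //=; rewrite ms; apply/seteqP; split; last exact: adj_sub.
  apply: adj_min => //; apply: (nakayama hm hI) => x xs.
  have : adj I t x by rewrite -mt ms; exact: adj_mem.
  apply: adj_min => //; [exact: is_ideal_madj|exact: madj_sub].
have [y [yt ny]] : exists y, y \in t /\ ~ madj m I s y.
  by apply: contrapT => k; apply: h => y yt; apply: contrapT => ny; apply: k; exists y.
have yI : adj I s y by rewrite -ms mt; exact: adj_mem.
have [//|[s' [ss' sub sJ]]] := adj_exchange hm hI yI.
have hy : is_ideal (adj I [:: y]) by exact: is_ideal_adj.
have e J u : J = adj I u -> adj I [:: y] `<=` J -> J `<=` adj I (y :: u) -> J = adj (adj I [:: y]) u.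
  move=> eJ h1 h2; rewrite adj_cons //; apply/seteqP; split => //.
  rewrite eJ; apply: adj_min; first exact: is_ideal_adj.
    exact: adj_sub.
  move=> z; rewrite inE => /orP [/eqP ->|zu]; last exact: adj_mem.
  by rewrite -eJ; apply: h1; apply: adj_mem => //; rewrite mem_head.
have sub1 : adj I [:: y] `<=` pset m.
  rewrite mt; apply: adj_mono => // z; by rewrite inE => /eqP ->.
have [||||t' [t't size_t' mt']] := IHr (adj I [:: y]) s'.
- by rewrite ss'.
- by [].
- rewrite adj_cons //; apply/seteqP; split; first by rewrite ms.
  rewrite ms; apply: adj_min; first exact: is_ideal_adj.
    exact: adj_sub.
  by move=> z; rewrite inE => /orP [/eqP -> //|/sub zs]; exact: adj_mem.
- apply: e => //; rewrite mt; apply: adj_mono => // z zt; by rewrite inE zt orbT.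
exists (y :: t'); split.
- by move=> z; rewrite inE => /orP [/eqP -> //|/t't].
- by rewrite /= -ss' ltnS.
- by rewrite mt' adj_cons.
Qed.

(* As [madj m [set 0] s] is the square of the maximal ideal, [y] belongs to a
   regular system of parameters. *)
Lemma regular_prime_elt m s y : nonunits_in m -> pset m = adj [set 0] s ->
  ht m (size s) -> y \in m -> ~ madj m [set 0] s y ->
  exists q, pset q = adj [set 0] [:: y].
Proof.
move=> hm ms [q0 hq0] ym ny; have h0 := @is_ideal0 A.
have ys : adj [set 0] s y by rewrite -ms.
have [//|[s' [ss' sub sJ]]] := adj_exchange hm h0 ys.
move: hq0; rewrite -ss' => hq0.
have [q [_ hq yq]] := chn_move noethA hq0 ym.
exists q; apply/esym; apply: (@regular_prime m _ s') => //.
- exact: is_ideal_adj.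
- rewrite adj_cons // ms; apply/seteqP; split => //.
  apply: adj_min; first exact: is_ideal_adj.
    exact: adj_sub.
  by move=> z; rewrite inE => /orP [/eqP -> //|/sub zs]; exact: adj_mem.
- apply: adj_min; [exact: is_ideal_pset|by move=> a ->; exact: pt0|].
  by move=> z; rewrite inE => /eqP ->.
Qed.

End RegularLocal.

Section LocalDimension.
Variable A : comNzRingType.
Implicit Types (p q m : Spec_pt A) (s t : seq A).

Lemma local_ring_pt : local_ring A -> exists m, nonunits_in m.
Proof.
move=> hl; have pr : prime_ideal [pred a : A | `[< ~ invertible a >]].
  have M (a b : A) : ~ invertible b -> ~ invertible (a * b).
    by move=> nb /invertibleM [].
  split; last first.
    move=> a b /asboolP h; apply/orP; apply: contrapT => k; apply: h.
    by apply/invertibleM; split; apply: contrapT => h; apply: k; [left|right]; apply/asboolP.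
  split; [apply/asboolP|apply/asboolP|move=> a u v /asboolP nu /asboolP nv; apply/asboolP].
  - by move=> [b]; rewrite mul0r => /esym /eqP; rewrite oner_eq0.
  - by move=> h; apply: h; exact: invertible1.
  - by move=> /hl []; [exact: M|].
by exists (SpecPt pr) => a /asboolP; apply: contrapT.
Qed.

Lemma chn_prime_chain q p d : chn d q p -> prime_chain A d.
Proof.
move=> h; suff [P [_ hP]] : exists P : nat -> Spec_pt A, P 0%N = q /\
    forall i, (i < d)%N -> ltp (P i) (P i.+1).
  by exists (fun i => P i : {pred A}); split => i; [move=> _; exact: pt_prime|exact: hP].
elim: d q h => [q _|d IHd q [q1 [h /IHd [P [P0 hP]]]]]; first by exists (fun=> q).
exists (fun i => if i is j.+1 then P j else q); split => // -[_|i]; first by rewrite P0.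
by rewrite ltnS; exact: hP.
Qed.

Lemma prime_chainP m d : nonunits_in m -> prime_chain A d <-> ht m d.
Proof.
move=> hm; split => [[P [pP hP]]|[q /chn_prime_chain //]].
suff h k : (k <= d)%N -> forall hk : prime_ideal (P (d - k)%N), chn k (SpecPt hk) m.
  have p0 : prime_ideal (P (d - d)%N) by apply: pP; exact: leq_subr.
  by exists (SpecPt p0); exact: h.
elim: k => [_ hk|k IHk kd hk]; first exact: nonunits_lep.
have hk' : prime_ideal (P (d - k)%N) by apply: pP; exact: leq_subr.
exists (SpecPt hk'); split; last by apply: IHk; exact: ltnW.
have := hP (d - k.+1)%N; rewrite -subSn // subSS; apply.
exact: leq_subr.
Qed.

(** [height_bound] supplies the upper bound of the dimension, so a generating list and a chain of
    the same length characterize regularity. *)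
Lemma regular_localP m : nonunits_in m -> regular_local_ring A <->
  noetherian A /\ exists s, pset m = adj [set 0] s /\ ht m (size s).
Proof.
move=> hm; have h0 := @is_ideal0 A.
split => [[_ noeth [s [[/(prime_chainP _ hm) hs _] ms]]]|[noeth [s [ms hs]]]].
  split => //; exists s; split => //; apply/seteqP; split => a.
    by move=> /(nonunits_inE _ hm) /ms; rewrite ideal_genE.
  by rewrite -ideal_genE => /ms na; exact/nonunits_inE.
split => //.
  move=> a b ab; apply: contrapT => h.
  have am : a \in m by apply/(nonunits_inE _ hm) => ia; apply: h; left.
  have bm : b \in m by apply/(nonunits_inE _ hm) => ia; apply: h; right.
  by move: (invertible_notin m ab); rewrite ptD.
exists s; split.
  split; first exact/(prime_chainP _ hm).
  move=> /(prime_chainP _ hm) [q hq]; suff : ((size s).+1 <= size s)%N by rewrite ltnn.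
  apply: (height_bound noeth h0 _ _ _ hq).
  - by move=> x xs; suff : pset m x by []; rewrite ms; exact: adj_mem.
  - by move=> a am; exists 1; rewrite pt1 mul1r -ms; split.
  - by move=> a ->; exact: pt0.
by move=> a; rewrite -(nonunits_inE _ hm) ideal_genE -ms.
Qed.

End LocalDimension.

(** * Regularity at a prime, expressed without localizing *)

Section RegularAt.
Variable A : comNzRingType.
Implicit Types (p q : Spec_pt A) (s : seq A).

(** The denominators of a regular system of parameters are cleared; in this form regularity can be
    carried from A to A[X]. *)
Definition regular_at p := exists s, [/\ {subset s <= p},
  forall a, a \in p -> exists u, u \notin p /\ adj [set 0] s (u * a) & ht p (size s)].

Lemma ht_mloc p d : ht (mloc p) d <-> ht p d.
Proof. by rewrite -(ht_preimp (to_loc_like p)) preimp_mloc. Qed.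

Lemma krull_dim_le_loc p d : krull_dim_le (loc p) d <-> ~ ht p d.+1.
Proof. by rewrite /krull_dim_le (prime_chainP _ (@nonunits_mloc _ p)) ht_mloc. Qed.

Lemma regular_atP p : noetherian A -> regular_local_ring (loc p) <-> regular_at p.
Proof.
move=> noeth; rewrite (regular_localP (@nonunits_mloc _ p)).
have lk := to_loc_like p; have h0 := @is_ideal0 (loc p).
split => [[_ [s [ms /ht_mloc hs]]]|[s [sp sP /ht_mloc hs]]].
  pose num (x : loc p) := (repr x).1.
  have numP (x : loc p) : exists u, invertible u /\ x * u = to_loc p (num x).
    have [a [t [tp ex]]] := lfrac_surj x.
    exists (to_loc p (val (repr x).2)); split; first exact/invertible_to_loc/(valP (repr x).2).
    have e : x = lfrac (repr x).1 (valP (repr x).2).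
      rewrite /lfrac -[LHS]reprK; congr (\pi _); case: (repr x) => b [r rp] /=.
      by congr (_, exist _ _ _); exact: Prop_irrelevance.
    by have := lfrac_mul (repr x).1 (valP (repr x).2); rewrite -e.
  have sm x : x \in s -> x \in mloc p.
    by move=> xs; suff : pset (mloc p) x by []; rewrite ms; exact: adj_mem.
  exists (map num s); split; last by rewrite size_map.
    move=> _ /mapP [x xs ->]; rewrite -mlocE; have [u [_ <-]] := numP x.
    by rewrite mulrC ptMl ?sm.
  move=> a; rewrite -mlocE => am.
  have [u [iu hu]] : exists u, invertible (to_loc p u) /\ adj [set 0] (map num s) (u * a).
    apply: (adj_loc_like_inv lk); suff : pset (mloc p) (to_loc p a).
      rewrite ms; apply: adj_min; first exact: is_ideal_adj.
        exact: adj_sub.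
      move=> x xs; have [u [[v uv] e]] := numP x.
      rewrite (_ : x = v * to_loc p (num x)).
        apply: idealMl; first exact: is_ideal_adj.
        by apply: adj_mem => //; do 2!apply: map_f.
      by rewrite -e mulrCA [v * u]mulrC uv mulr1.
    by [].
  by exists u; split => //; exact/invertible_to_loc.
split; first exact: loc_like_noetherian lk noeth.
exists (map (to_loc p) s); split; last by rewrite size_map.
apply/seteqP; split => [x|].
  have [a [t [tp ->]]] := lfrac_surj x => am.
  have [|u [up /(adj_map (to_loc p)) h]] := sP a.
    by rewrite -mlocE -(lfrac_mul a tp) mulrC ptMl.
  have [v uv] : invertible (to_loc p (u * t)) by apply/invertible_to_loc; exact: ptMn.
  rewrite (_ : lfrac a tp = v * to_loc p (u * a)).
    by apply: idealMl => //; exact: is_ideal_adj.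
  by rewrite to_locM -(lfrac_mul a tp) -[LHS]mulr1 -uv to_locM; ring.
apply: adj_min; first exact: is_ideal_pset.
  by move=> x ->; exact: pt0.
by move=> _ /mapP [x /sp xp ->]; rewrite /pset /= mlocE.
Qed.

End RegularAt.

(** * Transport of regularity along isomorphisms and localizations *)

Section RingIso.
Variables (A B : comNzRingType) (f : {rmorphism A -> B}).

Lemma inj_surj_bijective (T T' : Type) (h : T -> T') :
  injective h -> (forall y, exists x, h x = y) -> bijective h.
Proof.
move=> hi /choice [g hg]; exists g => x; last exact: hg.
by apply: hi; rewrite hg.
Qed.

Lemma rmorphism_inv : bijective f ->
  exists g : {rmorphism B -> A}, cancel f g /\ cancel g f.
Proof.
move=> [g fK gK].
have gB : zmod_morphism g by exact: can2_zmod_morphism fK gK.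
have gM : monoid_morphism g by exact: can2_monoid_morphism fK gK.
pose h : {rmorphism B -> A} := HB.pack g (GRing.isZmodMorphism.Build _ _ g gB)
  (GRing.isMonoidMorphism.Build _ _ g gM).
by exists h.
Qed.

(** Seen as a localization with denominator 1, an isomorphism inherits all transport lemmas for
    [loc_like]. *)
Lemma iso_loc_like : bijective f -> loc_like [set 1] f.
Proof.
move=> [g fK gK]; split.
- by move=> u ->; rewrite rmorph1; exact: invertible1.
- by move=> b; exists (g b), 1; rewrite gK rmorph1 mulr1.
- by move=> c e; exists 1; split => //; rewrite mul1r -[c]fK e -(rmorph0 f) fK.
Qed.

Lemma local_surj_pt (m : Spec_pt A) : bijective f -> nonunits_in m ->
  exists m', preimp f m' = m /\ nonunits_in m'.
Proof.
move=> bf hm; have lk := iso_loc_like bf; have [g [fK gK]] := rmorphism_inv bf.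
have av u : [set 1] u -> u \notin m by move=> ->; exact: pt1.
have e : preimp f (extp lk av) = m by exact: preimp_extp.
exists (extp lk av); split => // b; rewrite -[b]gK -(preimpE f) e => /hm [c bc].
by exists (f c); rewrite -rmorphM bc rmorph1.
Qed.

Lemma regular_local_iso : bijective f -> regular_local_ring A -> regular_local_ring B.
Proof.
move=> bf rA; have [hl _ _] := rA; have lk := iso_loc_like bf.
have [m hm] := local_ring_pt hl; have [m' [em hm']] := local_surj_pt bf hm.
move: rA => /(regular_localP hm) [noeth [s [ms hs]]].
apply/(regular_localP hm'); split; first exact: loc_like_noetherian lk noeth.
exists (map f s); rewrite size_map; split; last by apply/(ht_preimp lk); rewrite em.
have [g [fK gK]] := rmorphism_inv bf.
apply/seteqP; split.
  move=> b bm; rewrite -[b]gK; apply: adj_map; rewrite -ms.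
  by rewrite /pset /= -em preimpE gK.
apply: adj_min; first exact: is_ideal_pset.
  by move=> x ->; exact: pt0.
move=> _ /mapP [x xs ->]; rewrite /pset /= -(preimpE f) em.
by suff : pset m x by []; rewrite ms; apply: adj_mem => //; exact: is_ideal0.
Qed.

Lemma krull_dim_le_iso k : bijective f -> krull_dim_le B k -> krull_dim_le A k.
Proof.
move=> bf; have [g [fK gK]] := rmorphism_inv bf; apply: contra_not.
move=> [P [pP hP]]; exists (fun i => (fun b => g b \in P i) : {pred B}); split.
  move=> i /pP hi; exact: (preim_prime g (SpecPt hi)).
move=> i /hP [sub [a [a1 a2]]]; split; first by move=> b; exact: sub.
by exists (f a); rewrite !unfold_in fK.
Qed.

End RingIso.

Section LocLift.
Variables (A C : comNzRingType) (p : Spec_pt A) (g : {rmorphism A -> C}).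
Hypothesis g_unit : forall s, s \notin p -> invertible (g s).

Lemma loc_lift_bij : loc_like [set u | u \notin p] g -> bijective (loc_lift g_unit).
Proof.
move=> lk; apply: inj_surj_bijective.
  move=> x y e; apply: subr0_eq; move: e => /eqP; rewrite -subr_eq0.
  rewrite -rmorphB => /eqP; move: (x - y) => {x y} x.
  have [a [s [sp ->]]] := lfrac_surj x => e.
  have := loc_liftE g_unit a sp; rewrite [X in X * _]e mul0r => /esym.
  move=> /(loc_like_ker lk) [u [up ua]].
  apply: (@loc_cancel _ p _ _ s) => //; rewrite mul0r lfrac_mul -(rmorph0 (to_loc p)).
  by apply/to_loc_eq; exists u; rewrite ua mulr0.
move=> y; have [c [u [up e]]] := loc_like_frac lk y.
exists (lfrac c up); apply: (invertible_cancel (g_unit up)).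
by rewrite loc_liftE e.
Qed.

End LocLift.

Lemma Spec_stalk_bij (A B : comNzRingType) (U : set A) (phi : {rmorphism A -> B})
  (q : Spec_pt B) : loc_like U phi -> bijective (Spec_stalk phi q).
Proof. by move=> lk; apply: loc_lift_bij; exact: loc_like_stalk lk q. Qed.

Definition has_Rk (k : nat) (A : comNzRingType) : Prop :=
  forall p : Spec_pt A, krull_dim_le (loc p) k -> regular_local_ring (loc p).

Lemma iso_Rk k (A B : comNzRingType) (f : {rmorphism A -> B}) : bijective f ->
  (krull_dim_le A k -> regular_local_ring A) <-> (krull_dim_le B k -> regular_local_ring B).
Proof.
move=> bf; have [g [fK gK]] := rmorphism_inv bf.
have bg : bijective g by exists f.
split => h /krull_dim_le_iso hk.
  by apply: (regular_local_iso bf); apply: h; exact: hk bf.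
by apply: (regular_local_iso bg); apply: h; exact: hk bg.
Qed.

Lemma loc_like_Rk_at k (A B : comNzRingType) (U : set A) (phi : {rmorphism A -> B})
  (q : Spec_pt B) : loc_like U phi ->
  (krull_dim_le (loc (preimp phi q)) k -> regular_local_ring (loc (preimp phi q))) <->
  (krull_dim_le (loc q) k -> regular_local_ring (loc q)).
Proof. by move=> lk; apply: iso_Rk; exact: Spec_stalk_bij lk. Qed.

Lemma loc_like_Rk k (A B : comNzRingType) (U : set A) (phi : {rmorphism A -> B}) :
  loc_like U phi -> has_Rk k A -> has_Rk k B.
Proof. by move=> lk h q; apply/(loc_like_Rk_at k q lk); exact: h. Qed.

(** * Polynomial rings *)

Section Poly.
Variable A : comNzRingType.
Implicit Types (p : Spec_pt A) (q : Spec_pt {poly A}) (f g : {poly A}).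

(** Gauss's argument: if i and j are the least indices of coefficients outside p, the coefficient of
    fg at i + j is f_i g_j modulo p. *)
Lemma polyX_prime p : prime_ideal [pred f : {poly A} | `[< forall i, f`_i \in p >]].
Proof.
split; last first.
  move=> f g /asboolP fg; apply/orP; apply: contrapT => h.
  have ex (f' : {poly A}) : ~ (forall i, f'`_i \in p) -> exists i, f'`_i \notin p.
    by move=> k; apply: contrapT => nk; apply: k => i; apply: contrapT => /negP ?; apply: nk; exists i.
  have /ex fi : ~ forall i, f`_i \in p by move=> k; apply: h; left; apply/asboolP.
  have /ex gj : ~ forall i, g`_i \in p by move=> k; apply: h; right; apply/asboolP.
  case: (ex_minnP fi) => i fip imin; case: (ex_minnP gj) => j gjp jmin.
  have := fg (i + j)%N; rewrite coefM.
  have hi : (i < (i + j).+1)%N by rewrite ltnS leq_addr.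
  rewrite (bigD1 (Ordinal hi)) //= addKn => hs.
  have : f`_i * g`_j \in p.
    rewrite -[_ * _](addrK (\sum_(k < (i + j).+1 | k != Ordinal hi) f`_k * g`_(i + j - k))).
    apply: idealB (is_ideal_pset p) hs _; apply: ideal_sum (is_ideal_pset p) _.
    move=> k; rewrite -val_eqE /= /pset /= ptM => ki.
    case: (ltngtP k i) ki => // ki _; apply/orP; [left|right].
      by apply: contraT => /imin; rewrite leqNgt ki.
    by apply: contraT => /jmin; rewrite leqNgt ltn_subLR ?(ltn_add2r, ki) // -ltnS.
  by rewrite ptM (negPf fip) (negPf gjp).
split; [apply/asboolP|apply/asboolP|].
- by move=> i; rewrite coef0 pt0.
- by move=> /(_ 0%N); rewrite coef1 /=; apply/negP; exact: pt1.
- move=> a u v /asboolP hu /asboolP hv; apply/asboolP => i.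
  rewrite coefD coefM ptD //; apply: ideal_sum (is_ideal_pset p) _ => j _.
  exact: ptMl.
Qed.

Definition polyXp p : Spec_pt {poly A} := SpecPt (polyX_prime p).

Lemma polyXpP p f : reflect (forall i, f`_i \in p) (f \in polyXp p).
Proof. exact: asboolP. Qed.

Lemma polyXpC p a : (a%:P \in polyXp p) = (a \in p).
Proof.
apply/polyXpP/idP => [/(_ 0%N)|ap i]; rewrite coefC //.
by case: eqP => // _; exact: pt0.
Qed.

Lemma polyXp_lep p q : lep p (preimp polyC q) -> lep (polyXp p) q.
Proof.
move=> h f /polyXpP fp; rewrite -[f]coefK poly_def.
apply: ideal_sum (is_ideal_pset q) _ => i _; rewrite -mul_polyC mulrC.
by apply: ptMl; rewrite -(preimpE polyC); exact: h.
Qed.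

Lemma chn_polyXp l p p' : chn l p p' -> chn l (polyXp p) (polyXp p').
Proof.
elim: l p => /= [p h f /polyXpP fp|l IHl p [p1 [[h [a [a1 a2]]] /IHl h']]].
  by apply/polyXpP => i; exact: h.
exists (polyXp p1); split => //; split; last by exists a%:P; rewrite !polyXpC.
by move=> f /polyXpP fp; apply/polyXpP => i; exact: h.
Qed.

(** If q contained all constants from p, it would contain p[X] and no strict chain could start
    there. So some a in p is outside q, and forcing a into the next prime keeps the inclusion strict
    after contraction. *)
Lemma chn_polyXp_inv l p q : noetherian {poly A} -> chn l q (polyXp p) ->
  chn l (preimp polyC q) p.
Proof.
move=> noeth; elim: l q => /= [q h a|l IHl q h].
  by rewrite preimpE => /h; rewrite polyXpC.
have [a [ap aq]] : exists a, a \in p /\ a%:P \notin q.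
  apply: contrapT => k; case: h => q1 [[_ [f [f1 /negP f0]]] /chn_le h1].
  apply: f0; apply: (polyXp_lep (p := p)); last exact: h1.
  by move=> a ap; apply: contrapT => /negP na; apply: k; exists a.
have [|q' [[qq' _] h' aq']] := chn_move noeth h (a := a%:P).
  by rewrite polyXpC.
exists (preimp polyC q'); split; last exact: IHl.
by split => [b /qq' //|]; exists a.
Qed.

Lemma common_denom p (I : set A) (r : seq A) : is_ideal I ->
  (forall a, a \in r -> exists u, u \notin p /\ I (u * a)) ->
  exists u, u \notin p /\ forall a, a \in r -> I (u * a).
Proof.
move=> hI; elim: r => [|x r IHr] h; first by exists 1; rewrite pt1.
have [|u [up hu]] := IHr; first by move=> a ar; apply: h; rewrite inE ar orbT.
have [v [vp hv]] := h x (mem_head _ _).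
exists (u * v); split; first exact: ptMn.
move=> a; rewrite inE => /orP [/eqP ->|/hu ua]; first by rewrite -mulrA; exact: idealMl.
by rewrite mulrAC mulrC; exact: idealMl.
Qed.

Lemma polyXp_gens p (s : seq A) f : 
  (forall a, a \in p -> exists u, u \notin p /\ adj [set 0] s (u * a)) ->
  f \in polyXp p -> exists u, u \notin p /\ adj [set 0] (map polyC s) (u%:P * f).
Proof.
move=> h /polyXpP fp.
have [|a /(nthP 0) [i _ <-]|u [up hu]] := @common_denom p (adj [set 0] s) f.
- exact: is_ideal_adj (@is_ideal0 A).
- by apply: h; exact: fp.
have hI : is_ideal (adj [set 0] (map polyC s)) by exact: is_ideal_adj (@is_ideal0 _).
exists u; split => //; rewrite -[f]coefK poly_def mulr_sumr.
apply: ideal_sum => // i _; rewrite -mul_polyC mulrA -rmorphM mulrC.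
by apply: idealMl => //; apply: adj_map; apply: hu; exact: mem_nth.
Qed.

Lemma size_sub_lead f g : (size g <= size f)%N -> g`_(size f).-1 = lead_coef f -> f != 0 ->
  (size (f - g)%R < size f)%N.
Proof.
move=> sfg lfg f0; have sf : (0 < size f)%N by rewrite size_poly_gt0.
rewrite -(prednK sf) ltnS; apply/leq_sizeP => i; rewrite leq_eqVlt => /orP [/eqP <-|fi].
  by rewrite coefB -lead_coefE lfg subrr.
rewrite prednK // in fi.
by rewrite coefB !nth_default ?subrr //; exact: leq_trans fi.
Qed.

(** Either q is p[X], or it is generated, up to multipliers, by p and one f of least degree in q
    outside p[X]. In the second case the extra generator is matched by the extra inclusion of p[X]
    in q. *)
Lemma regular_at_poly q : regular_at (preimp polyC q) -> regular_at q.
Proof.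
set p := preimp polyC q => -[s [sp sP [p0 hs]]].
have pq : lep (polyXp p) q by exact: polyXp_lep.
have [qp|] := pselect (lep q (polyXp p)).
  exists (map polyC s); split.
  - by move=> _ /mapP [x /sp xp ->].
  - move=> f /qp /(polyXp_gens sP) [u [up hu]].
    by exists u%:P; rewrite -(preimpE polyC).
  - rewrite size_map; exists (polyXp p0).
    exact: chn_lep (chn_polyXp hs) pq.
move=> nqp.
have ex : exists n, `[< exists f, [/\ f \in q, f \notin polyXp p & size f = n] >].
  apply: contrapT => k; apply: nqp => f fq; apply: contrapT => /negP fp.
  by apply: k; exists (size f); apply/asboolP; exists f.
case: (ex_minnP ex) => n /asboolP [f [fq fp fn]] nmin.
have lt_p g : g \in q -> (size g < n)%N -> g \in polyXp p.
  move=> gq gn; apply: contraT => gp.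
  have /nmin : `[< exists f, [/\ f \in q, f \notin polyXp p & size f = size g] >].
    by apply/asboolP; exists g.
  by rewrite leqNgt gn.
have f0 : f != 0 by apply: contra fp => /eqP ->; exact: pt0.
have n0 : (0 < n)%N by rewrite -fn size_poly_gt0.
(* Otherwise f without its leading term would still be in q and outside p[X], against minimality. *)
have lp : lead_coef f \notin p.
  apply/negP => lp; move/negP: fp; apply.
  have lq : lead_coef f *: 'X^(n.-1) \in q.
    by rewrite -mul_polyC mulrC ptMl.
  have lf0 : lead_coef f != 0 by rewrite lead_coef_eq0.
  rewrite -[f](subrK (lead_coef f *: 'X^(n.-1))) ptD //; last first.
    by apply/polyXpP => i; rewrite coefZ mulrC ptMl.
  apply: lt_p; first exact: idealB (is_ideal_pset q) _ _.
  rewrite -[in X in (_ < X)%N]fn; apply: size_sub_lead => //.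
    by rewrite (leq_trans (size_scale_leq _ _)) // size_polyXn prednK // fn.
  by rewrite fn coefZ coefXn eqxx mulr1.
have hI : is_ideal (adj [set 0] (f :: map polyC s)) by exact: is_ideal_adj (@is_ideal0 _).
exists (f :: map polyC s); split.
- by move=> x; rewrite inE => /orP [/eqP -> //|/mapP [y /sp yp ->]].
- move=> g; have [m] := ubnP (size g); elim: m => // m IHm in g *; rewrite ltnS => gm gq.
  have [gn|ng] := ltnP (size g) n.
    have [u [up hu]] := polyXp_gens sP (lt_p _ gq gn).
    exists u%:P; rewrite -(preimpE polyC); split => //.
    apply: adj_mono hu => //; first exact: is_ideal0.
    by move=> x xs; rewrite inE xs orbT.
  (* Pseudo-division by f; the multiplier [lead_coef f] is outside q. *)
  pose g' := (lead_coef f)%:P * g - (lead_coef g)%:P * 'X^(size g - n) * f.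
  have g'q : g' \in q.
    by apply: idealB (is_ideal_pset q) _ _; exact: ptMl.
  have sg' : (size g' < size g)%N.
    have sg : (0 < size g)%N by exact: leq_trans ng.
    rewrite -(prednK sg) ltnS; apply/leq_sizeP => i gi.
    rewrite coefB -mulrA !coefCM coefXnM ifF; last by lia.
    move: gi; rewrite leq_eqVlt => /orP [/eqP <-|gi].
      rewrite !lead_coefE fn (_ : (_ - _ = n.-1)%N); last by lia.
      by rewrite mulrC subrr.
    rewrite prednK // in gi.
    rewrite (nth_default _ gi) [f`__]nth_default ?mulr0 ?subrr // fn; lia.
  have [|u [uq hu]] := IHm g' _ g'q; first by exact: leq_trans gm.
  exists (u * (lead_coef f)%:P); split; first by rewrite ptMn // -(preimpE polyC).
  rewrite (_ : _ * g = u * g' + u * (lead_coef g)%:P * 'X^(size g - n) * f); last first.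
    by rewrite /g'; ring.
  apply: idealD => //; apply: idealMl => //; apply: adj_mem; rewrite ?mem_head //.
  exact: is_ideal0.
- rewrite /= size_map -addn1; have := chn_polyXp hs => h.
  have h1 : ltp (polyXp p) q by split => //; exists f.
  exists (polyXp p0); elim: (size s) (polyXp p0) h => [|l IHl] r /=.
    by move=> rp; exists q; split => //; exact: lep_ltp_trans rp h1.
  by move=> [r1 [rr1 /IHl h]]; exists r1.
Qed.

Lemma poly_Rk k : noetherian A -> noetherian {poly A} -> has_Rk k A -> has_Rk k {poly A}.
Proof.
move=> noeth noethX h q /krull_dim_le_loc hq; apply/(regular_atP _ noethX).
apply: regular_at_poly; apply/(regular_atP _ noeth); apply: h.
apply/krull_dim_le_loc; apply: contra_not hq => -[p0 /chn_polyXp hp0].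
exists (polyXp p0); apply: chn_lep hp0 _; exact: polyXp_lep.
Qed.

Lemma coef_adj (s : seq A) f i : adj [set 0] (map polyC s) f -> adj [set 0] s f`_i.
Proof.
elim: s f => /= [f ->|x s IHs f [c /IHs h]]; first by rewrite coef0.
by exists c`_i; rewrite -coefMC -coefB.
Qed.

Lemma sub_map (T T' : eqType) (h : T -> T') (s : seq T) (t : seq T') :
  {subset t <= map h s} -> exists t0, {subset t0 <= s} /\ t = map h t0.
Proof.
elim: t => [|y t IHt] sub; first by exists [::].
have [|t0 [t0s ->]] := IHt; first by move=> z zt; apply: sub; rewrite inE zt orbT.
have /mapP [x xs ->] : y \in map h s by apply: sub; rewrite mem_head.
exists (x :: t0); split => // z; rewrite inE => /orP [/eqP -> //|]; exact: t0s.
Qed.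

(** At p[X] the maximal ideal is generated by constants from p. By exchange, as many of these as the
    dimension suffice, and comparing coefficients brings them down to A. *)
Lemma poly_Rk_inv k p : noetherian A -> noetherian {poly A} ->
  (krull_dim_le (loc (polyXp p)) k -> regular_local_ring (loc (polyXp p))) ->
  krull_dim_le (loc p) k -> regular_local_ring (loc p).
Proof.
move=> noeth noethX h /krull_dim_le_loc hp; apply/(regular_atP _ noeth).
set q := polyXp p in h *.
have /h : krull_dim_le (loc q) k.
  apply/krull_dim_le_loc; apply: contra_not hp => -[q0 /(chn_polyXp_inv noethX) h0].
  by exists (preimp polyC q0).
move/(regular_localP (@nonunits_mloc _ q)) => [_ [s [ms /ht_mloc [q0 hs]]]].
have [t ht] := (noetherianP A).1 noeth _ (is_ideal_pset p).
have h0 := @is_ideal0 (loc q); have lq := to_loc_like q.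
have tp a : a \in t -> a \in p.
  by move=> at_; suff : pset p a by []; rewrite ht; apply: adj_mem => //; exact: is_ideal0.
have mt : pset (mloc q) = adj [set 0] (map (to_loc q \o polyC) t).
  apply/seteqP; split; last first.
    apply: adj_min; first exact: is_ideal_pset.
      by move=> x ->; exact: pt0.
    by move=> _ /mapP [a /tp ap ->]; rewrite /pset /= mlocE polyXpC.
  move=> x; have [f [g [gq ->]]] := lfrac_surj x => fm.
  have [||u [up hu]] := @polyXp_gens p t f.
  - by move=> a ap; exists 1; rewrite pt1 mul1r -ht.
  - by rewrite -mlocE -(lfrac_mul f gq) mulrC ptMl.
  have [v uv] : invertible (to_loc q (u%:P * g)).
    by apply/invertible_to_loc; rewrite ptMn // polyXpC.
  rewrite (_ : lfrac f gq = v * to_loc q (u%:P * f)).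
    apply: idealMl; first exact: is_ideal_adj.
    by rewrite map_comp; exact: adj_map.
  by rewrite to_locM -(lfrac_mul f gq) -[LHS]mulr1 -uv to_locM; ring.
have [t' [/sub_map [t0 [t0t ->]] st' mt']] :=
  exchange_gens (@nonunits_mloc _ q) h0 ms mt.
exists t0; split.
- by move=> a /t0t /tp.
- move=> a ap; have : pset (mloc q) (to_loc q a%:P) by rewrite /pset /= mlocE polyXpC.
  rewrite mt' map_comp => /(adj_loc_like_inv lq) [u [/invertible_to_loc uq hu]].
  (* A multiplier outside p[X] has a coefficient outside p, and the relation is read off at that
     coefficient. *)
  have [i ui] : exists i, u`_i \notin p.
    apply: contrapT => k'; move/negP: uq; apply; apply/polyXpP => i.
    by apply: contrapT => /negP ui; apply: k'; exists i.
  by exists u`_i; split => //; rewrite -coefMC; exact: coef_adj.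
- rewrite size_map in st'; apply: ht_le st' _; exists (preimp polyC q0).
  exact: chn_polyXp_inv hs.
Qed.

End Poly.

(** [Lc n] is the ideal of n-th coefficients of members of J of degree at most n. It grows with n
    and is constant from N on, so lifts of generators for n up to N suffice to cancel every leading
    term. *)
Lemma hilbert_basis (A : comNzRingType) : noetherian A -> noetherian {poly A}.
Proof.
move=> /noetherianP noeth; apply/noetherianP => J hJ.
have h0 := @is_ideal0 {poly A}; have h0A := @is_ideal0 A.
pose Lc n := [set a | exists f, [/\ J f, (size f <= n.+1)%N & f`_n = a]].
have hL n : is_ideal (Lc n).
  split; first by exists 0; rewrite size_poly0 coef0; split => //; exact: ideal0.
  move=> a u v [f [Jf sf <-]] [g [Jg sg <-]]; exists (a%:P * f + g).
  split; [exact: hJ.2| |by rewrite coefD coefCM].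
  rewrite (leq_trans (size_polyD _ _)) // geq_max sg andbT mul_polyC.
  exact: leq_trans (size_scale_leq _ _) sf.
have Lmono n m : (n <= m)%N -> Lc n `<=` Lc m.
  move=> nm a [f [Jf sf <-]]; exists (f * 'X^(m - n)); split.
  - by rewrite mulrC; exact: idealMl.
  - rewrite (leq_trans (size_polyMleq _ _)) // size_polyXn addnS /=.
    by rewrite -(subnKC nm) addKn -addSn leq_add2r.
  - by rewrite coefMXn ltnNge leq_subr /= subKn.
have [s hs] : exists s, \bigcup_n Lc n = adj [set 0] s.
  apply: noeth; split; first by exists 0%N => //; exact: ideal0.
  move=> a u v [n _ hn] [m _ hm]; exists (maxn n m) => //; apply: (hL _).2.
    by apply: Lmono hn; exact: leq_maxl.
  by apply: Lmono hm; exact: leq_maxr.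
have [N hN] : exists N, forall n, Lc n `<=` Lc N.
  have [N sN] : exists N, {in s, forall x, Lc N x}.
    have : {in s, forall x, (\bigcup_n Lc n) x}.
      by move=> x xs; rewrite hs; exact: adj_mem.
    elim: {hs} s => [_|x s IHs h]; first by exists 0%N.
    have [|N sN] := IHs; first by move=> y ys; apply: h; rewrite inE ys orbT.
    have [n _ xn] := h x (mem_head _ _); exists (maxn n N) => y.
    rewrite inE => /orP [/eqP ->|/sN yN]; first by apply: Lmono xn; exact: leq_maxl.
    by apply: Lmono yN; exact: leq_maxr.
  exists N => n a an; have : (\bigcup_n Lc n) a by exists n.
  by rewrite hs; apply: adj_min => // x ->; exact: ideal0.
have lift n (r : seq A) : {in r, forall a, Lc n a} -> exists P : seq {poly A},
    {in P, forall f, J f /\ (size f <= n.+1)%N} /\ r = [seq f`_n | f : {poly A} <- P].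
  elim: r => [_|a r IHr h]; first by exists [::].
  have [|P [hP ->]] := IHr; first by move=> y ys; apply: h; rewrite inE ys orbT.
  have [f [Jf sf <-]] := h a (mem_head _ _); exists (f :: P); split => //.
  by move=> g; rewrite inE => /orP [/eqP ->|/hP].
have /choice [P hP] : forall n, exists Q : seq {poly A},
    {in Q, forall f, J f /\ (size f <= n.+1)%N} /\
    Lc n = adj [set 0] [seq f`_n | f : {poly A} <- Q].
  move=> n; have [r hr] := noeth _ (hL n).
  have [|Q [hQ e]] := lift n r; first by move=> a ar; rewrite hr; exact: adj_mem.
  by exists Q; rewrite -e.
have topcoef n a : Lc n a -> exists g, [/\ adj [set 0] (P n) g, (size g <= n.+1)%N & g`_n = a].
  have [hPn ->] := hP n; elim: (P n) a hPn => [|f Q IHQ] a /= hQ.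
    by move=> ->; exists 0; rewrite size_poly0 coef0.
  move=> [c hc]; have [|g [hg sg eg]] := IHQ _ _ hc.
    by move=> y ys; apply: hQ; rewrite inE ys orbT.
  exists (g + c%:P * f); split; first by exists c%:P; rewrite addrK.
    rewrite (leq_trans (size_polyD _ _)) // geq_max sg mul_polyC.
    by rewrite (leq_trans (size_scale_leq _ _)) //; case: (hQ f (mem_head _ _)).
  by rewrite coefD coefCM eg subrK.
pose G := flatten [seq P n | n <- iota 0 N.+1].
exists G; apply/seteqP; split; last first.
  apply: adj_min => // [x ->|f /flattenP [_ /mapP [n _ ->]]]; first exact: ideal0.
  by case: (hP n) => h _ /h [].
have PG n : (n <= N)%N -> adj [set 0] (P n) `<=` adj [set 0] G.
  move=> nN; apply: adj_mono => // f fP; apply/flattenP; exists (P n) => //.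
  by apply: map_f; rewrite mem_iota.
have hG : is_ideal (adj [set 0] G) by exact: is_ideal_adj.
move=> f; have [m] := ubnP (size f); elim: m => // m IHm in f *; rewrite ltnS => fm Jf.
have [->|f0] := eqVneq f 0; first exact: ideal0.
pose n := (size f).-1; have sf : (0 < size f)%N by rewrite size_poly_gt0.
have Ln : Lc (minn n N) f`_n.
  have : Lc n f`_n by exists f; rewrite prednK.
  by case: (leqP n N) => nN; [|exact: hN].
have [g [hg sg eg]] := topcoef _ _ Ln.
pose h := g * 'X^(n - minn n N).
have hh : adj [set 0] G h.
  by rewrite /h mulrC; apply: idealMl => //; apply: PG hg; exact: geq_minr.
rewrite -(subrK h f); apply: idealD => //; apply: IHm.
  apply: leq_trans fm; apply: size_sub_lead => //.
    rewrite (leq_trans (size_polyMleq _ _)) // size_polyXn addnS /=.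
    by rewrite (leq_trans (leq_add sg (leqnn _))) // addSn subnKC ?geq_minl ?prednK.
  rewrite -/n coefMXn ltnNge leq_subr /= subKn ?geq_minl //.
apply: idealB => //.
have JG : adj [set 0] G `<=` J.
  apply: adj_min => // [x ->|k /flattenP [_ /mapP [j _ ->]]]; first exact: ideal0.
  by case: (hP j) => k1 _ /k1 [].
exact: JG.
Qed.

(** * Monoid algebras *)

(* [B] is obtained from [C] by adjoining a variable or an invertible variable. *)
Definition poly_like (C B : comNzRingType) (phi : {rmorphism C -> B}) : Prop :=
  exists x : B,
    (forall b, exists m (p : {poly C}), b * x ^+ m = (map_poly phi p).[x] /\
        (m = 0%N \/ invertible x)) /\
    (forall p : {poly C}, (map_poly phi p).[x] = 0 -> p = 0).

Section PolyLike.
Variables (C B : comNzRingType) (phi : {rmorphism C -> B}).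

(** B is a localization of C[X] whose denominators are the powers of X if x is a unit, and 1
    otherwise. No denominator lies in a prime p[X], so p[X] survives in B; this makes (R_k) descend
    from B to C. *)
Lemma poly_like_loc : poly_like phi -> exists (ev : {rmorphism {poly C} -> B}),
  (forall c, ev c%:P = phi c) /\
  exists U, loc_like U ev /\ forall p u, U u -> u \notin polyXp p.
Proof.
move=> [x [h k]]; pose ev : {rmorphism {poly C} -> B} := horner_eval x \o map_poly phi.
have evE p : ev p = (map_poly phi p).[x] by [].
have evC c : ev c%:P = phi c by rewrite evE map_polyC hornerC.
exists ev; split => //.
have evX m : ev 'X^m = x ^+ m by rewrite evE map_polyXn hornerXn.
exists [set u | exists m, u = 'X^m /\ (m = 0%N \/ invertible x)]; split; last first.
  move=> p _ [m [-> _]]; apply/negP => /polyXpP /(_ m).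
  by rewrite coefXn eqxx; apply/negP; exact: pt1.
split.
- move=> _ [m [-> [->|xi]]]; rewrite evX; first by rewrite expr0; exact: invertible1.
  elim: m => [|m IHm]; first exact: invertible1.
  by rewrite exprS; apply/invertibleM.
- move=> b; have [m [p [e hm]]] := h b; exists p, 'X^m; split; first by exists m.
  by rewrite evX e evE.
- move=> c /k ->; exists 1; rewrite mulr0; split => //.
  by exists 0%N; rewrite expr0; split => //; left.
Qed.

Lemma poly_like_noetherian : poly_like phi -> noetherian C -> noetherian B.
Proof.
move=> /poly_like_loc [ev [_ [U [lk _]]]] hC.
exact: loc_like_noetherian lk (hilbert_basis hC).
Qed.

Lemma poly_like_Rk k : poly_like phi -> noetherian C -> has_Rk k C -> has_Rk k B.
Proof.
move=> /poly_like_loc [ev [_ [U [lk _]]]] noeth h.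
exact: loc_like_Rk lk (poly_Rk noeth (hilbert_basis noeth) h).
Qed.

Lemma poly_like_Rk_inv k : poly_like phi -> noetherian C -> has_Rk k B -> has_Rk k C.
Proof.
move=> /poly_like_loc [ev [_ [U [lk av]]]] noeth h p.
apply: (poly_Rk_inv noeth (hilbert_basis noeth)).
have e : preimp ev (extp lk (@av p)) = polyXp p by exact: preimp_extp.
by rewrite -e; apply/(loc_like_Rk_at k _ lk); exact: h.
Qed.

End PolyLike.

Section AlgLift.
Variables (R C : comNzRingType) (K : nmodType).
Variables (alpha : {rmorphism R -> C}) (beta : K -> C).
Hypotheses (beta0 : beta 0 = 1) (betaD : forall k l, beta (k + l) = beta k * beta l).

Fact alg_lift_scale_additive k : zmod_morphism (fun c => alpha c * beta k).
Proof. by move=> c d; rewrite rmorphB mulrBl. Qed.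

Definition alg_lift_scale k : {additive R -> C} :=
  HB.pack (fun c => alpha c * beta k)
    (GRing.isZmodMorphism.Build R C (fun c => alpha c * beta k) (alg_lift_scale_additive k)).

Definition alg_lift_fun : monoid_alg R K -> C := mono_ext alg_lift_scale.

Lemma alg_lift_funU k c : alg_lift_fun (mono k c) = alpha c * beta k.
Proof. exact: mono_extU. Qed.

Lemma alg_lift_zmod : zmod_morphism alg_lift_fun.
Proof. exact: mono_ext_is_zmod_morphism. Qed.

Definition alg_lift_add : {additive monoid_alg R K -> C} :=
  HB.pack alg_lift_fun (GRing.isZmodMorphism.Build _ _ alg_lift_fun alg_lift_zmod).

Lemma alg_lift_monoid : monoid_morphism alg_lift_fun.
Proof.
split; first by rewrite [LHS]alg_lift_funU rmorph1 beta0 mulr1.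
have f0 : alg_lift_fun 0 = 0 by exact: (raddf0 alg_lift_add).
have fD : {morph alg_lift_fun : x y / x + y} by exact: (raddfD alg_lift_add).
move=> x y; elim/monoid_alg_ind: x => [|x x' e e'|c k].
- by rewrite !(mul0r, f0).
- by rewrite mulrDl !fD e e' mulrDl.
elim/monoid_alg_ind: y => [|y y' e e'|d l].
- by rewrite !(mulr0, f0).
- by rewrite mulrDr !fD e e' mulrDr.
rewrite monoM !alg_lift_funU rmorphM betaD; ring.
Qed.

Definition alg_lift : {rmorphism monoid_alg R K -> C} :=
  HB.pack alg_lift_fun (GRing.isZmodMorphism.Build _ _ alg_lift_fun alg_lift_zmod)
    (GRing.isMonoidMorphism.Build _ _ alg_lift_fun alg_lift_monoid).

Lemma alg_liftU k c : alg_lift (mono k c) = alpha c * beta k.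
Proof. exact: alg_lift_funU. Qed.

End AlgLift.

Section Constants.
Variables (R : comNzRingType) (K : nmodType).

Definition alg_const_fun (c : R) : monoid_alg R K := mono 0 c.

Lemma alg_const_zmod : zmod_morphism alg_const_fun.
Proof. by move=> c d; rewrite /alg_const_fun raddfB. Qed.

Lemma alg_const_monoid : monoid_morphism alg_const_fun.
Proof. by split => // c d; rewrite /alg_const_fun monoM addr0. Qed.

Definition alg_const : {rmorphism R -> monoid_alg R K} :=
  HB.pack alg_const_fun (GRing.isZmodMorphism.Build _ _ alg_const_fun alg_const_zmod)
    (GRing.isMonoidMorphism.Build _ _ alg_const_fun alg_const_monoid).

Lemma alg_constE c : alg_const c = mono 0 c. Proof. by []. Qed.

Lemma mono_coeff (k l : K) (c : R) : (mono k c)@_l = c *+ (k == l).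
Proof. exact: mcoeffU. Qed.

Lemma mono_exp (k : K) (m : nat) : (mono k 1 : monoid_alg R K) ^+ m = mono (k *+ m) 1.
Proof. by elim: m => [|m IHm] //; rewrite exprS IHm monoM mulrS mulr1. Qed.

Lemma const_mul_coeff c (f : monoid_alg R K) k : (mono 0 c * f)@_k = c * f@_k.
Proof.
elim/monoid_alg_ind: f => [|f g ef eg|d l].
- by rewrite mulr0 !mcoeff0 mulr0.
- by rewrite mulrDr !mcoeffD ef eg mulrDr.
by rewrite monoM add0r !mono_coeff mulrnAr.
Qed.

Lemma alg_const_bij : (forall k : K, k = 0) -> bijective alg_const.
Proof.
move=> triv; apply: inj_surj_bijective.
  move=> c d; rewrite !alg_constE => /(congr1 (mcoeff 0)).
  by rewrite !mono_coeff eqxx.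
move=> g; exists (g@_0); rewrite alg_constE; apply/malgP => k.
by rewrite mono_coeff (triv k) eqxx.
Qed.

End Constants.

(** * Toric algebras of regular cones *)

(** Both directions of (R_k) are kept together with noetherianity, so that such extensions compose
    along a tower of monoids. *)
Definition good_ext (A B : comNzRingType) : Prop :=
  noetherian A -> noetherian B /\ forall k, has_Rk k A <-> has_Rk k B.

Lemma good_ext_trans (A B C : comNzRingType) : good_ext A B -> good_ext B C -> good_ext A C.
Proof.
move=> hAB hBC /hAB [/hBC [nC RC] RB]; split => // k; by rewrite RB RC.
Qed.

Lemma iso_good_ext (A B : comNzRingType) (f : {rmorphism A -> B}) :
  bijective f -> good_ext A B.
Proof.
move=> bf noeth; have lk := iso_loc_like bf; split; first exact: loc_like_noetherian lk noeth.
move=> k; split; first exact: loc_like_Rk lk.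
have [g [fK gK]] := rmorphism_inv bf.
by have bg : bijective g by [exists f]; exact: loc_like_Rk (iso_loc_like bg).
Qed.

Lemma poly_like_good_ext (A B : comNzRingType) (f : {rmorphism A -> B}) :
  poly_like f -> good_ext A B.
Proof.
move=> pf noeth; split; first exact: poly_like_noetherian pf noeth.
by move=> k; split; [exact: poly_like_Rk pf noeth|exact: poly_like_Rk_inv pf noeth].
Qed.

Section MonoidStep.
Variables (A : comNzRingType) (K L : nmodType) (iota : {additive K -> L}) (t : L).
Hypothesis step_surj : forall l, exists k m m', l + t *+ m = iota k + t *+ m' /\
  (m = 0%N \/ exists t', t + t' = 0).
Hypothesis step_inj : forall k1 k2 m1 m2, iota k1 + t *+ m1 = iota k2 + t *+ m2 ->
  k1 = k2 /\ m1 = m2.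

Variable phi : {rmorphism monoid_alg A K -> monoid_alg A L}.
Hypothesis phiU : forall k c, phi (mono k c) = mono (iota k) c.

(** By [step_surj] and [step_inj], L is the direct sum of K and the natural or integral multiples of
    t. The variable is the monomial at t, and its independence is seen by reading coefficients at
    iota k + it. *)
Lemma monoid_step_poly_like : poly_like phi.
Proof.
pose x : monoid_alg A L := mono t 1; exists x; split.
  move=> b; elim/monoid_alg_ind: b => [|b b' [m [p [e hm]]] [m' [p' [e' hm']]]|c l].
  - by exists 0%N, 0; rewrite mul0r rmorph0 horner0; split => //; left.
  - exists (m + m')%N, (p * 'X^m' + p' * 'X^m); split.
      rewrite rmorphD !rmorphM /= !map_polyXn !(hornerD, hornerM, hornerXn) -e -e' exprD; ring.
    by case: hm => [->|]; [rewrite add0n|right].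
  - have [k [m [m' [e hm]]]] := step_surj l.
    exists m, ((mono k c)%:P * 'X^m'); split.
      rewrite rmorphM /= map_polyXn hornerM hornerXn.
      have -> : (map_poly phi (mono k c)%:P).[x] = mono (iota k) c.
        by rewrite map_polyC hornerC; exact: phiU.
      by rewrite !mono_exp !monoM !mulr1 e.
    case: hm => [->|[t' tt']]; [by left|right].
    by exists (mono t' 1); rewrite monoM tt' mulr1.
have coefE g i k i' : (phi g * x ^+ i)@_(iota k + t *+ i') = g@_k *+ (i == i').
  elim/monoid_alg_ind: g => [|g h eg eh|c l].
  - by rewrite rmorph0 mul0r !mcoeff0 mul0rn.
  - by rewrite rmorphD mulrDl !mcoeffD eg eh mulrnDl.
  rewrite phiU mono_exp monoM mulr1 !mono_coeff.
  have [/step_inj [-> ->]|ne] := eqVneq; first by rewrite !eqxx.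
  have [elk|] := eqVneq l k; last by rewrite mul0rn.
  have [eii|//] := eqVneq i i'.
  by move: ne; rewrite elk eii eqxx.
move=> p e; apply/polyP => i; rewrite coef0; have [pi|ip] := ltnP i (size p); last first.
  exact: nth_default.
apply/malgP => k; rewrite mcoeff0.
have := congr1 (mcoeff (iota k + t *+ i)) e.
rewrite (@horner_coef_wide _ (size p)); last exact: size_poly.
rewrite raddf_sum /= (bigD1 (Ordinal pi)) //= big1 ?addr0 => [|j].
  by rewrite coef_map coefE eqxx mcoeff0.
by rewrite -val_eqE /= coef_map coefE => /negPf ->.
Qed.

End MonoidStep.

(** * Lattices *)

Section Lattice.
Variables (R : realType) (V : vectType R) (N : set V).
Hypothesis N_struct : Zstructure N.

Lemma Zbasis_in (b : seq V) (i : 'I_(size b)) : Zbasis N b -> N b`_i.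
Proof.
move=> [h _]; apply/h; exists (fun j => (j == i)%:Z).
by rewrite (bigD1 i) //= eqxx mulr1z big1 ?addr0 // => j /negPf ->.
Qed.

(** Expressing each basis through the other gives integral matrices with product the identity. *)
Lemma Zbasis_size_le (b b' : seq V) : Zbasis N b -> Zbasis N b' -> (size b <= size b')%N.
Proof.
move=> hb hb'; have /choice [Q hQ] (i : 'I_(size b)) := (hb'.1 b`_i).1 (Zbasis_in i hb).
have /choice [Q' hQ'] (i : 'I_(size b')) := (hb.1 b'`_i).1 (Zbasis_in i hb').
apply: (@mulmx1_min int _ _ (\matrix_(i, j) Q i j) (\matrix_(i, j) Q' i j)).
apply/matrixP => i k; rewrite !mxE; under eq_bigr => j _ do rewrite !mxE.
apply/eqP; rewrite -subr_eq0; apply/eqP; move: k.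
apply: (hb.2 (fun k => \sum_j Q i j * Q' j k - (i == k)%:R)).
under eq_bigr => j _ do rewrite mulrzBr.
rewrite sumrB [X in _ - X](bigD1 i) //= eqxx mulr1z [X in _ - (_ + X)]big1 ?addr0; last first.
  by move=> j; rewrite eq_sym => /negPf ->; rewrite mulr0z.
apply/eqP; rewrite subr_eq0 [X in _ == X]hQ; apply/eqP.
under eq_bigr => j _ do rewrite mulrz_sumr.
rewrite exchange_big /=; apply: eq_bigr => j _.
rewrite [in RHS]hQ' mulrz_suml; apply: eq_bigr => l _.
by rewrite -mulrzA mulrC.
Qed.

Lemma Zbasis_size (b : seq V) : Zbasis N b -> size b = \dim {:V}.
Proof.
move=> hb; case: N_struct => _ _ [b' [hb' <-]].
by apply/eqP; rewrite eqn_leq !Zbasis_size_le.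
Qed.

Lemma Zbasis_basis (b : seq V) : Zbasis N b -> basis_of {:V} (in_tuple b).
Proof.
move=> hb; rewrite basisEdim /= Zbasis_size // leqnn andbT; apply/subvP => v _.
case: N_struct => _ hs _; have [s [sN]] := hs v; apply: subvP; apply/span_subvP.
move=> w /sN /(hb.1 w).1 [z ->]; apply: memv_suml => i _.
by rewrite -scaler_int memvZ // memv_span // mem_nth.
Qed.

Definition bvec (b : seq V) (i : 'I_(size b)) : V := b`_i.

Section Dual.
Variable b : seq V.
Hypothesis hb : Zbasis N b.

Definition dualv (i : 'I_(size b)) : 'Hom(V, R^o) :=
  linfun (coord (in_tuple b) i : V -> R^o).

Lemma dualvE i v : dualv i v = coord (in_tuple b) i v.
Proof. by rewrite /dualv (lfunE (coord (in_tuple b) i : {linear V -> R^o})). Qed.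

Lemma dualv_b i (j : 'I_(size b)) : dualv i (bvec j) = (j == i)%:R.
Proof. by case/andP: (Zbasis_basis hb) => _ /(coord_free j i); rewrite dualvE. Qed.

Lemma dualv_sum v : v = \sum_i (dualv i v : R) *: bvec i.
Proof.
rewrite [LHS](coord_basis (Zbasis_basis hb) (memvf v)).
by apply: eq_bigr => i _; rewrite dualvE.
Qed.

Lemma lfun_dualv (u : 'Hom(V, R^o)) v : u v = \sum_i (dualv i v : R) * u (bvec i).
Proof.
rewrite [in LHS](dualv_sum v) linear_sum; apply: eq_bigr => i _.
by rewrite linearZ.
Qed.

Lemma lfun_eq (u w : 'Hom(V, R^o)) : (forall i : 'I_(size b), u (bvec i) = w (bvec i)) -> u = w.
Proof.
move=> h; apply/lfunP => v; rewrite !lfun_dualv.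
by apply: eq_bigr => i _; rewrite h.
Qed.

Lemma dualv_int i v : N v -> (dualv i v : R) \is a Num.int.
Proof.
move=> /hb.1 [z ->]; rewrite linear_sum rpred_sum // => j _.
rewrite -scaler_int linearZ /= dualv_b rpredM ?rpred_int //.
exact: rpred_nat.
Qed.

Lemma int_lfun (u : 'Hom(V, R^o)) :
  (forall i : 'I_(size b), (u (bvec i) : R) \is a Num.int) -> forall v, N v -> (u v : R) \is a Num.int.
Proof.
move=> h v Nv; rewrite lfun_dualv rpred_sum // => i _.
by rewrite rpredM // dualv_int.
Qed.

End Dual.

Lemma cone_ge0 (A : set V) (u : 'Hom(V, R^o)) :
  (forall v, A v -> 0 <= (u v : R)) -> forall v, cone A v -> 0 <= (u v : R).
Proof.
move=> h _ [s [c [sA c0 ->]]]; rewrite linear_sum sumr_ge0 // => i _.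
by rewrite linearZ /= mulr_ge0 //; apply/h/sA; exact: mem_nth.
Qed.

Lemma cone_in (A : set V) v : A v -> cone A v.
Proof.
move=> Av; exists [:: v], (fun=> 1); split => //.
  by move=> w; rewrite inE => /eqP ->.
by rewrite big_ord1 scale1r.
Qed.

Section RegularCone.
Variables (b : seq V) (A' : set V).
Hypotheses (hb : Zbasis N b) (A'b : A' `<=` [set` b]).
Variable A : comNzRingType.

Let dv := dualv (b := b).

(** A generating set rather than a cone: what counts is its dual monoid, whose members vanish at the
    basis vectors from index j on. Raising j frees one coordinate at a time, from the trivial monoid
    at 0 to the dual monoid of the cone at [size b]. *)
Definition flag_cone (j : nat) : set V :=
  cone A' `|` [set v | exists i : 'I_(size b), (j <= i)%N /\ (v = bvec i \/ v = - bvec i)].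

Lemma flag_cone_sub j : flag_cone j.+1 `<=` flag_cone j.
Proof.
by move=> v [cv|[i [ji h]]]; [left|right; exists i; split => //; exact: ltnW].
Qed.

Lemma flag_dual_pred j (u : 'Hom(V, R^o)) : u \in dual_pred N (flag_cone j) <->
  [/\ forall i : 'I_(size b), A' (bvec i) -> 0 <= (u (bvec i) : R),
      forall i : 'I_(size b), (u (bvec i) : R) \is a Num.int &
      forall i : 'I_(size b), (j <= i)%N -> u (bvec i) = 0].
Proof.
split => [/asboolP [h1 h2]|[h1 h2 h3]].
  split => [i Ai|i|i ji].
  - by apply: h1; left; exact: cone_in.
  - by apply: h2; exact: (Zbasis_in i hb).
  - have le0 := h1 (bvec i); have := h1 (- bvec i).
    rewrite linearN oppr_ge0 => ge0; apply: le_anti; rewrite ge0 ?le0 //.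
      by right; exists i; split => //; left.
    by right; exists i; split => //; right.
apply/asboolP; split; last by apply: int_lfun hb _ _.
move=> v [|[i [ji [->|->]]]].
- apply: cone_ge0 => w Aw; have /(nthP 0) [k kb e] : w \in b by exact: A'b Aw.
  have {}e : bvec (Ordinal kb) = w by [].
  by rewrite -e; apply: h1; rewrite e.
- exact: (eq_ind_r (fun z : R => 0 <= z) (lexx 0) (h3 i ji)).
- rewrite linearN oppr_ge0.
  exact: (eq_ind_r (fun z : R => z <= 0) (lexx 0) (h3 i ji)).
Qed.

Lemma dual_valD (tau : set V) (u w : dual_monoid N tau) v : (u + w) v = u v + w v.
Proof. exact: lfunE. Qed.

Lemma dual_valMn (tau : set V) (u : dual_monoid N tau) n v : (u *+ n) v = u v *+ n.
Proof.
elim: n => [|n IHn]; first exact: lfunE.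
by rewrite !mulrS dual_valD IHn.
Qed.

Lemma dual_monoid_eq (tau : set V) (u w : dual_monoid N tau) :
  (forall i : 'I_(size b), u (bvec i) = w (bvec i)) -> u = w.
Proof.
case: u w => [u hu] [w hw] h; have e : u = w by apply: (lfun_eq hb) => i; exact: h.
by apply: val_inj.
Qed.

(** The variable is the coordinate form t of the basis vector b_j, and l splits as k + l(b_j) t. If
    l(b_j) is negative for some l, then b_j is not in A', so -t also belongs to the monoid and the
    variable is invertible. *)
Lemma flag_step j : (j < size b)%N ->
  poly_like (monoid_alg_map (R := A) (dual_incl (N := N) (@flag_cone_sub j))).
Proof.
move=> jb; pose jo := Ordinal jb.
have dvb (i : 'I_(size b)) : dv jo (bvec i) = (i == jo)%:R by exact: dualv_b.
have tP : dv jo \in dual_pred N (flag_cone j.+1).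
  apply/flag_dual_pred; split => i; rewrite dvb.
  - by move=> _; exact: ler0n.
  - exact: rpred_nat.
  - by rewrite -val_eqE /= ltn_neqAle eq_sym => /andP [/negPf -> _].
pose t := DualMonoid tP.
apply: (monoid_step_poly_like (iota := dual_incl (@flag_cone_sub j)) (t := t)).
- move=> l; have /flag_dual_pred [l1 l2 l3] := dual_valP l.
  have /intrP [z hz] := l2 jo.
  have kv (i : 'I_(size b)) : ((l : 'Hom(V, R^o)) - z%:~R *: dv jo) (bvec i) =
      (l (bvec i) : R) - z%:~R *+ (i == jo).
    by rewrite add_lfunE opp_lfunE scale_lfunE dvb; congr (_ - _); exact: mulr_natr.
  have kP : (l : 'Hom(V, R^o)) - z%:~R *: dv jo \in dual_pred N (flag_cone j).
    apply/flag_dual_pred; split => i; rewrite kv; have [->|ij] := eqVneq i jo.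
    - by rewrite -hz subrr.
    - by rewrite mulr0n subr0; exact: l1.
    - by rewrite -hz subrr rpred0.
    - by rewrite mulr0n subr0; exact: l2.
    - by rewrite -hz subrr.
    - move=> ji; rewrite mulr0n subr0; apply: l3.
      by rewrite ltn_neqAle ji andbT eq_sym; move: ij; rewrite -val_eqE.
  pose k := DualMonoid kP.
  have kvE (i : 'I_(size b)) : (dual_incl (@flag_cone_sub j) k) (bvec i) =
      (l (bvec i) : R) - z%:~R *+ (i == jo) by exact: kv.
  have tE (i : 'I_(size b)) : t (bvec i) = (i == jo)%:R by exact: dvb.
  clearbody k; clear kP kv; case: z hz kvE => n hz kvE; exists k.
    exists 0%N, n; split; last by left.
    apply: dual_monoid_eq => i; rewrite mulr0n addr0 dual_valD dual_valMn kvE tE.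
    by rewrite -mulrnA mulnC mulrnA subrK.
  exists n.+1, 0%N; split.
    apply: dual_monoid_eq => i; rewrite mulr0n addr0 dual_valD dual_valMn kvE tE.
    by rewrite NegzE mulrNz mulNrn opprK -mulrnA mulnC mulrnA.
  right; have t'P : - dv jo \in dual_pred N (flag_cone j.+1).
    apply/flag_dual_pred; split => i; rewrite opp_lfunE dvb.
    - have [->|ij] := eqVneq i jo; last by rewrite oppr0.
      by move=> /l1; rewrite hz NegzE ler0z.
    - by rewrite rpredN rpred_nat.
    - by rewrite -val_eqE /= ltn_neqAle eq_sym => /andP [/negPf -> _]; rewrite oppr0.
  exists (DualMonoid t'P); apply: val_inj; exact: subrr.
- move=> k1 k2 m1 m2 e.
  have eb (i : 'I_(size b)) : (k1 (bvec i) : R) + (i == jo)%:R *+ m1 = (k2 (bvec i) : R) + (i == jo)%:R *+ m2.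
    have := congr1 (fun u : dual_monoid _ _ => (u (bvec i) : R)) e.
    by rewrite !dual_valD !dual_valMn /= dvb.
  have z0 (k : dual_monoid N (flag_cone j)) : k (bvec jo) = 0.
    by have /flag_dual_pred [_ _ ->] := dual_valP k.
  have := eb jo; rewrite !z0 eqxx !add0r => /eqP; rewrite eqr_nat => /eqP em.
  split => //; apply: dual_monoid_eq => i; have := eb i.
  by rewrite em => /addIr.
- by move=> k c; exact: monoid_alg_mapU.
Qed.

Lemma flag_base : good_ext A (monoid_alg A (dual_monoid N (flag_cone 0))).
Proof.
have triv (u : dual_monoid N (flag_cone 0)) : u = 0.
  apply: dual_monoid_eq => i; have /flag_dual_pred [_ _ ->] := dual_valP u => //.
  by rewrite lfunE.
exact: iso_good_ext (alg_const_bij A triv).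
Qed.

Lemma flag_cone_size : flag_cone (size b) = cone A'.
Proof.
apply/seteqP; split; last by move=> v; left.
by move=> v [//|[i]]; rewrite leqNgt ltn_ord => -[].
Qed.

Lemma regular_cone_good_ext : good_ext A (monoid_alg A (dual_monoid N (cone A'))).
Proof.
rewrite -flag_cone_size.
suff h j : (j <= size b)%N -> good_ext A (monoid_alg A (dual_monoid N (flag_cone j))).
  exact: h.
elim: j => [_|j IHj jb]; first exact: flag_base.
exact: good_ext_trans (IHj (ltnW jb)) (poly_like_good_ext (flag_step jb)).
Qed.

End RegularCone.
End Lattice.

(** * Farkas' lemma *)

Section Farkas.
Variables (F : realFieldType) (n : nat).
Implicit Types (v w g : 'rV[F]_n) (x y : 'cV[F]_n).

Definition pairing w x : F := (w *m x) 0 0.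

Lemma pairingBl v w x : pairing (v - w) x = pairing v x - pairing w x.
Proof. by rewrite /pairing mulmxBl !mxE. Qed.
Lemma pairingBr v x y : pairing v (x - y) = pairing v x - pairing v y.
Proof. by rewrite /pairing mulmxBr !mxE. Qed.
Lemma pairingZl c w x : pairing (c *: w) x = c * pairing w x.
Proof. by rewrite /pairing -scalemxAl mxE. Qed.
Lemma pairingZr c w x : pairing w (c *: x) = c * pairing w x.
Proof. by rewrite /pairing -scalemxAr mxE. Qed.

Fixpoint in_cone (s : seq 'rV[F]_n) g : Prop :=
  if s is v :: s' then exists c, 0 <= c /\ in_cone s' (g - c *: v) else g = 0.

(* The induction on the number of generators is the one of Bartl (2008). *)
Lemma farkas (s : seq 'rV[F]_n) g :
  (forall x, (forall v, v \in s -> 0 <= pairing v x) -> 0 <= pairing g x) -> in_cone s g.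
Proof.
have [k] := ubnP (size s); elim: k => // k IHk in s g *.
case: s => [_ h|v s].
  have h0 x : pairing g x = 0.
    apply: le_anti; rewrite h // andbT -oppr_ge0.
    by have := h (- 1 *: x); rewrite pairingZr mulN1r; exact.
  apply/rowP => i; rewrite [in RHS]mxE; have := h0 (delta_mx i 0).
  rewrite /pairing mxE (bigD1 i) //= big1 => [|j /negPf ji].
    by rewrite mxE !eqxx mulr1 addr0.
  by rewrite mxE ji mulr0.
rewrite /= ltnS => sk h.
have [hs|nhs] := pselect (forall x, (forall w, w \in s -> 0 <= pairing w x) -> 0 <= pairing g x).
  by exists 0; rewrite scale0r subr0; split => //; exact: IHk.
have [z [zs zg]] : exists z, (forall w, w \in s -> 0 <= pairing w z) /\ pairing g z < 0.
  apply: contrapT => k0; apply: nhs => x hx; rewrite leNgt; apply/negP => gx.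
  by apply: k0; exists x.
set t := pairing v z; have t0 : t < 0.
  rewrite ltNge; apply/negP => vz; move: zg; rewrite ltNge => /negP; apply; apply: h => w.
  by rewrite inE => /orP [/eqP ->|/zs].
have tn0 : t != 0 by rewrite lt_eqF.
(* The projection along v onto the forms that vanish at the violating vector z. *)
pose pr w := w - (pairing w z / t) *: v.
have prE w x : pairing (pr w) x = pairing w (x - (pairing v x / t) *: z).
  by rewrite pairingBl pairingBr pairingZl pairingZr; ring.
have hpr : in_cone (map pr s) (pr g).
  apply: IHk; first by rewrite size_map.
  move=> x hx; rewrite prE; apply: h => w; rewrite inE => /orP [/eqP ->|ws].
    by rewrite pairingBr pairingZr -/t divfK // subrr.
  by rewrite -prE; apply: hx; exact: map_f.
have unpr r g' : (forall w, w \in r -> 0 <= pairing w z) -> in_cone (map pr r) g' ->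
    exists c, 0 <= c /\ in_cone r (g' + (c / t) *: v).
  elim: r g' => /= [g' _ ->|w r IHr g' hr [c [c0 hc]]].
    by exists 0; rewrite mul0r scale0r addr0.
  have [|d [d0 hd]] := IHr _ _ hc; first by move=> w' w'r; apply: hr; rewrite inE w'r orbT.
  exists (d + c * pairing w z); split.
    by rewrite addr_ge0 // mulr_ge0 // hr // mem_head.
  exists c; split => //; move: hd; congr (in_cone r _); apply/rowP => i.
  by rewrite !mxE; ring.
have [c [c0 hc]] := unpr _ _ zs hpr.
exists ((pairing g z - c) / t); split.
  by rewrite ler_ndivlMr // mul0r subr_le0 (le_trans (ltW zg)).
by move: hc; congr (in_cone s _); apply/rowP => i; rewrite !mxE; ring.
Qed.

End Farkas.

(** * Rational cones and integral functionals *)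

Section LatticeCone.
Variables (R : realType) (V : vectType R) (N : set V).
Hypothesis N_struct : Zstructure N.

Lemma coneP (A : set V) v : cone A v <-> exists r : seq (R * V),
  (forall p, p \in r -> 0 <= p.1 /\ A p.2) /\ v = \sum_(p <- r) p.1 *: p.2.
Proof.
split => [[s [c [sA c0 ->]]]|[r [hr ->]]].
  exists [seq (c i, s`_i) | i <- enum 'I_(size s)]; split.
    move=> p /mapP [i _ ->]; split => //=; apply: sA; exact: mem_nth.
  by rewrite big_map big_enum.
exists (map snd r), (fun i => (nth (0, 0) r i).1); split.
- by move=> w /mapP [p /hr [_ h] ->].
- move=> i; have ir : (i < size r)%N by rewrite -(size_map snd r); exact: ltn_ord.
  by have [] := hr _ (mem_nth (0, 0) ir).
rewrite (big_nth (0, 0)) big_mkord -(size_map snd r); apply: eq_bigr => i _.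
by rewrite (nth_map (0, 0)) // -(size_map snd r); exact: ltn_ord.
Qed.

Lemma cone0 (A : set V) : cone A 0.
Proof. by apply/coneP; exists [::]; rewrite big_nil. Qed.

Lemma coneD (A : set V) v w : cone A v -> cone A w -> cone A (v + w).
Proof.
move=> /coneP [r [hr ->]] /coneP [r' [hr' ->]]; apply/coneP; exists (r ++ r').
by rewrite big_cat; split => // p; rewrite mem_cat => /orP [/hr|/hr'].
Qed.

Lemma coneZ (A : set V) c v : 0 <= c -> cone A v -> cone A (c *: v).
Proof.
move=> c0 /coneP [r [hr ->]]; apply/coneP; exists [seq (c * p.1, p.2) | p <- r]; split.
  by move=> _ /mapP [p /hr [h1 h2] ->]; split => //=; exact: mulr_ge0.
by rewrite big_map scaler_sumr; apply: eq_bigr => p _ /=; rewrite scalerA.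
Qed.

Lemma cone_min (A B : set V) : A `<=` cone B -> cone A `<=` cone B.
Proof.
move=> AB _ /coneP [r [hr ->]]; elim: r hr => [|p r IHr] hr.
  by rewrite big_nil; exact: cone0.
rewrite big_cons; apply: coneD.
  have [h1 h2] := hr p (mem_head _ _); exact/coneZ/AB.
by apply: IHr => q qr; apply: hr; rewrite inE qr orbT.
Qed.

Lemma dual_cone_pred (s : seq V) (u : 'Hom(V, R^o)) :
  (forall a, a \in s -> 0 <= (u a : R)) -> (forall v, N v -> (u v : R) \is a Num.int) ->
  u \in dual_pred N (cone [set` s]).
Proof. by move=> h k; apply/asboolP; split => //; exact: cone_ge0. Qed.

Lemma rat_denom n (x : 'cV[rat]_n) : exists d : int, 0 < d /\
  forall i, (d%:~R * x i 0) \is a Num.int.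
Proof.
exists (\prod_i denq (x i 0)); split; first by apply: prodr_gt0 => i _; exact: denq_gt0.
move=> i; rewrite (bigD1 i) //= rmorphM /= mulrAC [X in X * _]mulrC -numqE.
by rewrite rpredM // rpred_int.
Qed.

(* Rational Farkas, after clearing denominators. *)
Lemma farkas_lattice (s : seq V) v : (forall a, a \in s -> N a) -> N v ->
  (forall u : 'Hom(V, R^o), u \in dual_pred N (cone [set` s]) -> 0 <= (u v : R)) ->
  cone [set` s] v.
Proof.
move=> sN Nv h; have [b [hb _]] : exists b, Zbasis N b /\ size b = \dim {:V} by case: N_struct.
pose crd w (i : 'I_(size b)) := Num.floor (dualv i w : R).
have crdE w i : N w -> (crd w i)%:~R = dualv i w :> R.
  by move=> Nw; rewrite /crd floorK //; exact: (dualv_int N_struct hb).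
(* Farkas is applied to rational coordinates, since a rational separating vector can be scaled to an
   integral functional. *)
pose row w : 'rV[rat]_(size b) := \row_i (crd w i)%:~R.
pose vec (g : 'rV[rat]_(size b)) : V := \sum_i ratr (g 0 i) *: bvec i.
have vecK w : N w -> vec (row w) = w.
  move=> Nw; rewrite [RHS](dualv_sum N_struct hb); apply: eq_bigr => i _.
  by rewrite mxE ratr_int crdE.
have vecB g c g' : vec (g - c *: g') = vec g - ratr c *: vec g'.
  rewrite /vec scaler_sumr -sumrB; apply: eq_bigr => i _.
  by rewrite !mxE rmorphB rmorphM scalerBl scalerA.
suff : in_cone (map row s) (row v).
  suff key r g : {subset r <= s} -> in_cone (map row r) g -> cone [set` s] (vec g).
    by move=> /key; rewrite (vecK v Nv); exact.
  elim: r g => /= [g _ ->|a r IHr g rs [c [c0 hc]]].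
    rewrite (_ : vec 0 = 0); first exact: cone0.
    by rewrite /vec big1 // => i _; rewrite mxE rmorph0 scale0r.
  have as_ : a \in s by apply: rs; rewrite mem_head.
  have rs' : {subset r <= s} by move=> z zr; apply: rs; rewrite inE zr orbT.
  have := IHr _ rs' hc; rewrite vecB (vecK _ (sN _ as_)) => hr.
  rewrite -(subrK (ratr c *: a) (vec g)); apply: coneD => //.
  by apply: coneZ; [rewrite ler0q|exact: cone_in].
apply: farkas => x hx; rewrite leNgt; apply/negP => vx.
have [d [d0 dx]] := rat_denom x.
pose u : 'Hom(V, R^o) := \sum_i ratr (d%:~R * x i 0) *: dualv i.
have uE w : N w -> (u w : R) = ratr (d%:~R * pairing (row w) x).
  move=> Nw; rewrite /u sum_lfunE /pairing mxE mulr_sumr rmorph_sum; apply: eq_bigr => i _.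
  rewrite scale_lfunE -(crdE w i Nw) !mxE [in RHS]mulrCA [in RHS]rmorphM /= ratr_int.
  exact: mulrC.
have uP : u \in dual_pred N (cone [set` s]).
  apply: dual_cone_pred => [a as_|].
    rewrite uE; last exact: sN.
    by rewrite ler0q mulr_ge0 ?ler0z ?(ltW d0) // hx // map_f.
  move=> w Nw; apply: (int_lfun N_struct hb) Nw => i; rewrite uE; last exact: (Zbasis_in i hb).
  rewrite /pairing mxE mulr_sumr rmorph_sum rpred_sum // => j _.
  rewrite !mxE mulrCA rmorphM /= rpredM ?ratr_int ?rpred_int //.
  by have /intrP [z ->] := dx j; rewrite ratr_int rpred_int.
have := h u uP; rewrite uE // ler0q pmulr_rge0 ?ltr0z //.
by rewrite leNgt vx.
Qed.

(** For a nonzero generator a, the vector -a is not in the cone, which would otherwise contain a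
    line. Farkas then gives a functional positive at a, and the sum of these is positive at all
    nonzero generators. *)
Lemma interior_functional (s : seq V) : (forall a, a \in s -> N a) ->
  ~ has_line (cone [set` s]) -> exists u : 'Hom(V, R^o),
    u \in dual_pred N (cone [set` s]) /\ forall a, a \in s -> a != 0 -> 0 < (u a : R).
Proof.
move=> sN nl.
have pos a : a \in s -> exists u : 'Hom(V, R^o),
    u \in dual_pred N (cone [set` s]) /\ (a != 0 -> 0 < (u a : R)).
  move=> as_; have [->|a0] := eqVneq a 0.
    by exists 0; split; [exact: (dual_pred_nmod_closed N _).1|].
  apply: contrapT => hu; apply: nl; exists a; split => // t.
  have ca : cone [set` s] a by exact: cone_in.
  have cna : cone [set` s] (- a).
    apply: farkas_lattice => //.
      rewrite -[- a]sub0r; case: N_struct => [[N0 NB] _ _]; apply: NB => //; exact: sN.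
    move=> u uP; rewrite linearN oppr_ge0 leNgt; apply/negP => ua; apply: hu.
    by exists u.
  have [t0|t0] := leP 0 t; first exact: coneZ.
  by rewrite -[t]opprK scaleNr -scalerN; apply: coneZ => //; rewrite oppr_ge0 ltW.
suff key (r : seq V) : {subset r <= s} -> exists u : 'Hom(V, R^o),
    u \in dual_pred N (cone [set` s]) /\ forall a, a \in r -> a != 0 -> 0 < (u a : R).
  by apply: key.
elim: r => [_|a r IHr rs].
  by exists 0; split => //; exact: (dual_pred_nmod_closed N _).1.
have [|u [uP ur]] := IHr; first by move=> z zr; apply: rs; rewrite inE zr orbT.
have [|w [wP wa]] := pos a; first by apply: rs; rewrite mem_head.
move/asboolP: (uP) => [u0 uN]; move/asboolP: (wP) => [w0 wN].
have as_ z : z \in a :: r -> cone [set` s] z by move=> /rs zs; exact: cone_in.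
exists (u + w); split.
  exact: (dual_pred_nmod_closed N _).2.
move=> z zr z0; rewrite add_lfunE; have zs := as_ z zr.
move: zr; rewrite inE => /orP [/eqP za|/ur hz].
  by subst z; apply: ltr_wpDl; [exact: u0|exact: wa].
by apply: ltr_wpDr; [exact: w0|exact: hz].
Qed.

Lemma finite_set_seq (A : set V) : finite_set A -> exists s : seq V, A = [set` s].
Proof. by move/finite_seqP. Qed.

Lemma polycone_seq sigma : polycone N sigma -> exists s : seq V,
  [/\ forall a, a \in s -> N a, sigma = cone [set` s] & ~ has_line sigma].
Proof.
move=> [[A [/finite_set_seq [s ->] AN ->]] nl]; by exists s; split => //.
Qed.

(** The functional positive at all nonzero generators cuts out 0. This puts the zero cone, whose
    chart is a torus, into every nonempty fan. *)
Lemma zero_face sigma : polycone N sigma -> face N sigma [set 0].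
Proof.
move=> /polycone_seq [s [sN -> nl]]; have [u [uP upos]] := interior_functional sN nl.
exists u; split => //; apply/seteqP; split => [v ->|v].
  by split; [exact: cone0|exact: linear0].
move=> [[r [c [rs c0 ->]]] /= /eqP]; rewrite linear_sum /= psumr_eq0 => [/allP h|i _].
  rewrite /= big1 // => i _; have := h i (mem_index_enum i).
  rewrite linearZ /= mulf_eq0 => /orP [/eqP ->|]; first by rewrite scale0r.
  have [->|ri] := eqVneq r`_i 0; first by rewrite scaler0.
  by rewrite gt_eqF // upos // rs // mem_nth.
rewrite linearZ /= mulr_ge0 //; move/asboolP: uP => [u0 _]; apply: u0; apply: cone_in.
by apply: rs; exact: mem_nth.
Qed.

End LatticeCone.

(** * The distinguished point of a monoid algebra *)

Section DistinguishedPoint.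
Variables (F : fieldType) (K : nmodType).
Implicit Types (k l u w : K) (f g h : monoid_alg F K).

Definition mon_unit k : Prop := exists k', k + k' = 0.

Definition mon_irred u : Prop :=
  ~ mon_unit u /\ forall k l, u = k + l -> mon_unit k \/ mon_unit l.

Lemma mon_unit0 : mon_unit 0. Proof. by exists 0; rewrite addr0. Qed.

Lemma mon_unitD k l : mon_unit (k + l) <-> mon_unit k /\ mon_unit l.
Proof.
split => [[m e]|[[k' ek] [l' el]]]; last by exists (k' + l'); rewrite addrACA ek el addr0.
by split; [exists (l + m); rewrite addrA|exists (k + m); rewrite addrCA addrA].
Qed.

Definition eps_mono k : F := (`[< mon_unit k >])%:R.

Lemma eps_mono0 : eps_mono 0 = 1.
Proof. by rewrite /eps_mono asboolT //; exact: mon_unit0. Qed.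

Lemma eps_monoD k l : eps_mono (k + l) = eps_mono k * eps_mono l.
Proof.
rewrite /eps_mono -natrM mulnb; congr (nat_of_bool _)%:R.
apply/asboolP/andP => [/mon_unitD [hk hl]|[/asboolP hk /asboolP hl]].
  by split; exact/asboolP.
exact/mon_unitD.
Qed.

Definition eps : {rmorphism monoid_alg F K -> F} :=
  alg_lift (idfun : {rmorphism F -> F}) eps_mono0 eps_monoD.

Lemma epsU k c : eps (mono k c) = c * eps_mono k.
Proof. exact: alg_liftU. Qed.

Lemma epsD f g : eps (f + g) = eps f + eps g. Proof. exact: rmorphD. Qed.
Lemma epsM f g : eps (f * g) = eps f * eps g. Proof. exact: rmorphM. Qed.

Lemma dist_prime : prime_ideal [pred f : monoid_alg F K | eps f == 0].
Proof.
split; last by move=> f g; rewrite !inE rmorphM mulf_eq0.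
split; rewrite ?inE ?rmorph0 ?rmorph1 ?eqxx ?oner_eq0 // => a f g.
by rewrite !inE rmorphD rmorphM => /eqP -> /eqP ->; rewrite mulr0 addr0.
Qed.

Definition dist_pt : Spec_pt (monoid_alg F K) := SpecPt dist_prime.

Lemma dist_ptE f : (f \in dist_pt) = (eps f == 0). Proof. by []. Qed.

Lemma mono_shift_coeff g k w :
  (forall l, k + l = k + w -> l = w) -> (g * mono k 1)@_(k + w) = g@_w.
Proof.
move=> cancel; elim/monoid_alg_ind: g => [|g h eg eh|c l].
- by rewrite mul0r !mcoeff0.
- by rewrite mulrDl !mcoeffD eg eh.
rewrite monoM mulr1 !mono_coeff addrC; congr (_ *+ nat_of_bool _).
by apply/eqP/eqP => [/cancel|->].
Qed.

Lemma mono_shift_supp g k l : (g * mono k 1)@_l != 0 -> exists j, l = k + j.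
Proof.
apply: contra_neqP => nex; elim/monoid_alg_ind: g => [|g h eg eh|c j].
- by rewrite mul0r mcoeff0.
- by rewrite mulrDl mcoeffD eg eh addr0.
rewrite monoM mono_coeff; case: eqP => // e; exfalso; apply: nex.
by exists j; rewrite addrC.
Qed.

Lemma eps_supp g : eps g != 0 -> exists w, mon_unit w /\ g@_w != 0.
Proof.
apply: contra_neqP => nex; rewrite [g]monoE raddf_sum big1_seq // => k _.
suff : eps (mono k g@_k) = 0 by [].
rewrite epsU /eps_mono; case: asboolP => [ku|]; last by rewrite mulr0.
rewrite mulr1; apply: contrapT => /eqP gk; apply: nex; by exists k.
Qed.

Section Irreducible.
Variable u : K.
Hypothesis uirr : mon_irred u.

Definition assoc_u k : Prop := exists w, mon_unit w /\ k = u + w.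

Lemma assoc_unit k : mon_unit k -> ~ assoc_u k.
Proof. by move=> ku [w [_ e]]; apply: uirr.1; move: ku; rewrite e => /mon_unitD []. Qed.

(** By irreducibility, if k + l is an associate of u, one summand is a unit and the other an
    associate. This is the Leibniz rule at the level of exponents. *)
Lemma assocD k l : assoc_u (k + l) <-> mon_unit k /\ assoc_u l \/ mon_unit l /\ assoc_u k.
Proof.
split; last first.
  move=> [[hk [w [hw ->]]]|[hl [w [hw ->]]]].
    by exists (k + w); split; [exact/mon_unitD|rewrite addrCA].
  by exists (w + l); split; [exact/mon_unitD|rewrite addrA].
move=> [w [[w' ww'] e]].
have : u = k + (l + w') by rewrite addrA e -addrA ww' addr0.
move=> /uirr.2 [hk|/mon_unitD [hl _]]; [left|right]; split => //.
  have [k' kk'] := hk; exists (w + k'); split.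
    by apply/mon_unitD; split; [exists w'|exists k; rewrite addrC].
  by rewrite addrA -e addrAC kk' add0r.
have [l' ll'] := hl; exists (w + l'); split.
  by apply/mon_unitD; split; [exists w'|exists l; rewrite addrC].
by rewrite addrA -e -addrA ll' addr0.
Qed.

Fact dcoef_additive k : zmod_morphism (fun c : F => c *+ `[< assoc_u k >]).
Proof. by move=> c d; rewrite mulrnBl. Qed.

Definition dcoef k : {additive F -> F} :=
  HB.pack (fun c : F => c *+ `[< assoc_u k >])
    (GRing.isZmodMorphism.Build F F (fun c : F => c *+ `[< assoc_u k >]) (dcoef_additive k)).

(* The sum of the coefficients at the associates of [u]; this is a derivation at
   the distinguished point because [u] is irreducible. *)
Definition deriv_u : {additive monoid_alg F K -> F} :=
  HB.pack (mono_ext dcoef)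
    (GRing.isZmodMorphism.Build _ _ (mono_ext dcoef) (mono_ext_is_zmod_morphism dcoef)).

Lemma deriv_uU k c : deriv_u (mono k c) = c *+ `[< assoc_u k >].
Proof. exact: (mono_extU dcoef). Qed.

Lemma deriv_uD f g : deriv_u (f + g) = deriv_u f + deriv_u g.
Proof. exact: raddfD. Qed.

Lemma deriv_uM f g : deriv_u (f * g) = eps f * deriv_u g + deriv_u f * eps g.
Proof.
have dD a b : deriv_u (a + b) = deriv_u a + deriv_u b by exact: raddfD.
have d0 : deriv_u 0 = 0 by exact: raddf0.
elim/monoid_alg_ind: f => [|f f' e e'|c k].
- by rewrite !(mul0r, rmorph0, d0, addr0).
- by rewrite mulrDl !dD e e' (rmorphD eps); ring.
elim/monoid_alg_ind: g => [|g g' e e'|d l].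
- by rewrite !(mulr0, rmorph0, d0, addr0).
- by rewrite mulrDr !dD e e' (rmorphD eps); ring.
rewrite monoM !deriv_uU !epsU /eps_mono.
have -> : `[< assoc_u (k + l) >] = (`[< mon_unit k >] && `[< assoc_u l >]) ||
    (`[< mon_unit l >] && `[< assoc_u k >]).
  apply/asboolP/orP => [/assocD [[h1 h2]|[h1 h2]]|].
  - by left; apply/andP; split; exact/asboolP.
  - by right; apply/andP; split; exact/asboolP.
  by move=> [/andP [/asboolP h1 /asboolP h2]|/andP [/asboolP h1 /asboolP h2]]; apply/assocD; [left|right].
have ex j : `[< mon_unit j >] && `[< assoc_u j >] = false.
  by apply/negP => /andP [/asboolP h /asboolP]; exact: assoc_unit h.
have := ex k; have := ex l.
case: `[< mon_unit k >]; case: `[< assoc_u l >]; case: `[< mon_unit l >];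
  case: `[< assoc_u k >] => //= _ _; rewrite ?(mulr0n, mulr1n); ring.
Qed.

(** [T] consists of the fractions f/g with f killed by [eps] and by [deriv_u]. The Leibniz rule puts
    the square of the maximal ideal into it, but not u, at which the derivation is 1. *)
Lemma irred_notin_square (s : seq (loc dist_pt)) :
  {in s, forall x, x \in mloc dist_pt} ->
  ~ madj (mloc dist_pt) [set 0] s (to_loc dist_pt (mono u 1)).
Proof.
move=> sm.
pose T := [set x : loc dist_pt | exists f g, [/\ g \notin dist_pt,
  x * to_loc dist_pt g = to_loc dist_pt f, eps f = 0 & deriv_u f = 0]].
have T0 : T 0.
  by exists 0, 1; rewrite pt1 mul0r !rmorph0; split => //; exact: raddf0.
have TD x y : T x -> T y -> T (x + y).
  move=> [f [g [gp e e0 d0]]] [f' [g' [gp' e' e0' d0']]].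
  exists (f * g' + g * f'), (g * g'); split; first exact: ptMn.
  - by rewrite rmorphD !rmorphM /= -e -e'; ring.
  - by rewrite epsD !epsM e0 e0'; ring.
  - by rewrite deriv_uD !deriv_uM e0 e0' d0 d0'; ring.
have TM x y : x \in mloc dist_pt -> y \in mloc dist_pt -> T (x * y).
  have [f [g [gp ->]]] := lfrac_surj x; have [f' [g' [gp' ->]]] := lfrac_surj y.
  have num a c (cp : c \notin dist_pt) : lfrac a cp \in mloc dist_pt -> eps a = 0.
    move=> h; apply/eqP; rewrite -dist_ptE -mlocE -(lfrac_mul a cp) mulrC.
    exact: ptMl.
  move=> /num ef /num ef'; exists (f * f'), (g * g'); split; first exact: ptMn.
  - rewrite !rmorphM /= -(lfrac_mul f gp) -(lfrac_mul f' gp'); ring.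
  - by rewrite epsM ef mul0r.
  - by rewrite deriv_uM ef ef'; ring.
have sub : madj (mloc dist_pt) [set 0] s `<=` T.
  elim: s sm => /= [_ x -> //|y s IHs sm x [c [cm hc]]].
  rewrite -(subrK (c * y) x); apply: TD.
    by apply: (IHs _ _ hc) => z zs; apply: sm; rewrite inE zs orbT.
  by apply: TM => //; apply: sm; rewrite mem_head.
move=> /sub [f [g [gp e e0 d0]]].
have /to_loc_eq [h [hp eh]] : to_loc dist_pt (mono u 1 * g) = to_loc dist_pt f.
  by rewrite rmorphM.
have a1 : `[< assoc_u u >] = true.
  by apply: asboolT; exists 0; rewrite addr0; split => //; exact: mon_unit0.
have a2 : `[< mon_unit u >] = false by apply: asboolF; exact: uirr.1.
have := congr1 deriv_u eh; rewrite !deriv_uM !epsM e0 d0 deriv_uU epsU /eps_mono a1 a2.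
rewrite mulr1n !(mulr0, mul0r, addr0, add0r) mul1r => /eqP.
by rewrite mulf_eq0 -!dist_ptE (negPf hp) (negPf gp).
Qed.

Hypothesis cancel : forall k l l', k + l = k + l' -> l = l'.
Hypothesis reg : regular_local_ring (loc dist_pt).

(** The monomial at u generates a prime ideal of the regular local ring; [key] brings divisibility
    back from fractions to exponents. *)
Lemma irred_prime k l j : k + l = u + j -> exists j', k = u + j' \/ l = u + j'.
Proof.
move=> e; have hm := @nonunits_mloc _ dist_pt.
have [noeth [s [ms hs]]] := (regular_localP hm).1 reg.
have sm : {in s, forall x, x \in mloc dist_pt}.
  by move=> x xs; suff : pset (mloc dist_pt) x by []; rewrite ms; apply: adj_mem => //; exact: is_ideal0.
have um : to_loc dist_pt (mono u 1) \in mloc dist_pt.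
  rewrite mlocE dist_ptE epsU /eps_mono asboolF ?mulr0 //; exact: uirr.1.
have [q hq] := regular_prime_elt noeth hm ms hs um (irred_notin_square sm).
have key m : to_loc dist_pt (mono m 1) \in q -> exists j', m = u + j'.
  move=> mq; have : pset q (to_loc dist_pt (mono m 1)) by [].
  rewrite hq => -[c /= /subr0_eq].
  have [f [g [gp ->]]] := lfrac_surj c => ec.
  have /to_loc_eq [h [hp eh]] : to_loc dist_pt (mono m 1 * g) = to_loc dist_pt (f * mono u 1).
    rewrite !rmorphM /= ec -(lfrac_mul f gp); ring.
  (* An element outside the distinguished point has a unit w in its support, so m + w occurs in a
     multiple of the monomial at u. *)
  have [w [[w' ww'] gw]] : exists w, mon_unit w /\ (h * g)@_w != 0.
    by apply: eps_supp; rewrite -dist_ptE; exact: ptMn.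
  have : (h * f * mono u 1)@_(m + w) != 0.
    rewrite -mulrA -eh (_ : h * (mono m 1 * g) = h * g * mono m 1); last by ring.
    by rewrite mono_shift_coeff // => l' /cancel.
  move=> /mono_shift_supp [j' ej]; exists (j' + w').
  by rewrite addrA -ej -addrA ww' addr0.
have : to_loc dist_pt (mono k 1) * to_loc dist_pt (mono l 1) \in q.
  rewrite -to_locM monoM mul1r e -[X in mono _ X]mul1r -monoM to_locM mulrC; apply: ptMl.
  by suff : pset q (to_loc dist_pt (mono u 1)) by []; rewrite hq; apply: adj_mem; [exact: is_ideal0|rewrite mem_head].
by rewrite ptM => /orP [/key [j' ej]|/key [j' ej]]; exists j'; [left|right].
Qed.

End Irreducible.
End DistinguishedPoint.

(** * The dimension of a toric algebra *)

Section ChainIndependence.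
Variables (F : fieldType) (B : comNzRingType) (iota : {rmorphism F -> B}).
Implicit Types (q p : Spec_pt B).

Fixpoint exponents (D l : nat) : finType :=
  if l is l'.+1 then ('I_D * exponents D l')%type else unit.

Fixpoint monomial (D : nat) (xs : seq B) : exponents D (size xs) -> B :=
  match xs return exponents D (size xs) -> B with
  | [::] => fun=> 1
  | x :: xs' => fun t => x ^+ t.1 * monomial t.2
  end.

Lemma card_exponents D l : #|exponents D l| = (D ^ l)%N.
Proof.
elim: l => [|l IHl]; first by rewrite card_unit.
by rewrite /= card_prod card_ord IHl expnS.
Qed.

(** From each strict inclusion an element of the larger prime outside the smaller one is taken;
    these are algebraically independent modulo q. A chain of primes thus becomes a matter of
    counting monomials. *)
Lemma chain_independent l q p : chn l q p -> exists xs : seq B, size xs = l /\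
  forall D (c : exponents D (size xs) -> F),
    \sum_t iota (c t) * monomial t \in q -> forall t, c t = 0.
Proof.
elim: l q => [q _|l IHl q [q1 [[qq1 [x [xq1 xq]]] /IHl [xs [sxs hxs]]]]].
  exists [::]; split => // D c; rewrite (big_pred1 tt) => [|[]//]; rewrite mulr1 => cq [].
  apply: contrapT => /eqP c0.
  have : invertible (iota (c tt)) by exists (iota (c tt)^-1); rewrite -rmorphM divff ?rmorph1.
  by move/(invertible_notin q); rewrite cq.
exists (x :: xs); split => /=; first by rewrite sxs.
move=> D c hc; pose S (i : 'I_D) := \sum_t iota (c (i, t)) * monomial t.
have {hc} : \sum_(i < D) x ^+ i * S i \in q.
  move: hc; congr (_ \in q).
  transitivity (\sum_(i < D) \sum_t iota (c (i, t)) * (x ^+ i * monomial t)).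
    by rewrite pair_bigA; apply: eq_bigr => -[i t] _.
  by apply: eq_bigr => i _; rewrite /S mulr_sumr; apply: eq_bigr => t _; rewrite mulrCA.
move=> hS; suff h i : forall t, c (i, t) = 0 by case.
case: i => i iD; elim/ltn_ind: i iD => i IHi iD; apply: hxs.
(* The terms with lower powers of x vanish already, so x^i can be divided out modulo q; modulo q1,
   which contains x, the coefficient of x^i remains. *)
pose io := Ordinal iD; pose T := \sum_(j < D | (i < j)%N) x ^+ (j - i.+1) * S j.
have eS : \sum_(j < D) x ^+ j * S j = x ^+ i * (S io + x * T).
  rewrite (bigD1 io) //= mulrDr; congr (_ + _).
  rewrite mulrA -exprSr /T mulr_sumr (bigID (fun j : 'I_D => (i < j)%N)) /=.
  rewrite [X in _ + X]big1 ?addr0; last first.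
    move=> j /andP [ji]; rewrite -leqNgt leq_eqVlt => /orP [/eqP ej|jlti].
      by move: ji; rewrite -val_eqE /= ej eqxx.
    rewrite /S big1 ?mulr0 // => t _.
    have -> : j = Ordinal (ltn_ord j) by apply: val_inj.
    by rewrite IHi // rmorph0 mul0r.
  apply: eq_big => [j|j /andP [_ ij]].
    by rewrite -val_eqE /=; case: ltngtP.
  by rewrite mulrA -exprD subnKC.
move: hS; rewrite eS ptM => /orP [|hS].
  have : x ^+ i \notin q by elim: (i) => [|m IHm]; rewrite ?expr0 ?pt1 // exprS ptMn.
  by move=> /negPf ->.
have /(idealB (is_ideal_pset q1)) : S io + x * T \in q1 by exact: qq1.
move=> /(_ (x * T)); rewrite addrK; apply; rewrite mulrC; exact: ptMl.
Qed.

End ChainIndependence.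

Section ToricDimension.
Variables (R : realType) (V : vectType R) (N sigma : set V).
Hypothesis N_struct : Zstructure N.
Variables (b : seq V) (F : fieldType).
Hypothesis hb : Zbasis N b.
Local Notation K := (dual_monoid N sigma).
Local Notation B := (monoid_alg F K).
Implicit Types (k : K) (f g : B).

Definition small (H : nat) k : Prop := forall i : 'I_(size b), `|k (bvec i) : R| <= H%:R.

(** The support lies in a box of lattice points; this substitutes for a bound on the degree. *)
Definition bounded (H : nat) f : Prop := forall k, ~ small H k -> f@_k = 0.

Lemma boundedD H f g : bounded H f -> bounded H g -> bounded H (f + g).
Proof. by move=> hf hg k hk; rewrite mcoeffD hf ?hg ?addr0. Qed.

Lemma bounded_sum H (I : Type) (r : seq I) (P : pred I) (G : I -> B) :
  (forall i, P i -> bounded H (G i)) -> bounded H (\sum_(i <- r | P i) G i).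
Proof.
move=> h; elim/big_ind: _ => //; first by move=> k _; rewrite mcoeff0.
exact: boundedD.
Qed.

Lemma bounded_mono H k c : small H k -> bounded H (mono k c).
Proof.
move=> sk l sl; rewrite mono_coeff; case: eqP => // e.
by case: sl; rewrite -e.
Qed.

Lemma boundedM H H' f g : bounded H f -> bounded H' g -> bounded (H + H') (f * g).
Proof.
have supp H1 f1 k : bounded H1 f1 -> k \in msupp f1 -> small H1 k.
  by move=> h; rewrite -mcoeff_neq0 => /eqP h0; apply: contrapT => sk; apply: h0; exact: h.
move=> hf hg; rewrite [f]monoE [g]monoE mulr_suml big_seq; apply: bounded_sum => k kf.
rewrite mulr_sumr big_seq; apply: bounded_sum => l lg; rewrite monoM; apply: bounded_mono => i.
rewrite dual_valD natrD (le_trans (ler_normD _ _)) //.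
by apply: lerD; [exact: supp hf kf i|exact: supp hg lg i].
Qed.

Lemma bounded_le H H' f : (H <= H')%N -> bounded H f -> bounded H' f.
Proof.
move=> HH h k sk; apply: h => sk'; apply: sk => i; apply: le_trans (sk' i) _.
by rewrite ler_nat.
Qed.

Lemma bounded1 : bounded 0 1.
Proof. by apply: bounded_mono => i; rewrite lfunE normr0. Qed.

Lemma boundedX H f m : bounded H f -> bounded (m * H) (f ^+ m).
Proof.
move=> hf; elim: m => [|m IHm]; first by rewrite expr0; exact: bounded1.
by rewrite exprS mulSn; exact: boundedM.
Qed.

Lemma exists_bounded f : exists H, bounded H f.
Proof.
rewrite [f]monoE; elim: (enum_fset (msupp f)) => [|k r [H hH]].
  by exists 0%N; rewrite big_nil => k _; rewrite mcoeff0.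
have [H' hH'] : exists H', small H' k.
  exists (\sum_(i < size b) `|Num.floor (k (bvec i) : R)|)%N => i.
  have ki : (k (bvec i) : R) \is a Num.int.
    by have /asboolP [_] := dual_valP k; apply; exact: (Zbasis_in i hb).
  rewrite -(floorK ki) -intr_norm -abszE -pmulrn ler_nat.
  by rewrite (bigD1 i) //= leq_addr.
exists (H + H')%N; rewrite big_cons; apply: boundedD.
  by apply: bounded_le (bounded_mono _ hH'); exact: leq_addl.
by apply: bounded_le hH; exact: leq_addr.
Qed.

Lemma exists_bounded_seq (xs : seq B) : exists H, forall x, x \in xs -> bounded H x.
Proof.
elim: xs => [|x xs [H hH]]; first by exists 0%N.
have [H' hH'] := exists_bounded x; exists (H + H')%N => y.
rewrite inE => /orP [/eqP ->|yxs]; first by apply: bounded_le hH'; exact: leq_addl.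
by apply: bounded_le (hH _ yxs); exact: leq_addr.
Qed.

Lemma bounded_monomial D H (xs : seq B) (t : exponents D (size xs)) :
  (forall x, x \in xs -> bounded H x) -> bounded (size xs * (D * H)) (monomial t).
Proof.
elim: xs t => [|x xs IHxs] t h /=; first exact: bounded1.
rewrite mulSn; apply: boundedM.
  apply: (@bounded_le (t.1 * H)); first by rewrite leq_mul2r ltnW ?orbT.
  by apply: boundedX; apply: h; rewrite mem_head.
by apply: IHxs => y yxs; apply: h; rewrite inE yxs orbT.
Qed.

(** The elements supported in the box of radius H form a vector space of dimension at most (2H +
    1)^n with n = [size b]. *)
Lemma bounded_dependent H (T : finType) (G : T -> B) : ((2 * H).+1 ^ size b < #|T|)%N ->
  (forall t, bounded H (G t)) ->
  exists c : T -> F, (exists t, c t != 0) /\ \sum_t mono 0 (c t) * G t = 0.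
Proof.
move=> card hG; pose C : finType := {ffun 'I_(size b) -> 'I_(2 * H).+1}.
(* The coordinates lie between -H and H; adding H turns them into indices below 2H + 1. *)
pose code k : C := [ffun i => inord (absz (Num.floor (k (bvec i) : R) + H%:Z))].
have code_inj k l : small H k -> small H l -> code k = code l -> k = l.
  move=> sk sl /ffunP e; apply: (dual_monoid_eq N_struct hb) => i.
  have valint m : (m : K) (bvec i) = (Num.floor (m (bvec i) : R))%:~R :> R.
    rewrite floorK //; have /asboolP [_] := dual_valP m; apply; exact: (Zbasis_in i hb).
  have bnd m : small H m -> exists a : nat, Num.floor (m (bvec i) : R) + H%:Z = a%:Z /\ (a < (2 * H).+1)%N.
    move=> /(_ i) hm; have : `|Num.floor (m (bvec i) : R)| <= H%:Z.
      by move: hm; rewrite [X in `|X|]valint -intr_norm -[H%:R]/(H%:Z%:~R) ler_int.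
    move: (Num.floor _) => z; rewrite ler_norml => /andP [z1 z2].
    have zH : 0 <= z + H%:Z by lia.
    exists (absz (z + H%:Z)); split; first by rewrite gez0_abs.
    rewrite -ltz_nat gez0_abs //; move: z2; clear; lia.
  have [x [ex xlt]] := bnd k sk; have [y [ey ylt]] := bnd l sl.
  have := e i; rewrite !ffunE ex ey !absz_nat => /(congr1 (@nat_of_ord _)).
  rewrite !inordK // => exy; rewrite [LHS]valint [RHS]valint; congr (_%:~R).
  by apply: (addIr H%:Z); rewrite ex ey exy.
(* Codes that no small k attains are sent to the default 0; [row0] looks at attained codes only. *)
pose pick (beta : C) : K := xget 0 [set k | small H k /\ code k = beta].
pose row f : 'rV[F]_#|C| := \row_j f@_(pick (enum_val j)).
have row0 f : bounded H f -> row f = 0 -> f = 0.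
  move=> hf /rowP e; apply/malgP => k; rewrite mcoeff0.
  have [sk|/hf //] := pselect (small H k).
  have := e (enum_rank (code k)); rewrite !mxE enum_rankK.
  have [s1 s2] : [set l | small H l /\ code l = code k] (pick (code k)).
    by apply: (xgetPex 0); exists k.
  by rewrite (code_inj _ _ s1 sk s2).
pose M : 'M[F]_(#|T|, #|C|) := \matrix_(i, j) row (G (enum_val i)) 0 j.
have [v [v0 vM]] : exists v : 'rV[F]_#|T|, v != 0 /\ v *m M = 0.
  have : kermx M != 0.
    rewrite -mxrank_eq0 mxrank_ker subn_eq0 -ltnNge.
    by rewrite (leq_ltn_trans (rank_leq_col M)) // card_ffun !card_ord.
  move=> /rowV0Pn [v vk v0]; exists v; split => //; exact/sub_kermxP.
exists (fun t => v 0 (enum_rank t)); split.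
  move/eqP: v0 => v0; apply: contrapT => h; apply: v0; apply/rowP => i; rewrite mxE.
  apply: contrapT => /eqP vi; apply: h; exists (enum_val i); by rewrite enum_valK.
apply: row0.
  apply: bounded_sum => t _; rewrite -[H]add0n; apply: boundedM => //.
  by apply: bounded_mono => i; rewrite lfunE normr0.
apply/rowP => j; have /rowP /(_ j) := vM; rewrite !mxE => e.
rewrite raddf_sum /= -[RHS]e (reindex (@enum_val T T)) /=; last first.
  by exists enum_rank => x _; [exact: enum_valK|exact: enum_rankK].
by apply: eq_bigr => i _; rewrite !mxE const_mul_coeff enum_valK.
Qed.

Lemma toric_dim (Q : Spec_pt B) : ~ ht Q (size b).+1.
Proof.
move=> [q hq]; set n := size b; have [xs [sxs indep]] := chain_independent (alg_const F K) hq.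
have [L hL] := exists_bounded_seq xs.
(* The box has (2(n+1)DL + 1)^n points, at most (DC)^n. Taking D larger than C^n makes this less
   than D^(n+1), the number of monomials. *)
pose C := (2 * n.+1 * L).+1; pose D := (C ^ n).+1.
have card : ((2 * (size xs * (D * L))).+1 ^ n < #|exponents D (size xs)|)%N.
  rewrite card_exponents sxs; apply: (@leq_ltn_trans ((D * C) ^ n)).
    have [->|n0] := posnP n; first by rewrite !expn0.
    rewrite leq_exp2r // /C mulnS -[X in (X <= _)%N]add1n leq_add //.
    by rewrite [(n.+1 * (D * L))%N]mulnCA mulnCA !mulnA.
  by rewrite expnMn expnS mulnC ltn_pmul2r ?expn_gt0.
have [c [[t ct] e]] := bounded_dependent card (fun t => bounded_monomial t hL).
by move/eqP: ct; apply; apply: (indep D c); rewrite e pt0.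
Qed.

End ToricDimension.

(** * Factorial monoids *)

Section FactorialMonoid.
Variable K : nmodType.
Implicit Types (k l u w : K) (us : seq K).

Definition mon_dvd u k : Prop := exists j, k = u + j.

Hypothesis cancel : forall k l l', k + l = k + l' -> l = l'.
Hypothesis prime : forall u, mon_irred u -> forall k l, mon_dvd u (k + l) ->
  mon_dvd u k \/ mon_dvd u l.

Lemma irred_ndvd_unit u w : mon_irred u -> mon_unit w -> ~ mon_dvd u w.
Proof. by move=> [nu _] hw [j e]; apply: nu; move: hw; rewrite e => /mon_unitD []. Qed.

Lemma prime_dvdMn u k n : mon_irred u -> mon_dvd u (k *+ n) -> (0 < n)%N /\ mon_dvd u k.
Proof.
move=> hu; elim: n => [/(irred_ndvd_unit hu (mon_unit0 K)) //|n IHn].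
by rewrite mulrS => /(prime hu) [|/IHn []].
Qed.

Lemma prime_dvd_sum u (I : Type) (r : seq I) (G : I -> K) : mon_irred u ->
  mon_dvd u (\sum_(i <- r) G i) -> exists i, mon_dvd u (G i).
Proof.
move=> hu; elim: r => [|i r IHr].
  by rewrite big_nil => /(irred_ndvd_unit hu (mon_unit0 K)).
by rewrite big_cons => /(prime hu) [|/IHr //]; exists i.
Qed.

Definition pairwise_nonassoc us : Prop := (forall u, u \in us -> mon_irred u) /\
  forall i j : 'I_(size us), mon_dvd us`_i us`_j -> i = j.

Definition factored us (c : 'I_(size us) -> nat) : K :=
  \sum_(i < size us) us`_i *+ c i.

Lemma factoredD us c c' :
  factored (us := us) (fun i => (c i + c' i)%N) = factored c + factored c'.
Proof. by rewrite /factored -big_split; apply: eq_bigr => i _; rewrite mulrnDr. Qed.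

(** After the common part is cancelled, c and c' have disjoint supports. If c i > c' i, the i-th
    prime would divide the right side, hence a unit or a member of the list other than itself. *)
Lemma factored_le us (c c' : 'I_(size us) -> nat) w w' : pairwise_nonassoc us ->
  mon_unit w' -> w + factored c = w' + factored c' -> forall i, (c i <= c' i)%N.
Proof.
move=> [usirr usna] hw' e i; rewrite leqNgt; apply/negP => ci.
have split d d' : factored (us := us) d =
    factored (us := us) (fun j => minn (d j) (d' j)) + factored (fun j => (d j - d' j)%N).
  by rewrite -factoredD; congr factored; apply/funext => j; lia.
have {}e : w + factored (fun j => (c j - c' j)%N) = w' + factored (fun j => (c' j - c j)%N).
  apply: (@cancel (factored (us := us) (fun j => minn (c j) (c' j)))).
  rewrite addrCA -split e addrCA; congr (_ + _).
  rewrite [LHS](split c' c); congr (_ + _); congr factored.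
  by apply/funext => j; rewrite minnC.
have ui : mon_irred us`_i by apply: usirr; exact: mem_nth.
have : mon_dvd us`_i (w' + factored (fun j => (c' j - c j)%N)).
  rewrite -e /factored (bigD1 i) //= -(prednK (n := (c i - c' i)%N)) ?subn_gt0 // mulrS.
  exists (w + (us`_i *+ (c i - c' i).-1 + \sum_(j < size us | j != i) us`_j *+ (c j - c' j))).
  by rewrite -addrA addrCA.
move=> /(prime ui) [/(irred_ndvd_unit ui hw') //|].
move=> /(prime_dvd_sum ui) [j] /(prime_dvdMn ui) [cj /usna ij].
by move: cj; rewrite -ij; lia.
Qed.

Lemma factored_inj us (c c' : 'I_(size us) -> nat) w w' : pairwise_nonassoc us ->
  mon_unit w -> mon_unit w' -> w + factored c = w' + factored c' -> c = c'.
Proof.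
move=> h hw hw' e; apply/funext => i; apply/eqP.
by rewrite eqn_leq (factored_le h hw' e) (factored_le h hw (esym e)).
Qed.

Variables (deg : K -> nat) (n : nat).
Hypothesis degD : forall k l, deg (k + l) = (deg k + deg l)%N.
Hypothesis deg0 : forall k, deg k = 0%N -> mon_unit k.
Hypothesis nonassoc_le : forall us, pairwise_nonassoc us -> (size us <= n)%N.

Lemma irred_factor k : exists w (l : seq K), [/\ mon_unit w, forall u, u \in l -> mon_irred u &
  k = w + \sum_(u <- l) u].
Proof.
have [m] := ubnP (deg k); elim: m => // m IHm in k *; rewrite ltnS => km.
have [ku|nku] := pselect (mon_unit k).
  by exists k, [::]; rewrite big_nil addr0.
have [kirr|] := pselect (mon_irred k).
  exists 0, [:: k]; rewrite big_seq1 add0r; split => //; first exact: mon_unit0.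
  by move=> u; rewrite inE => /eqP ->.
move=> nirr; have [k1 [k2 [e n1 n2]]] : exists k1 k2, [/\ k = k1 + k2, ~ mon_unit k1 & ~ mon_unit k2].
  apply: contrapT => h; apply: nirr; split => // k1 k2 e; apply: contrapT => h'.
  by apply: h; exists k1, k2; split => // hk; apply: h'; [left|right].
have pos k' : ~ mon_unit k' -> (0 < deg k')%N.
  by move=> h; rewrite lt0n; apply/eqP => /deg0.
have [|w1 [l1 [h1 hl1 e1]]] := IHm k1.
  by apply: leq_trans km; rewrite e degD -[X in (X < _)%N]addn0 ltn_add2l pos.
have [|w2 [l2 [h2 hl2 e2]]] := IHm k2.
  by apply: leq_trans km; rewrite e degD -[X in (X < _)%N]add0n ltn_add2r pos.
exists (w1 + w2), (l1 ++ l2); split; first exact/mon_unitD.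
  by move=> u; rewrite mem_cat => /orP [/hl1|/hl2].
by rewrite big_cat /= addrACA -e1 -e2.
Qed.

(** Since lengths are bounded by n, there is a longest list of pairwise nonassociated irreducibles;
    by maximality every irreducible is associated to one of its members. *)
Lemma exists_primes : exists us, pairwise_nonassoc us /\
  forall k, exists w c, mon_unit w /\ k = w + factored (us := us) c.
Proof.
have ex0 : exists m, `[< exists us, pairwise_nonassoc us /\ size us = m >].
  by exists 0%N; apply/asboolP; exists [::]; split => //; split => // -[].
have ub m : `[< exists us, pairwise_nonassoc us /\ size us = m >] -> (m <= n)%N.
  by move=> /asboolP [us [/nonassoc_le h <-]].
case: (ex_maxnP ex0 ub) => h /asboolP [us [hus sus]] hmax.
exists us; split => // k.
have full u : mon_irred u -> exists (i : 'I_(size us)) w, mon_unit w /\ u = us`_i + w.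
  move=> hu; apply: contrapT => nex.
  have unit_quot v j : mon_irred u -> mon_irred v -> u = v + j -> mon_unit j.
    by move=> hu' [nv _] /hu'.2 [].
  suff /asboolT /hmax : exists vs, pairwise_nonassoc vs /\ size vs = h.+1 by rewrite ltnn.
  exists (u :: us); rewrite /= sus; split => //; split.
    by move=> v; rewrite inE => /orP [/eqP -> //|]; exact: hus.1.
  have irr (i : 'I_(size us)) : mon_irred us`_i by apply: hus.1; exact: mem_nth.
  move=> [[|i] hi] [[|j] hj] /= hd; apply: val_inj => //=.
  - exfalso; case: hd => w e; have hj' : (j < size us)%N by [].
    have wu : mon_unit w by case: ((irr (Ordinal hj')).2 u w e) => // /hu.1.
    have [w' ww'] := wu; apply: nex; exists (Ordinal hj'), w'; split.
      by exists w; rewrite addrC.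
    by rewrite /= e -addrA ww' addr0.
  - exfalso; case: hd => w e; have hi' : (i < size us)%N by [].
    apply: nex; exists (Ordinal hi'), w; split => //.
    by case: (hu.2 _ _ e) => // /(irr (Ordinal hi')).1.
  - congr S; have hi' : (i < size us)%N by []; have hj' : (j < size us)%N by [].
    by have /(congr1 val) := hus.2 (Ordinal hi') (Ordinal hj') hd.
have [w [l [hw hl ->]]] := irred_factor k.
elim: l hl => [_|u l IHl hl].
  exists w, (fun=> 0%N); split => //; rewrite big_nil /factored big1 // => i _.
have [|w1 [c [hw1 e]]] := IHl; first by move=> v vl; apply: hl; rewrite inE vl orbT.
have [i [w2 [hw2 e2]]] := full u (hl u (mem_head _ _)).
exists (w1 + w2), (fun j => ((j == i) + c j)%N); split; first exact/mon_unitD.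
have ei : factored (us := us) (fun j => (j == i) : nat) = us`_i.
  rewrite /factored (bigD1 i) //= eqxx mulr1n big1 ?addr0 // => j /negPf ->.
  exact: mulr0n.
have ac (a b' d f : K) : a + b' + (d + f) = d + b' + (a + f).
  by rewrite addrACA [a + d]addrC addrACA.
by rewrite big_cons addrCA e e2 factoredD ei; exact: ac.
Qed.

End FactorialMonoid.

(** * Regularity of the cone *)

Section Zspan.
Variables (R : realType) (V : vectType R).

Definition Zspan (r : seq V) (v : V) : Prop :=
  exists z : 'I_(size r) -> int, v = \sum_(i < size r) r`_i *~ z i.

Lemma ZspanD r v w : Zspan r v -> Zspan r w -> Zspan r (v + w).
Proof.
move=> [z ->] [z' ->]; exists (fun i => z i + z' i).
by rewrite -big_split; apply: eq_bigr => i _; rewrite mulrzDr.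
Qed.

Lemma ZspanZ r v m : Zspan r v -> Zspan r (v *~ m).
Proof.
move=> [z ->]; exists (fun i => z i * m).
by rewrite mulrz_suml; apply: eq_bigr => i _; rewrite mulrzA.
Qed.

Lemma Zspan0 r : Zspan r 0.
Proof. by exists (fun=> 0); rewrite big1 // => i _; rewrite mulr0z. Qed.

Lemma Zspan_sum r (I : Type) (s : seq I) (P : pred I) (G : I -> V) :
  (forall i, P i -> Zspan r (G i)) -> Zspan r (\sum_(i <- s | P i) G i).
Proof. by move=> h; elim/big_ind: _ => //; [exact: Zspan0|exact: ZspanD]. Qed.

Lemma Zspan_mem r v : v \in r -> Zspan r v.
Proof.
move=> /(nthP 0) [i ir <-]; exists (fun j => (j == Ordinal ir)%:Z).
rewrite (bigD1 (Ordinal ir)) //= eqxx mulr1z big1 ?addr0 // => j /negPf ->.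
by rewrite mulr0z.
Qed.

(** A spanning list of length dim V is linearly independent over R, hence over the integers. *)
Lemma Zbasis_gen (N : set V) (r : seq V) : Zstructure N -> size r = \dim {:V} ->
  (forall v, v \in r -> N v) -> (forall v, N v -> Zspan r v) -> Zbasis N r.
Proof.
move=> N_struct sr rN Nr; case: (N_struct) => -[N0 NB] Nspan _.
have NN v : N v -> N (- v) by move=> Nv; rewrite -[- v]sub0r; exact: NB.
have ND v w : N v -> N w -> N (v + w) by move=> Nv Nw; rewrite -[w]opprK; apply: NB => //; exact: NN.
have NZ v m : N v -> N (v *~ m).
  move=> Nv; have Nn k : N (v *+ k) by elim: k => [|k IHk]; rewrite ?mulr0n // mulrS; exact: ND.
  by case: m => k; [exact: Nn|exact/NN/Nn].
split => [v|z hz].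
  split; first exact: Nr.
  move=> [z ->]; elim/big_ind: _ => // i _; apply: NZ; apply: rN; exact: mem_nth.
have /andP [_ fr] : basis_of {:V} (in_tuple r).
  rewrite basisEdim /= sr leqnn andbT; apply/subvP => v _.
  have [s [sN]] := Nspan v; apply: subvP; apply/span_subvP => w /sN /Nr [c ->].
  by apply: memv_suml => i _; rewrite -scaler_int memvZ // memv_span // mem_nth.
move=> i; have := coord_sum_free (fun i => (z i)%:~R) i fr.
rewrite (_ : \sum_(_ < _) _ = 0) ?linear0 => [/esym /eqP|].
  by rewrite intr_eq0 => /eqP.
by rewrite -[RHS]hz; apply: eq_bigr => j _; rewrite scaler_int.
Qed.

End Zspan.

(** * Extension of a dual family to a lattice basis *)

Section BasisExtension.
Variables (R : realType) (V : vectType R) (N : set V).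
Hypothesis N_struct : Zstructure N.
Variable b : seq V.
Hypothesis hb : Zbasis N b.

(** The functionals give an integral left inverse U of the coordinate matrix M of the [nv]. In the
    Smith form M = LDP the diagonal entries are therefore units, so the first h columns of L lie in
    the span of the [nv] and can be exchanged for them. *)
Lemma extend_Zbasis (h : nat) (nv : 'I_h -> V) (uv : 'I_h -> 'Hom(V, R^o)) :
  (forall j, N (nv j)) -> (forall i v, N v -> (uv i v : R) \is a Num.int) ->
  (forall i j, (uv i (nv j) : R) = (j == i)%:R) ->
  exists b', Zbasis N b' /\ forall j, nv j \in b'.
Proof.
move=> nvN uvN dual; have nvD j := (hb.1 (nv j)).1 (nvN j).
have /choice [w hw] := nvD.
pose M : 'M[int]_(size b, h) := \matrix_(i, j) w j i.
pose U : 'M[int]_(h, size b) := \matrix_(i, l) Num.floor (uv i (bvec l) : R).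
have UE i l : (U i l)%:~R = (uv i (bvec l) : R).
  by rewrite mxE floorK //; apply: uvN; exact: (Zbasis_in l hb).
have UM : U *m M = 1%:M.
  apply/matrixP => i j; rewrite !mxE; apply: (@intr_inj R).
  transitivity (uv i (nv j) : R); last by rewrite dual eq_sym; case: eqP.
  rewrite (hw j) linear_sum rmorph_sum; apply: eq_bigr => l _.
  rewrite rmorphM /= UE !mxE -scaler_int linearZ /= mulrC.
  by [].
have hn : (h <= size b)%N by exact: mulmx1_min UM.
have [L Lu [P Pu [d _ MD]]] := int_Smith_normal_form M.
set D := (\matrix_(i, j) _) in MD.
pose X := P *m U *m L.
have XD : X *m D = 1%:M.
  by rewrite /X -!mulmxA; apply: mulmx1C; rewrite -[RHS]UM MD !mulmxA.
pose vecs p (Y : 'M[int]_(size b, p)) j : V := \sum_m bvec m *~ Y m j.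
have vecsM p q (Y : 'M[int]_(size b, p)) (Z : 'M[int]_(p, q)) j :
    vecs q (Y *m Z) j = \sum_l vecs p Y l *~ Z l j.
  rewrite /vecs; under [RHS]eq_bigr => l _ do rewrite mulrz_suml.
  rewrite exchange_big /=; apply: eq_bigr => m _; rewrite mxE mulrz_sumr.
  by apply: eq_bigr => l _; rewrite mulrzA.
have vecsN p (Y : 'M[int]_(size b, p)) j : N (vecs p Y j).
  by apply/hb.1; exists (fun m => Y m j).
have nvE j : nv j = vecs h M j.
  by rewrite {1}(hw j) /vecs; apply: eq_bigr => m _; rewrite mxE.
pose ell := vecs _ L; pose wd := widen_ord hn.
pose nf (l : 'I_(size b)) : V := if insub (val l) : option 'I_h is Some j then nv j else ell l.
pose b' := [seq nf l | l <- enum 'I_(size b)].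
have nvb j : nv j \in b'.
  apply/mapP; exists (wd j); first by rewrite mem_enum.
  by rewrite /nf (_ : insub _ = Some j) //; exact: valK.
have Dcol i l : D l i = d`_i *+ (l == wd i).
  by rewrite mxE -val_eqE /=; case: eqP => [->|].
have ellb l : Zspan b' (ell l).
  have [lh|hl] := ltnP l h; last first.
    apply: Zspan_mem; apply/mapP; exists l; first by rewrite mem_enum.
    by rewrite /nf insubF // ltnNge hl.
  pose i := Ordinal lh; have li : l = wd i by apply: val_inj.
  have e1 : ell l *~ d`_i = \sum_j nv j *~ invmx P j i.
    transitivity (vecs _ (L *m D) i).
      rewrite vecsM (bigD1 l) //= Dcol li eqxx mulr1n big1 ?addr0 // => l' /negPf l'i.
      by rewrite Dcol l'i mulr0n mulr0z.
    have -> : L *m D = M *m invmx P by rewrite MD mulmxK.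
    by rewrite vecsM; apply: eq_bigr => j _; rewrite nvE.
  have e2 : d`_i * X i l = 1.
    have : \sum_l' X i l' * D l' i = 1.
      by move/matrixP: XD => /(_ i i); rewrite [LHS]mxE [RHS]mxE eqxx.
    rewrite (bigD1 l) //= Dcol {2}li eqxx mulr1n big1 ?addr0 ?[X i l * _]mulrC //.
    by move=> l'; rewrite li Dcol => /negPf ->; rewrite mulr0n mulr0.
  rewrite -[ell l]mulr1z -e2 mulrzA e1; apply: ZspanZ; apply: Zspan_sum => j _.
  by apply: ZspanZ; exact: Zspan_mem.
have bE m : bvec m = \sum_l ell l *~ invmx L l m.
  rewrite -vecsM mulmxV // /vecs (bigD1 m) //= mxE eqxx mulr1z big1 ?addr0 // => l.
  by rewrite mxE => /negPf ->; rewrite mulr0z.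
exists b'; split => //; apply: Zbasis_gen => //.
- by rewrite size_map size_enum_ord; exact: (Zbasis_size N_struct hb).
- move=> v /mapP [l _ ->]; rewrite /nf; case: insub => [j|]; [exact: nvN|exact: vecsN].
- move=> v /hb.1 [z ->]; apply: Zspan_sum => m _; apply: ZspanZ.
  suff : Zspan b' (bvec m) by [].
  by rewrite bE; apply: Zspan_sum => l _; exact: ZspanZ.
Qed.

End BasisExtension.

(** * From a regular distinguished point to a regular cone *)

Section RegularCriterion.
Variables (R : realType) (V : vectType R) (N : set V) (s : seq V).
Hypotheses (N_struct : Zstructure N) (sN : forall a, a \in s -> N a).
Hypothesis nl : ~ has_line (cone [set` s]).
Variables (F : fieldType) (b : seq V).
Hypothesis hb : Zbasis N b.
Local Notation sigma := (cone [set` s]).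
Local Notation K := (dual_monoid N sigma).
Implicit Types (k l u w : K).
Hypothesis reg : regular_local_ring (loc (dist_pt F K)).

Lemma dual_cancel k l l' : k + l = k + l' -> l = l'.
Proof.
move=> e; apply: (dual_monoid_eq N_struct hb) => i.
have := congr1 (fun m : K => (m (bvec i) : R)) e.
by rewrite !dual_valD => /addrI.
Qed.

Lemma dual_ge0 k a : a \in s -> 0 <= (k a : R).
Proof. by move=> as_; have /asboolP [h _] := dual_valP k; apply: h; exact: cone_in. Qed.

Lemma dual_val_int k v : N v -> (k v : R) \is a Num.int.
Proof. by have /asboolP [_ h] := dual_valP k; exact: h. Qed.

Lemma dual_unitP k : mon_unit k <-> forall a, a \in s -> k a = 0.
Proof.
split => [[k' e] a as_|h].
  have := congr1 (fun m : K => (m a : R)) e; rewrite dual_valD /= zero_lfunE => e0.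
  apply/eqP; move: e0 => /eqP; rewrite paddr_eq0 ?dual_ge0 // => /andP [ka _].
  exact: ka.
have k'P : - (k : 'Hom(V, R^o)) \in dual_pred N sigma.
  apply: dual_cone_pred => [a as_|v Nv]; rewrite opp_lfunE.
    by rewrite oppr_ge0 le_eqVlt; apply/orP; left; apply/eqP; exact: h.
  by rewrite rpredN; exact: dual_val_int.
exists (DualMonoid k'P); apply: (dual_monoid_eq N_struct hb) => i.
rewrite dual_valD /= opp_lfunE zero_lfunE; exact: subrr.
Qed.

Lemma dual_prime u : mon_irred u -> forall k l, mon_dvd u (k + l) ->
  mon_dvd u k \/ mon_dvd u l.
Proof.
move=> hu k l [j e]; have [j' [ej|ej]] := irred_prime hu dual_cancel reg e.
  by left; exists j'.
by right; exists j'.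
Qed.

(** A length function: it is additive and, by [deg0], zero only at units, so factoring into
    irreducibles terminates. *)
Definition deg k : nat := absz (Num.floor (\sum_(a <- s) (k a : R))).

Lemma degE k : (deg k)%:R = \sum_(a <- s) (k a : R).
Proof.
have ki : \sum_(a <- s) (k a : R) \is a Num.int.
  by rewrite big_seq rpred_sum // => a /sN; exact: dual_val_int.
have k0 : 0 <= \sum_(a <- s) (k a : R).
  by rewrite big_seq sumr_ge0 // => a; exact: dual_ge0.
by rewrite /deg -[LHS]/((absz _)%:Z%:~R) gez0_abs ?floorK // floor_ge0.
Qed.

Lemma degD k l : deg (k + l) = (deg k + deg l)%N.
Proof.
apply/eqP; rewrite -(eqr_nat R) natrD !degE -big_split; apply/eqP.
by apply: eq_bigr => a _; rewrite dual_valD.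
Qed.

Lemma deg0 k : deg k = 0%N -> mon_unit k.
Proof.
move=> e; apply/dual_unitP => a as_; have := degE k; rewrite e => /esym /eqP.
rewrite big_seq psumr_eq0 => [/allP h|x]; last exact: dual_ge0.
by have := h a as_; rewrite as_ => /eqP.
Qed.

Lemma factored_val (us : seq K) (c : 'I_(size us) -> nat) v :
  (factored c : K) v = \sum_(i < size us) (us`_i v : R) *+ c i.
Proof.
rewrite /factored; elim/big_ind2: _ => [|x r y t|i _].
- by rewrite zero_lfunE.
- by rewrite dual_valD => -> ->.
- exact: dual_valMn.
Qed.

Definition posz (z : int) : nat := if 0 <= z then absz z else 0%N.

Lemma poszE z : (posz z)%:Z - (posz (- z))%:Z = z.
Proof. by rewrite /posz; case: z => [[|n]|n]; rewrite /= ?subr0 ?sub0r // NegzE. Qed.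

Lemma posz_mul (x : R) z : x *+ posz z - x *+ posz (- z) = x * z%:~R.
Proof.
rewrite -[in RHS](poszE z) intrB mulrBr; congr (_ - _).
  by rewrite -[_%:~R]/((posz z)%:R) mulr_natr.
by rewrite -[_%:~R]/((posz (- z))%:R) mulr_natr.
Qed.

(** More than [size b] primes satisfy a nontrivial integral relation. Separating its positive and
    negative coefficients gives two factorizations of one element, against uniqueness. *)
Lemma nonassoc_le (us : seq K) : pairwise_nonassoc us -> (size us <= size b)%N.
Proof.
move=> hus; rewrite leqNgt; apply/negP => lt.
pose M : 'M[rat]_(size us, size b) := \matrix_(i, l) (Num.floor (us`_i (bvec l) : R))%:~R.
have : kermx M != 0.
  by rewrite -mxrank_eq0 mxrank_ker subn_eq0 -ltnNge (leq_ltn_trans (rank_leq_col M)).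
move=> /rowV0Pn [v /sub_kermxP vM /eqP v0]; apply: v0.
have [d [d0 hd]] := rat_denom v^T.
have /choice [z hz] : forall i, exists z : int, d%:~R * v 0 i = z%:~R.
  by move=> i; have /intrP [z ez] := hd i; exists z; rewrite -ez mxE.
have e : 0 + factored (us := us) (fun i => posz (z i)) =
    0 + factored (us := us) (fun i => posz (- z i)).
  rewrite !add0r; apply: (dual_monoid_eq N_struct hb) => l; apply/eqP.
  rewrite -subr_eq0 !factored_val -sumrB; apply/eqP.
  under eq_bigr => i _ do rewrite posz_mul.
  have /rowP /(_ l) := vM; rewrite !mxE => /(congr1 (fun q : rat => ratr (d%:~R * q) : R)).
  rewrite mulr0 rmorph0 mulr_sumr rmorph_sum => e; rewrite -[RHS]e.
  apply: eq_bigr => i _; rewrite mxE mulrA hz rmorphM /= !ratr_int mulrC.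
  by rewrite floorK //; apply: dual_val_int; exact: Zbasis_in.
have ec := factored_inj dual_cancel dual_prime hus (mon_unit0 K) (mon_unit0 K) e.
apply/rowP => i; rewrite mxE; have := hz i.
have -> : z i = 0.
  by have := congr1 (fun c => c i) ec => /= ei; rewrite -(poszE (z i)) ei subrr.
move=> /eqP; rewrite mulf_eq0 intr_eq0 gt_eqF //= => /eqP ->.
by [].
Qed.

(** Adding a functional that is positive at the nonzero generators often enough makes a coordinate
    form nonnegative on the cone. Hence every coordinate form is a difference of two members of the
    dual monoid. *)
Lemma shift_dual (u0 : K) (i : 'I_(size b)) : (forall a, a \in s -> a != 0 -> 0 < (u0 a : R)) ->
  exists t : nat, dualv i + t%:R *: (u0 : 'Hom(V, R^o)) \in dual_pred N sigma.
Proof.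
move=> pos; suff [t ht] : exists t : nat, forall a, a \in s -> 0 <= (dualv (b := b) i a : R) + t%:R * u0 a.
  exists t; apply: dual_cone_pred => [a as_|v Nv]; rewrite add_lfunE scale_lfunE; first exact: ht.
  apply: (rpredD (dualv_int N_struct hb i Nv)).
  exact: (rpredM (rpred_nat _ t) (dual_val_int u0 Nv)).
suff key (r : seq V) : {subset r <= s} ->
    exists t : nat, forall a, a \in r -> 0 <= (dualv (b := b) i a : R) + t%:R * u0 a.
  by apply: key.
elim: r => [_|a r IHr rs]; first by exists 0%N.
have [|t ht] := IHr; first by move=> z zr; apply: rs; rewrite inE zr orbT.
have as_ : a \in s by apply: rs; rewrite mem_head.
have [t' ht'] : exists t' : nat, 0 <= (dualv (b := b) i a : R) + t'%:R * u0 a.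
  have [->|a0] := eqVneq a 0; first by exists 0%N; rewrite linear0 mul0r addr0.
  set x := (dualv (b := b) i a : R); have := archi_boundP (normr_ge0 (x / u0 a)).
  move: (Num.bound _) => B hB; exists B.
  rewrite addrC -[x]opprK subr_ge0 -ler_pdivrMr ?pos // mulNr.
  by rewrite (le_trans (ler_norm _)) // normrN ltW.
exists (t + t')%N => z; rewrite inE natrD mulrDl addrA => /orP [/eqP ->|zr].
  by rewrite addrAC addr_ge0 // mulr_ge0 ?dual_ge0.
rewrite addr_ge0 ?ht // mulr_ge0 // dual_ge0 //.
by apply: rs; rewrite inE zr orbT.
Qed.

(* The [us] are the prime elements up to association; the exponents of the
   primes are integral functionals on the dual lattice, that is, elements [nv]
   of [N]. *)
Lemma exponent_vectors : exists (us : seq K) (nv : 'I_(size us) -> V),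
  [/\ forall j, N (nv j),
      forall k, exists w (c : 'I_(size us) -> nat),
        [/\ mon_unit w, k = w + factored c & forall j, (k (nv j) : R) = (c j)%:R] &
      forall i j : 'I_(size us), (us`_i (nv j) : R) = (j == i)%:R].
Proof.
have [us [hus rep]] := exists_primes degD deg0 nonassoc_le.
have /choice [W hW] : forall k, exists wc : K * ('I_(size us) -> nat),
    mon_unit wc.1 /\ k = wc.1 + factored wc.2.
  by move=> k; have [w [c h]] := rep k; exists (w, c).
pose C k := (W k).2.
have CE k w c : mon_unit w -> k = w + factored c -> C k = c.
  move=> hw e; have [h1 h2] := hW k.
  by apply: (factored_inj dual_cancel dual_prime hus h1 hw); rewrite -h2.
have CD k l j : C (k + l) j = (C k j + C l j)%N.
  have [h1 h2] := hW k; have [h3 h4] := hW l.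
  rewrite (CE (k + l) ((W k).1 + (W l).1) (fun j => (C k j + C l j)%N)) //.
    exact/mon_unitD.
  by rewrite factoredD addrACA -h2 -h4.
have C0 j : C 0 j = 0%N.
  rewrite (CE 0 0 (fun=> 0%N)) //; first exact: mon_unit0.
  by rewrite add0r /factored big1 // => i _; rewrite mulr0n.
have CMn k m j : C (k *+ m) j = (m * C k j)%N.
  by elim: m => [|m IHm]; rewrite ?mulr0n ?C0 // mulrS CD IHm mulSn.
have Csum (I : Type) (r : seq I) (G : I -> K) j : C (\sum_(i <- r) G i) j = (\sum_(i <- r) C (G i) j)%N.
  by elim: r => [|i r IHr]; rewrite ?big_nil ?C0 // !big_cons CD IHr.
have Cu (i j : 'I_(size us)) : C us`_i j = (j == i).
  rewrite (CE us`_i 0 (fun j => (j == i) : nat)) //; first exact: mon_unit0.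
  rewrite add0r /factored (bigD1 i) //= eqxx mulr1n big1 ?addr0 // => l /negPf ->.
  exact: mulr0n.
have [uu0 [uP upos]] := interior_functional N_struct sN nl.
pose u0 : K := DualMonoid uP.
have /choice [t ht] (i : 'I_(size b)) := @shift_dual u0 i upos.
pose kap i : K := DualMonoid (ht i).
(* The exponent of the j-th prime in the i-th coordinate form, written as the difference of [kap i]
   and t i times u0. *)
pose w i j : int := (C (kap i) j)%:Z - (t i * C u0 j)%:Z.
pose nv j : V := \sum_(i < size b) bvec i *~ w i j.
have Cnv k j : (k (nv j) : R) = (C k j)%:R.
  pose z (i : 'I_(size b)) : int := Num.floor (k (bvec i) : R).
  have zE i : (k (bvec i) : R) = (z i)%:~R.
    by rewrite /z floorK //; apply: dual_val_int; exact: (Zbasis_in i hb).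
  pose T (c : 'I_(size b) -> nat) := (\sum_(i < size b) c i * t i)%N.
  (* This says that k is the sum of z_i (kap_i - t_i u0); negative terms are moved to the other side
     because K has no subtraction. *)
  have eK : k + \sum_(i < size b) kap i *+ posz (- z i) + u0 *+ T (fun i => posz (z i)) =
      \sum_(i < size b) kap i *+ posz (z i) + u0 *+ T (fun i => posz (- z i)).
    have sval (c : 'I_(size b) -> nat) (l : 'I_(size b)) :
        ((\sum_(i < size b) kap i *+ c i : K) (bvec l) : R) = (c l)%:R + (T c)%:R * u0 (bvec l).
      transitivity (\sum_(i < size b) ((kap i (bvec l) : R) *+ c i)).
        elim/big_ind2: _ => [|x r y q|i _]; first by rewrite zero_lfunE.
          by rewrite dual_valD => -> ->.
        exact: dual_valMn.
      have kapE i : (kap i (bvec l) : R) = (l == i)%:R + (t i)%:R * u0 (bvec l).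
        rewrite /kap /= add_lfunE scale_lfunE; congr (_ + _).
        exact: (dualv_b N_struct hb).
      under eq_bigr => i _ do rewrite kapE mulrnDl.
      rewrite big_split /= (bigD1 l) //= eqxx big1 ?addr0 => [|i /negPf il]; last first.
        by rewrite eq_sym il mul0rn.
      congr (_ + _); rewrite /T natr_sum mulr_suml; apply: eq_bigr => i _.
      by rewrite -mulrnAl -mulrnA mulnC.
    apply: (dual_monoid_eq N_struct hb) => l; rewrite !dual_valD !dual_valMn !sval zE.
    have e0 := poszE (z l); have {}e0 : (posz (z l))%:R = (z l)%:~R + (posz (- z l))%:R :> R.
      by rewrite -{2}e0 intrB subrK.
    rewrite e0; set x := (u0 (bvec l) : R).
    have aux (y : R) m : y *+ m = m%:R * y by rewrite mulr_natl.
    by rewrite (aux x) (aux x); ring.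
  have := congr1 (fun m : K => (C m j)%:R : R) eK.
  rewrite !CD !Csum !CMn !natrD !natr_sum !natrM !natr_sum => e.
  rewrite /nv linear_sum /=.
  transitivity (\sum_(i < size b) ((posz (z i))%:R - (posz (- z i))%:R : R) *
      ((C (kap i) j)%:R - (t i)%:R * (C u0 j)%:R)).
    apply: eq_bigr => i _; rewrite -scaler_int linearZ /= zE.
    rewrite -{1}(poszE (z i)) /w !intrB mulrC; congr (_ * (_ - _)).
    by rewrite -natrM.
  apply: (addIr (\sum_(i < size b) ((posz (- z i) * C (kap i) j)%:R : R) +
    (\sum_(i < size b) ((posz (z i) * t i)%:R : R)) * (C u0 j)%:R)).
  move: e; under eq_bigr => i _ do rewrite CMn.
  move=> e; rewrite [RHS]addrA e.
  under [in RHS]eq_bigr => i _ do rewrite CMn.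
  rewrite !mulr_suml -!big_split /=; apply: eq_bigr => i _.
  by rewrite !natrM; ring.
exists us, nv; split.
- by move=> j; apply/hb.1; exists (w^~ j).
- by move=> k; have [h1 h2] := hW k; exists (W k).1, (C k).
- by move=> i j; rewrite Cnv Cu.
Qed.

(** The [nv] lie in the cone by Farkas, since exponents are nonnegative, and they extend to a basis.
    A generator a is the combination of the [nv] with the nonnegative coefficients us_j(a). *)
Lemma regular_criterion : exists b' A', [/\ Zbasis N b', A' `<=` [set` b'] & sigma = cone A'].
Proof.
have [us [nv [nvN rep dual]]] := exponent_vectors.
have [b' [hb' nvb]] := @extend_Zbasis _ _ _ N_struct _ hb _ nv (fun i => (us`_i : 'Hom(V, R^o))) nvN
  (fun i v Nv => dual_val_int us`_i Nv) dual.
exists b', (range nv); split => //; first by move=> _ [j _ <-]; exact: nvb.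
apply/seteqP; split; apply: cone_min; last first; first move=> _ [j _ <-]; last move=> a as_.
  apply: (farkas_lattice N_struct) => // u uP.
  have [w [c [_ _ h]]] := rep (DualMonoid uP).
  by have := h j => /= ->; exact: ler0n.
have Na := sN as_.
have -> : a = \sum_(j < size us) (us`_j a : R) *: nv j.
  have [u0 [uP upos]] := interior_functional N_struct sN nl.
  (* Units vanish at a, so the identity holds when tested on the dual monoid; [shift_dual] carries
     it to all coordinate forms. *)
  have sepK k : (k a : R) = \sum_(j < size us) (us`_j a : R) * k (nv j).
    have [w [c [wu e h]]] := rep k; have /dual_unitP /(_ a as_) wa := wu.
    have -> : (k a : R) = (w a : R) + (factored c : K) a by rewrite {1}e dual_valD.
    have {}wa : (w a : R) = 0 by exact: wa.
    rewrite wa add0r factored_val; apply: eq_bigr => j _.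
    by rewrite h mulr_natr.
  rewrite [LHS](dualv_sum N_struct hb) [RHS](dualv_sum N_struct hb).
  apply: eq_bigr => i _; congr (_ *: _).
  have [t ht] := @shift_dual (DualMonoid uP) i upos.
  have := sepK (DualMonoid ht); rewrite /= add_lfunE scale_lfunE.
  have := sepK (DualMonoid uP) => /= -> e.
  rewrite linear_sum; apply: (addIr (t%:R * \sum_(j < size us) (us`_j a : R) * u0 (nv j))).
  rewrite [LHS]e mulr_sumr -big_split; apply: eq_bigr => j _.
  rewrite linearZ add_lfunE scale_lfunE /= mulrDr; congr (_ + _).
  exact: mulrCA.
elim/big_ind: _ => [|x y|j _]; [exact: cone0|exact: coneD|].
apply: coneZ; first exact: dual_ge0.
by apply: cone_in; exists j.
Qed.

End RegularCriterion.

(** * Affine schemes *)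

Section Away.
Variables (A : comNzRingType) (p : Spec_pt A) (f : denom p).

(* The localization A_f, as A[X]/(fX - 1). *)
Definition away_rel : {poly A} := (val f)%:P * 'X - 1.

Definition away_ideal : {pred {poly A}} := [pred g | `[< exists h, g = away_rel * h >]].

(** Comparing coefficients in a = (fX - 1)h gives h_i = -f^i a, which is 0 beyond the degree of
    h. *)
Lemma away_ker (a : A) : a%:P \in away_ideal -> exists n, val f ^+ n * a = 0.
Proof.
move=> /asboolP [h e]; exists (size h).
have ch i : h`_i = - (val f ^+ i * a).
  elim: i => [|i IHi].
    have := congr1 (fun g : {poly A} => g`_0) e.
    rewrite coefC eqxx /away_rel mulrBl mul1r coefB -mulrA coefCM coefXM eqxx mulr0 sub0r.
    by rewrite expr0 mul1r => ->; rewrite opprK.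
  have := congr1 (fun g : {poly A} => g`_i.+1) e.
  rewrite coefC /= /away_rel mulrBl mul1r coefB -mulrA coefCM coefXM /= IHi mulrN => e0.
  by rewrite exprS -mulrA; apply/eqP; rewrite -subr_eq0 opprK -oppr_eq0 opprD addrC -e0.
by apply/eqP; rewrite -oppr_eq0 -ch nth_default.
Qed.

(** The element f comes with a prime p that avoids it: no power of f is 0, and A_f is not the zero
    ring. *)
Lemma away_ideal_closed : idealr_closed away_ideal.
Proof.
split.
- by apply/asboolP; exists 0; rewrite mulr0.
- apply/negP => /away_ker [n]; rewrite mulr1 => fn; have fp := valP f.
  have : val f ^+ n \notin p by elim: n {fn} => [|n IHn]; rewrite ?expr0 ?pt1 // exprS ptMn.
  by rewrite fn pt0.
- move=> a u v /asboolP [h ->] /asboolP [k ->]; apply/asboolP.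
  by exists (a * h + k); ring.
Qed.

HB.instance Definition _ := isIdealr.Build {poly A} away_ideal away_ideal_closed.

Definition away : comNzRingType := {ideal_quot away_ideal}.

Definition away_map : {rmorphism A -> away} :=
  (\pi_{ideal_quot away_ideal} : {rmorphism {poly A} -> {ideal_quot away_ideal}}) \o polyC.

Lemma away_loc_like : loc_like (powers (val f)) away_map.
Proof.
pose P : {rmorphism {poly A} -> away} := \pi_{ideal_quot away_ideal}.
have piE g h : P g = P h <-> g - h \in away_ideal.
  by rewrite Quotient.idealrBE; split=> /eqP.
pose x := P 'X; have fx : away_map (val f) * x = 1.
  rewrite -(rmorph1 P) -(rmorphM P); apply/piE.
  by apply/asboolP; exists 1; rewrite mulr1.
have fu : invertible (away_map (val f)) by exists x.
split.
- move=> _ [n ->]; elim: n => [|n IHn].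
    by rewrite expr0 rmorph1; exact: invertible1.
  by rewrite exprS rmorphM; apply/invertibleM.
- move=> b; suff h g : exists c u, powers (val f) u /\ P g * away_map u = away_map c.
    by rewrite -[b]reprK; exact: (h (repr b)).
  elim/poly_ind: g => [|g c [a [_ [[n ->] e]]]].
    exists 0, 1; rewrite !rmorph0 mul0r; split => //; by exists 0%N.
  exists (a + c * val f ^+ n.+1), (val f ^+ n.+1); split; first by exists n.+1.
  have e1 : P (g * 'X + c%:P) = P g * x + away_map c by rewrite (rmorphD P) (rmorphM P).
  rewrite e1 exprS (rmorphD away_map) !(rmorphM away_map) -e mulrDl; congr (_ + _).
  transitivity (away_map (val f) * x * (P g * away_map (val f ^+ n))); first by ring.
  by rewrite fx mul1r.
- move=> c; rewrite -(rmorph0 P) => /piE; rewrite subr0 => /away_ker [n e].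
  by exists (val f ^+ n); split => //; exists n.
Qed.

End Away.

Section SpecLoc.
Variables (A : comNzRingType) (f : A).

Lemma powers_avoid (p : Spec_pt A) : f \notin p -> forall u, powers f u -> u \notin p.
Proof.
move=> fp _ [n ->]; elim: n => [|n IHn]; first by rewrite expr0 pt1.
by rewrite exprS ptMn.
Qed.

Variables (B : comNzRingType) (phi : {rmorphism A -> B}).
Hypothesis lk : loc_like (powers f) phi.

Lemma Spec_away_range : range (Spec_hom phi) = [set p : Spec_lrs A | f \notin pt_pred p].
Proof.
apply/seteqP; split => [_ [q _ <-]|p fp] /=.
  by apply: (loc_like_avoid lk q); exists 1%N; rewrite expr1.
by exists (extp lk (powers_avoid fp)) => //; exact: preimp_extp.
Qed.

Lemma Spec_away_open : open_immersion (Spec_hom phi).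
Proof.
split.
- by move=> q q' e; exact: (@preimp_inj _ _ _ _ lk q q' e).
- move=> _ [E ->].
  exists [set a | exists e c u, [/\ E e, powers f u, e * phi u = phi c & a = c * f]].
  apply/seteqP; split => [_ [q [e Ee eq] <-]|p [_ [e [c [u [Ee Uu ec ->]]]]]].
    have [c [u [Uu ec]]] := loc_like_frac lk e.
    exists (c * f); first by exists e, c, u.
    apply: ptMn; first by rewrite -(loc_like_in lk q Uu ec).
    by apply: (loc_like_avoid lk q); exists 1%N; rewrite expr1.
  rewrite ptM negb_or => /andP [cp fp].
  exists (extp lk (powers_avoid fp)); last exact: preimp_extp.
  exists e => //; rewrite (loc_like_in lk _ Uu ec).
  by rewrite (preimp_extp lk (powers_avoid fp)).
- by move=> q; exact: Spec_stalk_bij lk.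
Qed.

End SpecLoc.

Lemma to_locD (A : comNzRingType) (p : Spec_pt A) a b :
  to_loc p (a + b) = to_loc p a + to_loc p b.
Proof. exact: rmorphD. Qed.

(** * Global sections of an affine scheme *)

Section GlobalSections.
Variable A : comNzRingType.
Implicit Types q : Spec_pt A.

(** The u with ux = uy form an ideal. If it contained no power of k, a prime over it would avoid k,
    against the equality of germs there. *)
Lemma to_loc_eq_away k x y : (forall q, k \notin q -> to_loc q x = to_loc q y) ->
  exists n, k ^+ n * x = k ^+ n * y.
Proof.
move=> h; apply: contrapT => nex.
have hI : is_ideal [set u | u * x = u * y].
  split; first by rewrite /= !mul0r.
  by move=> a u v /= hu hv; rewrite !mulrDl -!mulrA hu hv.
have [|||p [Ip kp]] := @prime_avoid A _ (powers k) hI.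
- by exists 0%N; rewrite expr0.
- by move=> _ _ [n ->] [m ->]; exists (n + m)%N; rewrite exprD.
- by move=> _ [n ->] e; apply: nex; exists n.
have /h /to_loc_eq [u [up e]] : k \notin p by apply: kp; exists 1%N; rewrite expr1.
by move/negP: up; apply; exact: Ip.
Qed.

Lemma to_loc_inj x y : (forall q, to_loc q x = to_loc q y) -> x = y.
Proof.
move=> h; have [n] := @to_loc_eq_away 1 x y (fun q _ => h q).
by rewrite expr1n !mul1r.
Qed.

Lemma ideal_nowhere (I : set A) : is_ideal I -> (forall q, exists a, I a /\ a \notin q) -> I 1.
Proof.
move=> hI h; apply: contrapT => nI1.
have [|||p [Ip _]] := @prime_avoid A I [set 1] hI.
- by [].
- by move=> u v -> ->; rewrite mulr1.
- by move=> u ->.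
by have [a [Ia /negP]] := h p; apply; exact: Ip.
Qed.

(** The k for which ks comes from one element of A form an ideal. It contains a power of every local
    denominator, so it lies in no prime and contains 1. *)
Lemma global_section (s : forall q : Spec_pt A, loc q) : Spec_sec setT s ->
  exists a, forall q, s q = to_loc q a.
Proof.
move=> hs; pose G := [set k | exists a, forall q, k \notin q -> s q * to_loc q k = to_loc q a].
have Gq q : exists k, G k /\ k \notin q.
  have [a [f nf]] := hs q I.
  have : nbhs q [set r : Spec_pt A | f \notin r /\ s r * to_loc r f = to_loc r a] by exact: nf.
  rewrite nbhsE => -[U [[E EU] Uq]] sub.
  move: Uq; rewrite EU => -[e Ee eq]; exists (e * f).
  have Ur (r : Spec_pt A) : e \notin r -> f \notin r /\ s r * to_loc r f = to_loc r a.
    by move=> er; apply: sub; rewrite EU; exists e.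
  split; last by rewrite ptMn //; case: (Ur q eq).
  exists (e * a) => r; rewrite ptM negb_or => /andP [er _].
  have [_ h] := Ur r er; rewrite !to_locM -h; ring.
(* Quasi-compactness: finitely many local denominators generate the unit ideal, so one exponent can
   serve all overlaps. *)
have [l [lG l1]] : exists l, (forall k, k \in l -> G k) /\ adj [set 0] l 1.
  have hJ : is_ideal [set x | exists l, (forall k, k \in l -> G k) /\ adj [set 0] l x].
    split; first by exists [::].
    move=> a u v [l [lG hu]] [l' [lG' hv]]; exists (l ++ l'); split.
      by move=> k; rewrite mem_cat => /orP [/lG|/lG'].
    have hi := is_ideal_adj (l ++ l') (@is_ideal0 A).
    apply: hi.2; [apply: adj_mono hu => //|apply: adj_mono hv => //]; try exact: is_ideal0.
      by move=> z zl; rewrite mem_cat zl.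
    by move=> z zl; rewrite mem_cat zl orbT.
  apply: (ideal_nowhere hJ) => q; have [k [Gk kq]] := Gq q; exists k; split => //.
  exists [:: k]; split; first by move=> k'; rewrite inE => /eqP ->.
  by apply: adj_mem; [exact: is_ideal0|rewrite mem_head].
have cover q : exists k, k \in l /\ k \notin q.
  apply: contrapT => nex; have := adj_min (is_ideal_pset q) _ _ l1; rewrite /pset /= => h.
  suff : 1 \in q by rewrite (negPf (pt1 q)).
  apply: h => [x ->|k kl]; first exact: pt0.
  by apply: contrapT => /negP kq; apply: nex; exists k.
(* If s = a/k on D(k) and s = a'/k' on D(k'), then ak' = a'k up to a power of kk'. With a common
   exponent n for the cover, k^n a represents k^(n+1) s everywhere. *)
have Gpow k : G k -> exists n a, forall q, s q * to_loc q (k ^+ n) = to_loc q a.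
  move=> [a ha].
  have [n hn] : exists n, forall k', k' \in l -> exists a', (forall q, k' \notin q ->
      s q * to_loc q k' = to_loc q a') /\ (k * k') ^+ n * (a * k') = (k * k') ^+ n * (a' * k).
    elim: (l) lG => [_|k' r IHr rG]; first by exists 0%N.
    have [|n hn] := IHr; first by move=> z zr; apply: rG; rewrite inE zr orbT.
    have [a' ha'] := rG k' (mem_head _ _).
    have [|m hm] := @to_loc_eq_away (k * k') (a * k') (a' * k).
      move=> q; rewrite ptM negb_or => /andP [kq k'q].
      by rewrite !to_locM -(ha q kq) -(ha' q k'q); ring.
    exists (n + m)%N => z; rewrite inE => /orP [/eqP ->|/hn [b [hb eb]]].
      by exists a'; split => //; rewrite exprD -!mulrA hm.
    by exists b; split => //; rewrite addnC exprD -!mulrA eb.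
  exists n.+1, (k ^+ n * a) => q; have [k' [k'l k'q]] := cover q.
  have [a' [ha' e]] := hn k' k'l.
  have kn : k' ^+ n.+1 \notin q by apply: powers_avoid k'q _ _; exists n.+1.
  apply: (loc_cancel kn).
  transitivity (to_loc q ((k * k') ^+ n * (a' * k))).
    transitivity (s q * to_loc q k' * to_loc q (k' ^+ n * k ^+ n.+1)).
      by rewrite !to_locM exprS [k' ^+ n.+1]exprS !to_locM; ring.
    by rewrite (ha' q k'q) -to_locM; congr to_loc; rewrite exprMn exprS; ring.
  by rewrite -e -to_locM; congr to_loc; rewrite exprMn exprS; ring.
have hJ : is_ideal [set k | exists a, forall q, s q * to_loc q k = to_loc q a].
  split; first by exists 0 => q; rewrite rmorph0 mulr0.
  move=> c u v [a ha] [a' ha']; exists (c * a + a') => q.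
  by rewrite !to_locD !to_locM -ha -ha'; ring.
have [|a ha] := ideal_nowhere hJ.
  move=> q; have [k [/Gpow [n hn] kq]] := Gq q; exists (k ^+ n); split => //.
  by apply: powers_avoid kq _ _; exists n.
by exists a => q; rewrite -ha rmorph1 mulr1.
Qed.

End GlobalSections.

Section EqHom.
Implicit Types X Y Z T : lrspace.

Lemma eq_hom_sym X Y (f g : lrs_hom X Y) : eq_hom f g -> eq_hom g f.
Proof.
move=> [h k]; split => [x|U s oU sU x Ux]; first by rewrite h.
by rewrite (k U) // h.
Qed.

Lemma eq_hom_trans X Y (f g h : lrs_hom X Y) : eq_hom f g -> eq_hom g h -> eq_hom f h.
Proof.
move=> [h1 k1] [h2 k2]; split => [x|U s oU sU x Ux]; first by rewrite h1.
by rewrite (k1 U) // (k2 U) // -h1.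
Qed.

Lemma eq_hom_comp_l X Y Z (g : lrs_hom Y Z) (f f' : lrs_hom X Y) : eq_hom f f' ->
  eq_hom (comp_hom g f) (comp_hom g f').
Proof.
move=> [h k]; split => [x|U s oU sU x Ux]; first by rewrite /= /comp_fun h.
apply: (k (g @^-1` U) (fun y => hom_stalk g y (s (g y)))) => //.
  by apply: open_comp => // y _; exact: hom_continuous.
exact: hom_sec.
Qed.

Lemma eq_hom_comp_r X Y Z (g g' : lrs_hom Y Z) (f : lrs_hom X Y) : eq_hom g g' ->
  eq_hom (comp_hom g f) (comp_hom g' f).
Proof.
move=> [h k]; split => [x|U s oU sU x Ux]; first by rewrite /= /comp_fun h.
by rewrite /= (k U).
Qed.

Lemma comp_homA X Y Z T (h : lrs_hom Z T) (g : lrs_hom Y Z) (f : lrs_hom X Y) :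
  eq_hom (comp_hom h (comp_hom g f)) (comp_hom (comp_hom h g) f).
Proof. by []. Qed.

End EqHom.

Lemma Spec_stalk_frac (A B : comNzRingType) (phi : {rmorphism A -> B}) (q : Spec_lrs B)
    (y : loc (Spec_fun phi q)) f a :
  y * to_loc _ f = to_loc _ a -> Spec_stalk phi q y * to_loc q (phi f) = to_loc q (phi a).
Proof. by move=> e; rewrite -!Spec_stalk_to_loc -e [RHS]rmorphM. Qed.

(** * Morphisms of affine schemes and ring morphisms *)

Section SpecFull.
Variables (A B C : comNzRingType).

Lemma Spec_hom_comp (phi : {rmorphism A -> B}) (psi : {rmorphism B -> C}) :
  eq_hom (comp_hom (Spec_hom phi) (Spec_hom psi)) (Spec_hom (psi \o phi : {rmorphism A -> C})).
Proof.
have e1 (x : Spec_lrs C) : comp_hom (Spec_hom phi) (Spec_hom psi) x =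
    Spec_hom (psi \o phi : {rmorphism A -> C}) x by exact: Spec_pt_eq.
split => // U s oU sU x Ux.
have [a [f /nbhs_singleton [fx e]]] := sU _ Ux.
have fx' : psi (phi f) \notin (x : Spec_pt C) by exact: fx.
apply: (loc_cancel fx').
have e2 : s (Spec_hom (psi \o phi : {rmorphism A -> C}) x) * to_loc _ f = to_loc _ a.
  by move: e; rewrite e1.
apply: etrans (esym (Spec_stalk_frac e2)).
exact: Spec_stalk_frac (Spec_stalk_frac e).
Qed.

Lemma Spec_hom_inj (phi phi' : {rmorphism A -> B}) :
  eq_hom (Spec_hom phi) (Spec_hom phi') -> phi =1 phi'.
Proof.
move=> [h k] a; apply: to_loc_inj => q.
have := k setT (fun p : Spec_lrs A => to_loc p a) openT _ q I.
rewrite /= !Spec_stalk_to_loc; apply.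
by move=> p _; exists a, 1; apply: filterE => r; rewrite pt1 rmorph1 mulr1.
Qed.

Lemma Spec_hom_eq (phi phi' : {rmorphism A -> B}) : phi =1 phi' ->
  eq_hom (Spec_hom phi) (Spec_hom phi').
Proof.
move=> h; have e1 (x : Spec_lrs B) : Spec_hom phi x = Spec_hom phi' x.
  by apply: Spec_pt_eq => a; rewrite !Spec_fun_in h.
split => // U s oU sU x Ux.
have [a [f /nbhs_singleton [fx e]]] := sU _ Ux.
have fx' : phi f \notin (x : Spec_pt B) by exact: fx.
apply: (loc_cancel fx').
have e2 : s (Spec_hom phi' x) * to_loc _ f = to_loc _ a by move: e; rewrite e1.
have := Spec_stalk_frac e2; rewrite -!h => e3; apply: etrans (esym e3).
exact: Spec_stalk_frac e.
Qed.

(** Pulling back the germs of elements of A gives global sections, hence phi; locality of the stalk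
    maps forces g and phi to agree on points. *)
Lemma Spec_full (g : lrs_hom (Spec_lrs B) (Spec_lrs A)) :
  exists phi : {rmorphism A -> B}, eq_hom g (Spec_hom phi).
Proof.
have csec a : sec setT (fun p : Spec_lrs A => to_loc p a).
  by move=> p _; exists a, 1; apply: filterE => r; rewrite pt1 rmorph1 mulr1.
have /choice [phi hphi] : forall a, exists b, forall q : Spec_lrs B,
    hom_stalk g q (to_loc (g q) a) = to_loc q b.
  move=> a; apply: global_section; exact: (hom_sec g (V := setT) (s := fun p : Spec_lrs A => to_loc p a) openT (csec a)).
have pB : zmod_morphism phi.
  by move=> a b; apply: to_loc_inj => q; rewrite rmorphB /= -!hphi !rmorphB.
have pM : monoid_morphism phi.
  split; first by apply: to_loc_inj => q; rewrite -hphi !rmorph1.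
  by move=> a b; apply: to_loc_inj => q; rewrite rmorphM /= -!hphi !rmorphM.
pose phi' : {rmorphism A -> B} := HB.pack phi (GRing.isZmodMorphism.Build _ _ phi pB)
  (GRing.isMonoidMorphism.Build _ _ phi pM).
exists phi'; have e1 (x : Spec_lrs B) : g x = Spec_hom phi' x.
  apply: Spec_pt_eq => a; rewrite Spec_fun_in.
  apply/negb_inj; apply/idP/idP => [/invertible_to_loc|].
    by move=> /(invertible_rmorph (hom_stalk g x)); rewrite hphi => /invertible_to_loc.
  by move=> /invertible_to_loc; rewrite -hphi => h; apply/invertible_to_loc; exact: (@hom_local _ _ g x _ h).
split => // U s oU sU x Ux.
have [a [f /nbhs_singleton [fx e]]] := sU _ Ux.
have fx' : phi' f \notin (x : Spec_pt B) by rewrite -Spec_fun_in -[Spec_fun _ _]/(Spec_hom phi' x) -e1.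
apply: (loc_cancel fx').
transitivity (to_loc x (phi' a)).
  by rewrite -[phi' a]/(phi a) -[phi' f]/(phi f) -!hphi -e rmorphM.
have e2 : s (Spec_hom phi' x) * to_loc _ f = to_loc _ a by move: e; rewrite e1.
exact: esym (Spec_stalk_frac e2).
Qed.

End SpecFull.

(** * Open immersions *)

Section Transport.
Variables (X : lrspace).

(** [eq_hom] compares points by a propositional equality, so the stalks at equal points are matched
    by transport. *)
Definition tr (x y : X) (e : x = y) : {rmorphism stalk x -> stalk y} :=
  match e in _ = z return {rmorphism stalk x -> stalk z} with erefl => idfun end.

Lemma tr_sec x y (e : x = y) (s : forall z : X, stalk z) : tr e (s x) = s y.
Proof. by case: y / e. Qed.

Lemma tr_bij x y (e : x = y) : bijective (tr e).
Proof. by case: y / e; exists id. Qed.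

Lemma tr_invertible x y (e : x = y) a : invertible (tr e a) -> invertible a.
Proof. by case: y / e. Qed.

End Transport.

Lemma eq_hom_stalk (X Y : lrspace) (f g : lrs_hom X Y) (h : eq_hom f g) x (e : f x = g x) a :
  hom_stalk f x a = hom_stalk g x (tr e a).
Proof.
have [U [s [oU Ux sU <-]]] := germ_surj a.
by rewrite tr_sec; case: h => _ k; exact: (k U).
Qed.

Lemma eq_hom_open (X Y : lrspace) (f g : lrs_hom X Y) : eq_hom f g ->
  open_immersion f -> open_immersion g.
Proof.
move=> h [fi fo fs]; have fg : (f : X -> Y) = g by apply/funext => x; exact: h.1.
split; [by rewrite -fg|by rewrite -fg|move=> x].
have e := h.1 x; have [k ke ek] := tr_bij e.
apply: (eq_bij (f := hom_stalk f x \o k)).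
  by apply: bij_comp => //; exists (tr e).
by move=> a /=; rewrite (eq_hom_stalk h e) ek.
Qed.

Lemma open_comp_hom (X Y Z : lrspace) (g : lrs_hom Y Z) (f : lrs_hom X Y) :
  open_immersion g -> open_immersion f -> open_immersion (comp_hom g f).
Proof.
move=> [gi go gs] [fi fo fs]; split.
- by move=> x y /gi /fi.
- move=> U oU; rewrite (_ : _ @` _ = g @` (f @` U)); first exact/go/fo.
  by rewrite image_comp.
- by move=> x; apply: bij_comp.
Qed.

Lemma open_comp_inv (X Y Z : lrspace) (g : lrs_hom Y Z) (f : lrs_hom X Y) :
  open_immersion g -> open_immersion (comp_hom g f) -> open_immersion f.
Proof.
move=> [gi go gs] [ci co cs]; split.
- by move=> x y e; apply: ci; rewrite /= /comp_fun e.
- move=> U oU; rewrite (_ : f @` U = g @^-1` (comp_hom g f @` U)).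
    by apply: open_comp; [move=> y _; exact: hom_continuous|exact: co].
  apply/seteqP; split => [_ [x Ux <-]|y [x Ux /gi e]]; first by exists x.
  by exists x.
- move=> x; have [k ke ek] := gs (f x).
  apply: (eq_bij (f := hom_stalk (comp_hom g f) x \o k)).
    by apply: bij_comp => //; exists (hom_stalk g (f x)).
  by move=> a /=; rewrite ek.
Qed.

Lemma open_range (X Y : lrspace) (f : lrs_hom X Y) : open_immersion f -> open (range f).
Proof. by move=> [_ h _]; apply: h; exact: openT. Qed.

Section Lift.
Variables (Z X T : lrspace) (j : lrs_hom Z X) (t : lrs_hom T X).
Hypotheses (oj : open_immersion j) (tj : range t `<=` range j).

Lemma lift_pt x : {z | j z = t x}.
Proof.
have tx : range j (t x) by apply: tj; exists x.
by apply: cid; case: tx => z _ e; exists z.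
Qed.

Definition lift_fun x : Z := sval (lift_pt x).
Lemma lift_funE x : j (lift_fun x) = t x. Proof. exact: svalP (lift_pt x). Qed.

Lemma stalk_inv_sig z : {g : {rmorphism stalk z -> stalk (j z)} |
  cancel (hom_stalk j z) g /\ cancel g (hom_stalk j z)}.
Proof. by apply: cid; apply: rmorphism_inv; case: oj. Qed.

Definition stalk_inv z := sval (stalk_inv_sig z).

Definition lift_stalk x : {rmorphism stalk (lift_fun x) -> stalk x} :=
  hom_stalk t x \o (tr (lift_funE x) \o stalk_inv (lift_fun x)).

Lemma lift_stalkE x (s : forall y, stalk y) :
  lift_stalk x (hom_stalk j (lift_fun x) (s (j (lift_fun x)))) = hom_stalk t x (s (t x)).
Proof.
rewrite /lift_stalk /= /stalk_inv; have [h _] := svalP (stalk_inv_sig (lift_fun x)).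
by rewrite h tr_sec.
Qed.

Lemma lift_preim (U : set Z) : lift_fun @^-1` U = t @^-1` (j @` U).
Proof.
apply/seteqP; split => x /=; first by exists (lift_fun x) => //; exact: lift_funE.
by case: oj => ji _ _ [z Uz e]; suff -> : lift_fun x = z by []; apply: ji; rewrite lift_funE.
Qed.

Lemma lift_open (U : set Z) : open U -> open (lift_fun @^-1` U).
Proof.
move=> oU; rewrite lift_preim; apply: open_comp; first by move=> x _; exact: hom_continuous.
by case: oj => _ h _; exact: h.
Qed.

Lemma lift_continuous : continuous lift_fun.
Proof. by apply/continuousP => U; exact: lift_open. Qed.

(** The stalk maps of j are bijective, so a section on Z agrees near each point with the pullback of
    a section on X; morphisms to Z can then be checked on X. *)
Lemma local_pullback z (V : set Z) (s : forall z, stalk z) : open V -> V z -> sec V s ->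
  exists W U s', [/\ open W, W z, W `<=` V, open U & [/\ sec U s', W `<=` j @^-1` U &
    forall w, W w -> s w = hom_stalk j w (s' (j w))]].
Proof.
move=> oV Vz sV; have [k [kj jk]] := stalk_inv_sig z.
have [U [s' [oU Uz sU es]]] := germ_surj (k (s z)).
have oU' : open (j @^-1` U) by apply: open_comp => // y _; exact: hom_continuous.
have oVU : open (V `&` j @^-1` U) by exact: openI.
have s1 : sec (V `&` j @^-1` U) s by apply: sec_res sV => //; exact: subIsetl.
have s2 : sec (V `&` j @^-1` U) (fun w => hom_stalk j w (s' (j w))).
  by apply: sec_res (hom_sec j oU sU) => //; exact: subIsetr.
have [|W [oW Wz WVU e]] := germ_inj oVU (conj Vz Uz) s1 s2; first by rewrite es jk.
exists W, U, s'; split => //; first by move=> w /WVU [].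
by split => // w /WVU [].
Qed.

Lemma lift_sec (V : set Z) s : open V -> sec V s ->
  sec (lift_fun @^-1` V) (fun x => lift_stalk x (s (lift_fun x))).
Proof.
move=> oV sV; apply: sec_glue => [|x Vx]; first exact: lift_open.
have [W [U [s' [oW Wx WV oU [sU WU e]]]]] := local_pullback oV Vx sV.
exists (lift_fun @^-1` W); split => //; [exact: lift_open|by move=> y /WV|].
apply: (sec_ext (s := fun y => hom_stalk t y (s' (t y)))); first exact: lift_open.
  by move=> y Wy; rewrite e // lift_stalkE.
apply: sec_res (hom_sec t oU sU); last 1 first.
- by move=> y /WU /=; rewrite lift_funE.
- by apply: open_comp => // y _; exact: hom_continuous.
- exact: lift_open.
Qed.

Lemma lift_local x a : invertible (lift_stalk x a) -> invertible a.
Proof.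
rewrite /lift_stalk /= => /(@hom_local _ _ t x _) /tr_invertible.
rewrite /stalk_inv; case: (stalk_inv_sig _) => k [kj jk] /= ia.
by rewrite -[a]jk; exact: invertible_rmorph.
Qed.

Lemma exists_lift : exists k : lrs_hom T Z, eq_hom (comp_hom j k) t.
Proof.
exists (LRSHom lift_continuous lift_sec lift_local); split.
  by move=> x; exact: lift_funE.
by move=> U s oU sU x Ux; exact: lift_stalkE.
Qed.

End Lift.

Lemma open_mono (Z X T : lrspace) (j : lrs_hom Z X) (u v : lrs_hom T Z) :
  open_immersion j -> eq_hom (comp_hom j u) (comp_hom j v) -> eq_hom u v.
Proof.
move=> oj [h k]; have uv x : u x = v x by case: oj => ji _ _; apply: ji; exact: h.
split => // V s oV sV x Vx.
have [W [U [s' [oW Wx WV oU [sU WU e]]]]] := local_pullback oj oV Vx sV.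
rewrite (e _ Wx) (e (v x)); last by rewrite -uv.
by apply: (k U s' oU sU); exact: WU.
Qed.

Lemma basic_nbhd (B : comNzRingType) (X : lrspace) (h : lrs_hom (Spec_lrs B) X)
  (W : set X) (y : Spec_lrs B) : open W -> W (h y) ->
  exists g : denom (y : Spec_pt B), forall q : Spec_pt B, val g \notin q -> W (h q).
Proof.
move=> oW Wy; have : open (h @^-1` W) by apply: open_comp => // z _; exact: hom_continuous.
move=> [E EW]; have : (h @^-1` W) y by [].
rewrite EW => -[e Ee ey]; exists (exist _ e ey) => q eq.
suff : (h @^-1` W) q by [].
by rewrite EW; exists e.
Qed.

Lemma away_map_open (A : comNzRingType) (p : Spec_pt A) (f : denom p) :
  open_immersion (Spec_hom (away_map f)).
Proof. exact: Spec_away_open (away_loc_like f). Qed.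

Lemma away_map_range (A : comNzRingType) (p : Spec_pt A) (f : denom p) q :
  range (Spec_hom (away_map f)) q <-> val f \notin (q : Spec_pt A).
Proof. by rewrite (Spec_away_range (away_loc_like f)). Qed.

Lemma affine_nbhd (X : scheme) (W : set X) (x : X) : open W -> W x ->
  exists (C : comNzRingType) (t : lrs_hom (Spec_lrs C) X),
    [/\ open_immersion t, range t x & range t `<=` W].
Proof.
move=> oW Wx; have [C [c [oc [y _ e]]]] := scheme_affine x.
have [|g hg] := @basic_nbhd _ _ c W y oW; first by rewrite e.
exists (away g), (comp_hom c (Spec_hom (away_map g))); split.
- by apply: open_comp_hom => //; exact: away_map_open.
- have [z _ ez] : range (Spec_hom (away_map g)) y by apply/away_map_range; exact: (valP g).
  by exists z => //; exact: etrans (congr1 c ez) e.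
- move=> _ [z _ <-]; apply: hg; apply/(away_map_range g); by exists z.
Qed.

(** * Charts of fibre products *)

Definition is_coproduct (B0 A B : comNzRingType) (kappa : {rmorphism B0 -> B})
    (iota : {rmorphism A -> B}) : Prop :=
  (forall (C : comNzRingType) (phi1 : {rmorphism B0 -> C}) (phi2 : {rmorphism A -> C}),
    exists psi : {rmorphism B -> C}, psi \o kappa =1 phi1 /\ psi \o iota =1 phi2) /\
  (forall (C : comNzRingType) (psi psi' : {rmorphism B -> C}),
    psi \o kappa =1 psi' \o kappa -> psi \o iota =1 psi' \o iota -> psi =1 psi').

Lemma int_initial (C : comNzRingType) (phi phi' : {rmorphism int -> C}) : phi =1 phi'.
Proof. by move=> z; rewrite -[z]intz !rmorph_int. Qed.

(** Affine sources suffice, because the charts are tested against affine schemes. *)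
Lemma Spec_int_terminal (C : comNzRingType) (f g : lrs_hom (Spec_lrs C) (Spec_lrs int)) :
  eq_hom f g.
Proof.
have [phi hf] := Spec_full f; have [psi hg] := Spec_full g.
apply: eq_hom_trans hf _; apply: eq_hom_trans (eq_hom_sym hg).
by apply: Spec_hom_eq; exact: int_initial.
Qed.

Section Chart.
Variables (XZ S X : scheme) (a : lrs_hom XZ (Spec int)) (b : lrs_hom S (Spec int))
  (p : lrs_hom X XZ) (q : lrs_hom X S).
Hypothesis fib : fibre_product a b p q.
Variables (B0 A B : comNzRingType) (kappa : {rmorphism B0 -> B}) (iota : {rmorphism A -> B}).
Hypothesis cop : is_coproduct kappa iota.
Variables (i : lrs_hom (Spec_lrs B0) XZ) (j : lrs_hom (Spec_lrs A) S).
Hypotheses (oi : open_immersion i) (oj : open_immersion j).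

Let W : set X := [set x | range i (p x) /\ range j (q x)].

Lemma chart_open_range : open W.
Proof.
apply: openI; apply: open_comp; try exact: open_range.
  by move=> x _; exact: hom_continuous.
by move=> x _; exact: hom_continuous.
Qed.

Section ChartMap.
Variable h : lrs_hom (Spec_lrs B) X.
Hypotheses (hp : eq_hom (comp_hom p h) (comp_hom i (Spec_hom kappa)))
  (hq : eq_hom (comp_hom q h) (comp_hom j (Spec_hom iota))).

Lemma chart_inW y : W (h y).
Proof.
split; first by exists (Spec_hom kappa y) => //; exact: esym (hp.1 y).
by exists (Spec_hom iota y) => //; exact: esym (hq.1 y).
Qed.

(** A morphism t from an affine scheme into W lifts through i and j, hence gives ring morphisms out
    of B0 and A, which the coproduct joins to psi. Uniqueness in the fibre product identifies h
    after Spec psi with t. *)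
Lemma chart_factor (C : comNzRingType) (t : lrs_hom (Spec_lrs C) X) : range t `<=` W ->
  exists psi : {rmorphism B -> C}, eq_hom (comp_hom h (Spec_hom psi)) t.
Proof.
move=> tW.
have [|k1 hk1] := @exists_lift _ _ _ i (comp_hom p t) oi.
  by move=> _ [x _ <-]; have [|+ _] := tW (t x); [exists x|].
have [|k2 hk2] := @exists_lift _ _ _ j (comp_hom q t) oj.
  by move=> _ [x _ <-]; have [|_] := tW (t x); [exists x|].
have [phi1 e1] := Spec_full k1; have [phi2 e2] := Spec_full k2.
have [psi [psi1 psi2]] := cop.1 C phi1 phi2; exists psi.
have [m [m1 m2 m3]] := fib.2 (Spec C) (comp_hom p t) (comp_hom q t)
  (Spec_int_terminal _ _).
apply: eq_hom_trans (eq_hom_sym _); first apply: m3; last exact: m3.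
- apply: eq_hom_trans (comp_homA p _ _) _.
  apply: eq_hom_trans (eq_hom_comp_r (Spec_hom psi) hp) _.
  apply: eq_hom_trans hk1; apply: eq_hom_trans (eq_hom_sym (eq_hom_comp_l i e1)).
  apply: (eq_hom_trans (eq_hom_sym (comp_homA i _ _))); apply: (eq_hom_comp_l i).
  apply: eq_hom_trans (Spec_hom_comp _ _) _.
  exact: Spec_hom_eq.
- apply: eq_hom_trans (comp_homA q _ _) _.
  apply: eq_hom_trans (eq_hom_comp_r (Spec_hom psi) hq) _.
  apply: eq_hom_trans hk2; apply: eq_hom_trans (eq_hom_sym (eq_hom_comp_l j e2)).
  apply: (eq_hom_trans (eq_hom_sym (comp_homA j _ _))); apply: (eq_hom_comp_l j).
  apply: eq_hom_trans (Spec_hom_comp _ _) _.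
  exact: Spec_hom_eq.
Qed.

(** Near h y the morphism Spec psi is a section of h. Conversely h factors through t on a principal
    open around y, and uniqueness in the coproduct shows that the two directions are inverse
    there. *)
Lemma chart_point (C : comNzRingType) (t : lrs_hom (Spec_lrs C) X) (psi : {rmorphism B -> C}) y :
  open_immersion t -> eq_hom (comp_hom h (Spec_hom psi)) t -> range t (h y) ->
  exists tau, [/\ t tau = h y, Spec_hom psi tau = y & bijective (hom_stalk h y)].
Proof.
move=> ot ht ty.
have [g hg] := basic_nbhd (open_range ot) ty.
have [|k hk] := @exists_lift _ _ _ t (comp_hom h (Spec_hom (away_map g))) ot.
  by move=> _ [z _ <-]; apply: hg; apply/(away_map_range g); exists z.
have [chi ek] := Spec_full k.
have hk' : eq_hom (comp_hom t (Spec_hom chi)) (comp_hom h (Spec_hom (away_map g))).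
  exact: eq_hom_trans (eq_hom_sym (eq_hom_comp_l t ek)) hk.
have hh : eq_hom (comp_hom h (comp_hom (Spec_hom psi) (Spec_hom chi)))
    (comp_hom h (Spec_hom (away_map g))).
  apply: (eq_hom_trans (comp_homA h (Spec_hom psi) (Spec_hom chi))).
  exact: eq_hom_trans (eq_hom_comp_r (Spec_hom chi) ht) hk'.
have factor (D : comNzRingType) (Y : lrspace) (r : lrs_hom X Y) (m : lrs_hom (Spec_lrs D) Y)
    (phi : {rmorphism D -> B}) : open_immersion m ->
    eq_hom (comp_hom r h) (comp_hom m (Spec_hom phi)) ->
    (chi \o psi) \o phi =1 away_map g \o phi.
  move=> om hr; apply: (@Spec_hom_inj _ _ ((chi \o psi) \o phi) (away_map g \o phi)).
  apply: (open_mono om).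
  apply: eq_hom_trans (eq_hom_comp_l m (eq_hom_sym (Spec_hom_comp phi (chi \o psi)))) _.
  apply: eq_hom_trans (eq_hom_comp_l m (Spec_hom_comp phi (away_map g))).
  apply: eq_hom_trans (comp_homA m _ _) _.
  apply: eq_hom_trans (eq_hom_sym (comp_homA m _ _)).
  apply: eq_hom_trans (eq_hom_sym (eq_hom_comp_r _ hr)) _.
  apply: eq_hom_trans (eq_hom_comp_r _ hr).
  apply: eq_hom_trans (eq_hom_sym (comp_homA r _ _)) _.
  apply: eq_hom_trans (comp_homA r _ _).
  apply: (eq_hom_comp_l r); apply: eq_hom_trans hh.
  by apply: (eq_hom_comp_l h); apply: eq_hom_sym; exact: Spec_hom_comp.
have chipsi : chi \o psi =1 away_map g.
  by apply: cop.2; [exact: (factor _ _ p i kappa oi hp)|exact: (factor _ _ q j iota oj hq)].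
have hl : eq_hom (comp_hom (Spec_hom psi) (Spec_hom chi)) (Spec_hom (away_map g)).
  by apply: eq_hom_trans (Spec_hom_comp _ _) _; exact: Spec_hom_eq.
have [z _ ez] : range (Spec_hom (away_map g)) y by apply/away_map_range; exact: (valP g).
have ey : Spec_hom psi (Spec_hom chi z) = y by exact: etrans (hl.1 z) ez.
exists (Spec_hom chi z); split => //.
  exact: etrans (hk'.1 z) (congr1 h ez).
case: _ / ey.
(* Two composites are bijective on stalks; cancelling their common factor leaves the stalk map of
   h. *)
have [_ _ b1] := eq_hom_open (eq_hom_sym hl) (away_map_open g).
have [_ _ b2] := eq_hom_open (eq_hom_sym ht) ot.
have [k1 k1K Kk1] := b1 z; have [k2 k2K Kk2] := b2 (Spec_hom chi z).
have inj : injective (hom_stalk (Spec_hom psi) (Spec_hom chi z)).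
  by move=> u v e; apply: (can_inj k1K); rewrite /= e.
have bpsi : bijective (hom_stalk (Spec_hom psi) (Spec_hom chi z)).
  apply: inj_surj_bijective inj _ => u.
  by exists (hom_stalk h _ (k2 u)); exact: Kk2.
apply: inj_surj_bijective => [u v e|u].
  by apply: (can_inj k2K); rewrite /= e.
exists (k2 (hom_stalk (Spec_hom psi) (Spec_hom chi z) u)); apply: inj; exact: Kk2.
Qed.

Lemma chart_map_open : open_immersion h /\ range h = W.
Proof.
have cover x : W x -> exists (C : comNzRingType) (t : lrs_hom (Spec_lrs C) X)
    (psi : {rmorphism B -> C}), [/\ open_immersion t, range t x &
      eq_hom (comp_hom h (Spec_hom psi)) t].
  move=> Wx; have [C [t [ot tx tW]]] := affine_nbhd chart_open_range Wx.
  by have [psi hpsi] := chart_factor tW; exists C, t, psi.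
split; last first.
  apply/seteqP; split => [_ [y _ <-]|x]; first exact: chart_inW.
  by move=> /cover [C [t [psi [ot [tau _ <-] ht]]]]; exists (Spec_hom psi tau) => //; exact: ht.1.
split.
- move=> y y' e; have [C [t [psi [ot ty ht]]]] := cover _ (chart_inW y).
  have [tau [e1 e2 _]] := chart_point ot ht ty.
  have [|tau' [e1' e2' _]] := chart_point (y := y') ot ht; first by rewrite -e.
  rewrite -e2 -e2'; congr (Spec_hom psi _).
  by case: ot => ti _ _; apply: ti; rewrite e1 e1'.
- move=> U oU; rewrite openE => _ [y Uy <-].
  have [C [t [psi [ot ty ht]]]] := cover _ (chart_inW y).
  have [tau [e1 e2 _]] := chart_point ot ht ty.
  rewrite /interior nbhsE; exists (t @` (Spec_hom psi @^-1` U)).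
    split; last by exists tau => //; exact: (eq_ind_r U Uy e2).
    case: ot => _ to _; apply: to; apply: open_comp => // z _; exact: hom_continuous.
  by move=> _ [z Uz <-]; exists (Spec_hom psi z) => //; exact: ht.1.
- move=> y; have [C [t [psi [ot ty ht]]]] := cover _ (chart_inW y).
  by have [tau [_ _]] := chart_point ot ht ty.
Qed.

End ChartMap.

Lemma exists_chart : exists h : lrs_hom (Spec_lrs B) X,
  open_immersion h /\ range h = [set x | range i (p x) /\ range j (q x)].
Proof.
have [h [h1 h2 _]] := fib.2 (Spec B) (comp_hom i (Spec_hom kappa))
  (comp_hom j (Spec_hom iota)) (Spec_int_terminal _ _).
by exists h; exact: chart_map_open.
Qed.

End Chart.

(** * Noetherian and regular charts *)

Lemma noetherian_surj (A B : comNzRingType) (e : {rmorphism A -> B}) :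
  (forall b, exists a, e a = b) -> noetherian A -> noetherian B.
Proof.
move=> es /noetherianP noeth; apply/noetherianP => J hJ.
have hI : is_ideal [set a | J (e a)].
  split => [|c u v Ju Jv] /=; first by rewrite rmorph0; exact: ideal0.
  by rewrite rmorphD rmorphM; exact: hJ.2.
have [s hs] := noeth _ hI; exists (map e s); apply/seteqP; split => b.
  have [a <-] := es b => Ja; apply: adj_map; rewrite -hs; exact: Ja.
apply: adj_min => // [x -> |x /mapP [a sa ->]]; first exact: ideal0.
suff : [set a | J (e a)] a by [].
by rewrite hs; apply: adj_mem => //; exact: is_ideal0.
Qed.

(** The universal property of the ring of fractions at g, read off from lifting through the open
    immersion onto D(g). *)
Lemma powers_lift (B B' D : comNzRingType) (g : B) (phi : {rmorphism B -> B'})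
    (psi : {rmorphism B -> D}) : loc_like (powers g) phi -> invertible (psi g) ->
  exists chi : {rmorphism B' -> D}, chi \o phi =1 psi.
Proof.
move=> lk ig; have op := Spec_away_open lk.
have [|k hk] := @exists_lift _ _ _ (Spec_hom phi) (Spec_hom psi) op.
  move=> _ [q _ <-]; rewrite (Spec_away_range lk) /=.
  by rewrite Spec_fun_in; exact: invertible_notin.
have [chi ek] := Spec_full k; exists chi; apply: Spec_hom_inj.
apply: eq_hom_trans (eq_hom_sym (Spec_hom_comp _ _)) _.
apply: eq_hom_trans (eq_hom_sym (eq_hom_comp_l _ ek)) hk.
Qed.

Lemma away_surj (A B B' : comNzRingType) (e : {rmorphism B -> A}) (p : Spec_pt A)
    (f : denom p) (g : B) (phi : {rmorphism B -> B'}) :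
  (forall a, exists b, e b = a) -> loc_like (powers g) phi -> e g = val f ->
  exists e' : {rmorphism B' -> away f}, forall a, exists b, e' b = a.
Proof.
move=> es lk eg; have lf := away_loc_like f.
have pf n : invertible (away_map f (val f ^+ n)).
  by apply: (loc_like_unit lf); exists n.
have [|chi hchi] := @powers_lift _ _ _ g phi (away_map f \o e) lk.
  by have := pf 1%N; rewrite expr1 /= eg.
exists chi => a; have [c [_ [[n ->] ec]]] := loc_like_frac lf a.
have [b eb] := es c.
have [d gd] : invertible (phi (g ^+ n)) by apply: (loc_like_unit lk); exists n.
exists (phi b * d); apply: (invertible_cancel (pf n)).
have h x : chi (phi x) = away_map f (e x) by exact: hchi.
rewrite ec -eb -eg -(rmorphXn e) -!h -rmorphM -mulrA [d * _]mulrC gd mulr1 //.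
Qed.

(** If Spec B is open in Spec C and contains D(h), then D(h) is also a principal open of Spec B, so
    C_h is B localized at the image of h. *)
Lemma open_away (B C : comNzRingType) (phi : {rmorphism C -> B}) (z : Spec_pt C)
    (h : denom z) : open_immersion (Spec_hom phi) ->
  (forall q : Spec_lrs C, val h \notin pt_pred q -> range (Spec_hom phi) q) ->
  exists theta : {rmorphism B -> away h}, loc_like (powers (phi (val h))) theta.
Proof.
move=> op hr; have lf := away_loc_like h; have oa := away_map_open h.
have [|l hl] := @exists_lift _ _ _ (Spec_hom phi) (Spec_hom (away_map h)) op.
  by move=> _ [q _ <-]; apply: hr; apply/(away_map_range h); exists q.
have ol : open_immersion l by apply: (open_comp_inv op); apply: eq_hom_open (eq_hom_sym hl) oa.
have [theta el] := Spec_full l; exists theta.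
have ot := eq_hom_open el ol.
have ht : eq_hom (comp_hom (Spec_hom phi) (Spec_hom theta)) (Spec_hom (away_map h)).
  exact: eq_hom_trans (eq_hom_sym (eq_hom_comp_l _ el)) hl.
have tphi x : theta (phi x) = away_map h x.
  apply: (@Spec_hom_inj _ _ (theta \o phi)).
  exact: eq_hom_trans (eq_hom_sym (Spec_hom_comp _ _)) ht.
split.
- move=> _ [n ->]; rewrite -rmorphXn tphi; apply: (loc_like_unit lf); by exists n.
- move=> b; have [c [_ [[n ->] e]]] := loc_like_frac lf b.
  by exists (phi c), (phi (val h) ^+ n); split; [exists n|rewrite -rmorphXn !tphi].
- move=> b tb; have [r hr'|n hn] := @to_loc_eq_away _ (phi (val h)) b 0.
    have [w _ ew] : range (Spec_hom (away_map h)) (Spec_hom phi r).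
      by apply/(away_map_range h); exact: hr'.
    have er : Spec_hom theta w = r.
      by case: op => opi _ _; apply: opi; exact: etrans (ht.1 w) ew.
    case: _ / er {hr' ew}; case: ot => _ _ /(_ w) /bij_inj; apply.
    by rewrite /= !Spec_stalk_to_loc tb !rmorph0.
  by exists (phi (val h) ^+ n); split; [exists n|rewrite hn mulr0].
Qed.

(** The noetherian affine open Spec C at the given point of X need not be comparable with Spec B. A
    principal open of Spec B is chosen inside Spec C, then one of Spec C inside the former; this
    gives a noetherian localization of B, which maps onto a localization of A. *)
Lemma noetherian_descent (X : scheme) (A B : comNzRingType) (h : lrs_hom (Spec_lrs B) X)
    (e : {rmorphism B -> A}) (p : Spec_lrs A) :
  locally_noetherian X -> open_immersion h -> (forall a, exists b, e b = a) ->
  exists (A' : comNzRingType) (m : lrs_hom (Spec_lrs A') (Spec_lrs A)),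
    [/\ noetherian A', open_immersion m & range m p].
Proof.
move=> lX oh es; pose y := Spec_hom e p.
have [C [c [nC oc cy]]] := lX (h y).
have [g hg] := basic_nbhd (open_range oc) cy.
have [|k hk] := @exists_lift _ _ _ c (comp_hom h (Spec_hom (away_map g))) oc.
  by move=> _ [z _ <-]; apply: hg; apply/(away_map_range g); exists z.
have ok : open_immersion k.
  apply: (open_comp_inv oc); apply: eq_hom_open (eq_hom_sym hk) _.
  by apply: open_comp_hom oh _; exact: away_map_open.
have [phi ek] := Spec_full k; have op := eq_hom_open ek ok.
have f0p : e (val g) \notin (p : Spec_pt A) by rewrite -Spec_fun_in; exact: (valP g).
pose f0 : denom (p : Spec_pt A) := exist _ (e (val g)) f0p.
have [e1 es1] := away_surj es (away_loc_like g) (erefl : e (val g) = val f0).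
have [p1 _ ep1] : range (Spec_hom (away_map f0)) p by apply/(away_map_range f0).
pose z := Spec_hom phi (Spec_hom e1 p1).
have [h' hz hr] : exists2 h', h' \notin (z : Spec_pt C) &
    forall q : Spec_lrs C, h' \notin pt_pred q -> range (Spec_hom phi) q.
  have := open_range op => -[E EW].
  have : range (Spec_hom phi) z by exists (Spec_hom e1 p1).
  rewrite EW => -[x Ex xz]; exists x => // q xq.
  by exists x.
pose hd : denom (z : Spec_pt C) := exist _ h' hz.
have [theta lt] := @open_away _ _ phi z hd op hr.
have f1p : e1 (phi h') \notin (p1 : Spec_pt (away f0)) by rewrite -!Spec_fun_in.
pose f1 : denom (p1 : Spec_pt (away f0)) := exist _ (e1 (phi h')) f1p.
have [e2 es2] := away_surj es1 lt (erefl : e1 (phi (val hd)) = val f1).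
exists (away f1), (comp_hom (Spec_hom (away_map f0)) (Spec_hom (away_map f1))); split.
- apply: noetherian_surj es2 _; exact: loc_like_noetherian (away_loc_like hd) nC.
- by apply: open_comp_hom; exact: away_map_open.
- have [p2 _ ep2] : range (Spec_hom (away_map f1)) p1 by apply/(away_map_range f1).
  by exists p2 => //; exact: etrans (congr1 (Spec_hom (away_map f0)) ep2) ep1.
Qed.

Lemma open_immersion_Rk k (X : lrspace) (B : comNzRingType) (h : lrs_hom (Spec_lrs B) X) y :
  open_immersion h -> (krull_dim_le (stalk (h y)) k -> regular_local_ring (stalk (h y))) <->
  (krull_dim_le (loc (y : Spec_pt B)) k -> regular_local_ring (loc (y : Spec_pt B))).
Proof. by move=> [_ _ bs]; exact: iso_Rk (bs y). Qed.

Lemma has_R_chart k (X : scheme) (B : comNzRingType) (h : lrs_hom (Spec_lrs B) X) :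
  has_R k X -> open_immersion h -> has_Rk k B.
Proof. by move=> [_ rX] oh q; apply/(open_immersion_Rk k q oh); exact: rX. Qed.

Lemma has_R_intro k (X : scheme) : (forall x : X, exists (B : comNzRingType)
    (h : lrs_hom (Spec_lrs B) X), [/\ noetherian B, has_Rk k B, open_immersion h & range h x]) ->
  has_R k X.
Proof.
move=> hX; split => x; have [B [h [nB rB oh hx]]] := hX x; first by exists B, h.
by have [y _ <-] := hx; apply/(open_immersion_Rk k y oh); exact: rB.
Qed.

(** * Change of coefficients in monoid algebras *)

Section CoefMap.
Variables (A B : comNzRingType) (phi : {rmorphism A -> B}) (K : nmodType).

Fact mono_one0 : mono 0 1 = 1 :> monoid_alg B K. Proof. by []. Qed.

Fact mono_oneD (k l : K) : mono (k + l) 1 = mono k 1 * mono l 1 :> monoid_alg B K.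
Proof. by rewrite monoM mulr1. Qed.

Definition coef_map : {rmorphism monoid_alg A K -> monoid_alg B K} :=
  alg_lift (alg_const B K \o phi) mono_one0 mono_oneD.

Lemma coef_mapU k c : coef_map (mono k c) = mono k (phi c).
Proof. by rewrite [LHS]alg_liftU /= monoM add0r mulr1. Qed.

Lemma coef_map_coeff f k : (coef_map f)@_k = phi f@_k.
Proof.
elim/monoid_alg_ind: f => [|f g ef eg|c l].
- by rewrite raddf0 !mcoeff0 rmorph0.
- by rewrite raddfD /= !mcoeffD ef eg rmorphD.
by rewrite coef_mapU !mono_coeff rmorphMn.
Qed.

Variable U : set A.
Hypotheses (U1 : U 1) (UM : forall u v, U u -> U v -> U (u * v)) (lk : loc_like U phi).

(** Supports are finite, so a product of denominators serves all coefficients at once. *)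
Lemma coef_map_loc_like : loc_like (mono 0 @` U) coef_map.
Proof.
split.
- move=> _ [u Uu <-]; rewrite coef_mapU; have [v uv] := loc_like_unit lk Uu.
  by exists (mono 0 v); rewrite monoM uv addr0.
- move=> g; suff [u Uu [c e]] : exists2 u, U u & exists c, g * mono 0 (phi u) = coef_map c.
    by exists c, (mono 0 u); split; [exists u|rewrite coef_mapU].
  elim/monoid_alg_ind: g => [|g h [u Uu [c e]] [v Uv [d e']]|x k].
  + by exists 1 => //; exists 0; rewrite mul0r raddf0.
  + exists (u * v); first exact: UM.
    exists (c * mono 0 v + d * mono 0 u); rewrite rmorphD !(rmorphM coef_map) !coef_mapU.
    rewrite -e -e' (rmorphM phi) -[0 in LHS](addr0 0) -monoM; ring.
  + have [c [u [Uu e]]] := loc_like_frac lk x; exists u => //; exists (mono k c).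
    by rewrite coef_mapU monoM addr0 e.
- move=> f f0.
  suff [u Uu hu] : exists2 u, U u & forall k, k \in enum_fset (msupp f) -> u * f@_k = 0.
    exists (mono 0 u); split; first by exists u.
    apply/malgP => k; rewrite const_mul_coeff mcoeff0.
    have [/hu //|/mcoeff_outdom ->] := boolP (k \in msupp f); exact: mulr0.
  elim: (enum_fset (msupp f)) => [|k s [u Uu hu]]; first by exists 1.
  have [|v [Uv hv]] := loc_like_ker lk (c := f@_k).
    by rewrite -coef_map_coeff f0 mcoeff0.
  exists (u * v); first exact: UM.
  move=> l; rewrite inE => /orP [/eqP ->|/hu e]; first by rewrite -mulrA hv mulr0.
  by rewrite mulrAC e mul0r.
Qed.

End CoefMap.

Lemma monoid_alg_coproduct (A : comNzRingType) (K : nmodType) :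
  is_coproduct (coef_map (intr : {rmorphism int -> A}) K) (alg_const A K).
Proof.
split=> [C phi1 phi2|C psi psi' e1 e2 f].
  have b0 : phi1 (mono 0 1) = 1 by exact: rmorph1.
  have bD (k l : K) : phi1 (mono (k + l) 1) = phi1 (mono k 1) * phi1 (mono l 1).
    by rewrite -rmorphM monoM mulr1.
  exists (alg_lift phi2 b0 bD); split => [f|c]; last first.
    by rewrite -[LHS]/(alg_lift phi2 b0 bD (mono 0 c)) alg_liftU b0 mulr1.
  elim/monoid_alg_ind: f => [|f g ef eg|z k].
  - by rewrite !rmorph0.
  - by rewrite !(rmorphD phi1) -ef -eg !rmorphD.
  rewrite -[LHS]/(alg_lift phi2 b0 bD (coef_map _ _ (mono k z))) coef_mapU.
  rewrite [LHS]alg_liftU.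
  have -> : mono k z = mono 0 z * mono k 1 :> monoid_alg int K by rewrite monoM add0r mulr1.
  rewrite (rmorphM phi1); congr (_ * _).
  exact: (int_initial (phi2 \o (intr : {rmorphism int -> A})) (phi1 \o alg_const int K) z).
elim/monoid_alg_ind: f => [|f g ef eg|c k].
- by rewrite !rmorph0.
- by rewrite !rmorphD ef eg.
have -> : mono k c = mono 0 c * coef_map (intr : {rmorphism int -> A}) K (mono k 1).
  by rewrite coef_mapU monoM add0r rmorph1 mulr1.
rewrite !rmorphM; congr (_ * _); [exact: e2|exact: e1].
Qed.

Lemma augmentation (A : comNzRingType) (K : nmodType) :
  exists e : {rmorphism monoid_alg A K -> A}, forall a, exists b, e b = a.
Proof.
exists (alg_lift (idfun : {rmorphism A -> A}) (beta := fun _ => 1) (erefl 1)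
  (fun _ _ => esym (mulr1 1))) => a.
by exists (mono 0 a); rewrite [LHS]alg_liftU mulr1.
Qed.

(** At height 0 a regular system of parameters is empty, so the maximal ideal of the local ring is
    zero. *)
Lemma minimal_residue_field (A : comNzRingType) (p : Spec_pt A) :
  ~ ht p 1 -> regular_local_ring (loc p) ->
  exists (F : fieldType) (phi : {rmorphism A -> F}), loc_like [set u | u \notin p] phi.
Proof.
move=> h0 /(regular_localP (@nonunits_mloc _ p)) [_ [s [ms /ht_mloc hs]]].
have s0 : s = [::].
  by case: s ms hs => // x s _ hs; case: h0; apply: ht_le hs.
have minv (x : loc p) : x != 0 -> exists y, y * x = 1.
  move=> x0; have [|y xy] := @nonunits_mloc _ p x; last by exists y; rewrite mulrC.
  apply: contra x0 => xm; apply/eqP; have : pset (mloc p) x by [].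
  by rewrite ms s0.
have /choice [inv hinv] (x : loc p) : exists y, (x != 0 -> y * x = 1) /\ (x = 0 -> y = 0).
  have [->|x0] := eqVneq x 0; first by exists 0.
  by have [y hy] := minv x x0; exists y; split => // e; rewrite e eqxx in x0.
pose F : fieldType := HB.pack (loc p) (GRing.ComNzRing_isField.Build (loc p)
  (fun x => (hinv x).1) ((hinv 0).2 (erefl 0))).
exists F, (to_loc p : {rmorphism A -> F}); exact: to_loc_like.
Qed.

Lemma has_R_le k k' (X : scheme) : (k <= k')%N -> has_R k' X -> has_R k X.
Proof.
move=> kk' [lX rX]; split => // x hx; apply: rX => -[P [pP sP]]; apply: hx.
exists P; split => l lk; [apply: pP|apply: sP]; exact: leq_trans lk _.
Qed.

(** * The toric scheme over S *)

Section Toric.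
Variables (R : realType) (V : vectType R) (N : set V) (Sigma : set (set V)).
Hypotheses (N_struct : Zstructure N) (Sigma_fan : fan N Sigma).
Variables (S X : scheme).
Hypothesis X_toric : toric_scheme N Sigma S X.

(** [D sigma] is the part of X over the chart of sigma. The gluing maps depend on a proof of
    membership in Sigma, hence the existential in [D] and the use of proof irrelevance. *)
Lemma toric_charts : exists (q : lrs_hom X S) (D : set V -> set X),
  (forall x, exists2 sigma, Sigma sigma & D sigma x) /\
  (forall sigma (A : comNzRingType) (j : lrs_hom (Spec_lrs A) S), Sigma sigma ->
    open_immersion j -> exists h : lrs_hom (Spec_lrs (monoid_alg A (dual_monoid N sigma))) X,
      open_immersion h /\ range h = [set x | D sigma x /\ range j (q x)]).
Proof.
have [XZ [a [b [p [q [[i [oi cover _ _]] fib]]]]]] := X_toric.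
exists q, (fun sigma => [set x | exists hs : Sigma sigma, range (i sigma hs) (p x)]).
split=> [x|sigma A j hs oj].
  by have [sigma [hs ix]] := cover (p x); exists sigma => //; exists hs.
have [h [oh hr]] := exists_chart fib (monoid_alg_coproduct A (dual_monoid N sigma)) (oi sigma hs) oj.
exists h; split => //; rewrite hr; apply/seteqP; split => x /= [ix jx]; split => //.
  by exists hs.
by have [hs' ix'] := ix; rewrite (Prop_irrelevance hs hs').
Qed.

Lemma toric_has_R k : has_R k S -> regular_fan N Sigma -> has_R k X.
Proof.
move=> rS rSigma; have [q [D [cover charts]]] := toric_charts.
apply: has_R_intro => x; have [sigma hs Dx] := cover x.
have [A [j [nA oj jx]]] := rS.1 (q x); have rA := has_R_chart rS oj.
have [b [A' [hb A'b e]]] := rSigma sigma hs.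
have [h [oh hr]] := charts sigma A j hs oj.
have ext : good_ext A (monoid_alg A (dual_monoid N sigma)).
  by rewrite e; exact: (regular_cone_good_ext N_struct hb A'b).
have [nB rB] := ext nA.
exists (monoid_alg A (dual_monoid N sigma)), h; split => //; first exact/rB.
by rewrite hr; split.
Qed.

Section Converse.
Variables (k : nat) (sigma0 : set V).
Hypotheses (Sigma0 : Sigma sigma0) (rX : has_R k X).

Lemma zero_cone_mem : Sigma [set 0].
Proof.
have [_ pc faces] := Sigma_fan.
by apply: (faces _ _ Sigma0 Sigma0).2; exact: zero_face (pc _ Sigma0).
Qed.

Lemma zero_cone_good_ext (A : comNzRingType) :
  good_ext A (monoid_alg A (dual_monoid N [set 0])).
Proof.
have [_ _ [b [hb _]]] := N_struct.
(* As the cone of the empty subset of a basis, the zero cone is regular. *)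
have -> : [set 0] = cone set0 :> set V.
  apply/seteqP; split => [v ->|]; first exact: cone0.
  move=> v [s [c [hs _ ->]]]; rewrite big1 // => i _.
  by have := hs s`_i (mem_nth _ (ltn_ord i)).
exact: (regular_cone_good_ext N_struct hb (@sub0set _ _)).
Qed.

(** Noetherianity has to come before (R_k), as [good_ext] presupposes a noetherian base. The
    augmentation of the zero chart gives a smaller noetherian A', and the zero chart over A' then
    yields (R_k). *)
Lemma base_chart (s : S) : exists (A : comNzRingType) (j : lrs_hom (Spec_lrs A) S),
  [/\ noetherian A, has_Rk k A, open_immersion j & range j s].
Proof.
have [q [D [cover charts]]] := toric_charts.
have [A [j [oj [p _ jp]]]] := scheme_affine s.
have [h [oh _]] := charts _ A j zero_cone_mem oj.
have [e es] := augmentation A (dual_monoid N [set 0]).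
have [A' [m [nA' om mp]]] := noetherian_descent p rX.1 oh es.
have oj' := open_comp_hom oj om.
have [h' [oh' _]] := charts _ A' _ zero_cone_mem oj'.
exists A', (comp_hom j m); split => //.
  have [_ gk] := zero_cone_good_ext nA'; apply/gk; exact: has_R_chart rX oh'.
by have [y _ my] := mp; exists y => //; rewrite /= /comp_fun my.
Qed.

Lemma base_has_R : has_R k S.
Proof. exact: has_R_intro base_chart. Qed.

(** The bound on k serves the distinguished point, whose height is at most dim V; at the minimal
    prime of A any k will do. *)
Lemma fan_regular : (\dim {:V} <= k)%N -> S -> regular_fan N Sigma.
Proof.
move=> nk s sigma hsigma; have [q [D [_ charts]]] := toric_charts.
have [_ /(_ _ hsigma) pc _] := Sigma_fan.
have [A [j [nA rA oj [p0 _ _]]]] := base_chart s.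
have [p [_ p1]] := exists_minimal_pt (p0 : Spec_pt A) nA.
have rp : regular_local_ring (loc p).
  by apply: rA; apply/krull_dim_le_loc => hp; apply: p1; apply: ht_le hp.
have [F [phi lk]] := minimal_residue_field p1 rp.
have [h [oh _]] := charts _ A j hsigma oj; have rB := has_R_chart rX oh.
have [r [rN e nl]] := polycone_seq pc; subst sigma.
have lk' := coef_map_loc_like (dual_monoid N (cone [set` r])) (pt1 p) (@ptMn _ p) lk.
have [_ _ [b [hb sb]]] := N_struct.
apply: (regular_criterion N_struct rN nl hb (F := F)).
(* F[P] is a localization of A[P], so (R_k) passes to the distinguished point, and [toric_dim]
   bounds the height there. *)
apply: (loc_like_Rk_at k (dist_pt F _) lk').1; first exact: rB.
apply/krull_dim_le_loc => /ht_le hd.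
by apply: (toric_dim N_struct hb (Q := dist_pt F _)); apply: hd; rewrite sb ltnS.
Qed.

End Converse.

Lemma toric_empty k : empty_scheme S \/ Sigma = set0 -> has_R k X.
Proof.
move=> h; have [q [D [cover _]]] := toric_charts; apply: has_R_intro => x.
case: h => [S0|e]; last by have [sigma] := cover x; rewrite e.
by have : [set: S] (q x) by []; rewrite S0.
Qed.

End Toric.

Theorem mainTheorem17 (R : realType) (V : vectType R) (n : nat)
    (dimV : \dim {:V} = n) (N : set V) (N_struct : Zstructure N)
    (Sigma : set (set V)) (Sigma_fan : fan N Sigma)
    (S X : scheme) (X_toric : toric_scheme N Sigma S X) :
  (forall k : nat,
     (has_R k S /\ regular_fan N Sigma \/ empty_scheme S \/ Sigma = set0 ->
        has_R k X) /\
     ((n <= k)%N -> has_R k X ->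
        has_R k S /\ regular_fan N Sigma \/ empty_scheme S \/ Sigma = set0)) /\
  (regular_scheme X <->
     regular_scheme S /\ regular_fan N Sigma \/
     empty_scheme S \/ Sigma = set0).
Proof.
have fwd k : has_R k S /\ regular_fan N Sigma \/ empty_scheme S \/ Sigma = set0 -> has_R k X.
  move=> [[rS rSigma]|]; [exact: (toric_has_R N_struct X_toric)|exact: (toric_empty X_toric)].
have bwd k : (n <= k)%N -> has_R k X ->
    has_R k S /\ regular_fan N Sigma \/ empty_scheme S \/ Sigma = set0.
  move=> nk rX; have [->|/set0P [sigma0 Sigma0]] := eqVneq Sigma set0; first by right; right.
  have [S0|/set0P [s _]] := eqVneq [set: S] set0; first by right; left.
  left; split; first exact: (base_has_R N_struct Sigma_fan X_toric Sigma0 rX).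
  apply: (fan_regular N_struct Sigma_fan X_toric Sigma0 rX) s; by rewrite dimV.
split=> [k|]; first by split; [exact: fwd|exact: bwd].
split=> [rX|[[rS rSigma]|h] k]; [|by apply: fwd; left|by apply: fwd; right].
have [[_ rSigma]|] := bwd n (leqnn n) (rX n); last by right.
have [h|h] := pselect (empty_scheme S \/ Sigma = set0); first by right.
left; split => // k.
(* The converse in a) is available from n on, so (R_k) of S for small k is deduced from a larger
   exponent. *)
have [[+ _]|//] := bwd (maxn k n) (leq_maxr k n) (rX _).
by apply: has_R_le; exact: leq_maxl.
Qed.
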